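(* Let $p_0$ be the unique real root of the polynomial $4x^3-7x^2+5x-1$ (so $p_0\approx 0.312$). Then: (i) If $p\in(0,p_0)$ is a constant, or if $p=n^{\gamma}$ where $\gamma\in(-1/3,0)$ is a constant, then $bp(G_{n,p})=n-\alpha(G_{n,p})$ with high probability. (ii) For every constant $p$ with $p_0\le p<1/2$ there is a constant $C_p>0$ such that $bp(G_{n,p})\ge n-C_p\,\alpha(G_{n,p})$ with high probability, i.e. $bp(G_{n,p})=n-O(\alpha(G_{n,p}))$ whp. (iii) For every constant $p$ with $p_0<p<1/2$ there exists a constant $c_p>0$ such that $bp(G_{n,p})\le n-(1+c_p)\alpha(G_{n,p})$ with high probability.
   Context: $G_{n,p}$ is the Erdős–Rényi random graph on vertex set $[n]$ in which each pair is an edge independently with probability $p$. ''With high probability'' (whp) means with probability tending to $1$ as $n\to\infty$. For a graph $G$, $\alpha(G)$ is the maximum size of an independent set, and the biclique partition number $bp(G)$ is the minimum number of pairwise edge-disjoint complete bipartite subgraphs (bicliques) of $G$ such that every edge of $G$ lies in exactly one of them. *)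

(* Defs.v *)
From HB Require Import structures.
From mathcomp Require Import all_boot all_order all_algebra.
From mathcomp Require Import all_classical all_reals all_analysis.
Set Implicit Arguments. Unset Strict Implicit. Unset Printing Implicit Defensive.
Import Order.TTheory GRing.Theory Num.Theory numFieldNormedType.Exports.
Local Open Scope ring_scope.
Local Open Scope classical_set_scope.

(* Potential edges of a graph on [n] = 'I_n: ordered pairs (i,j) with i < j.
   A (simple) graph on 'I_n is an edge set E \subset upper_pairs n. *)
Definition upper_pairs (n : nat) : {set 'I_n * 'I_n} :=
  [set u : 'I_n * 'I_n | (u.1 < u.2)%N].

Definition adj (n : nat) (E : {set 'I_n * 'I_n}) (x y : 'I_n) : bool :=
  ((x, y) \in E) || ((y, x) \in E).

Definition independent (n : nat) (E : {set 'I_n * 'I_n}) (S : {set 'I_n}) : bool :=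
  [forall x in S, forall y in S, ~~ adj E x y].

Definition alpha (n : nat) (E : {set 'I_n * 'I_n}) : nat :=
  \max_(S : {set 'I_n} | independent E S) #|S|.

Definition is_biclique (n : nat) (E : {set 'I_n * 'I_n}) (AB : {set 'I_n} * {set 'I_n}) : bool :=
  [disjoint AB.1 & AB.2] && [forall a in AB.1, forall b in AB.2, adj E a b].

Definition in_biclique (n : nat) (AB : {set 'I_n} * {set 'I_n}) (x y : 'I_n) : bool :=
  ((x \in AB.1) && (y \in AB.2)) || ((y \in AB.1) && (x \in AB.2)).

Definition bp_le (n : nat) (E : {set 'I_n * 'I_n}) (k : nat) : bool :=
  [exists F : k.-tuple ({set 'I_n} * {set 'I_n}),
     [forall i : 'I_k, is_biclique E (tnth F i)] &&
     [forall x : 'I_n, forall y : 'I_n,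
        ((x < y)%N && adj E x y) ==>
        ((\sum_(i < k) (in_biclique (tnth F i) x y : nat))%N == 1%N)]].

(* biclique partition number: least k with a partition into k bicliques.
   (A partition into single edges always exists, with k <= n*n, so the
   search range 0..n*n is exhaustive.) *)
Definition bp (n : nat) (E : {set 'I_n * 'I_n}) : nat :=
  find (bp_le E) (iota 0 (n * n).+1).

Definition Gnp_prob {R : realType} (n : nat) (p : R)
    (A : pred {set 'I_n * 'I_n}) : R :=
  \sum_(E : {set 'I_n * 'I_n} | (E \subset upper_pairs n) && A E)
     p ^+ #|E| * (1 - p) ^+ (#|upper_pairs n| - #|E|).

Definition whp {R : realType} (P : nat -> R) : Prop :=
  P n @[n --> \oo] --> (1 : R).

Arguments Gnp_prob {R} n p A.

(* Main.v *)
(* Emptying a partition into bicliques of its stars leaves m vertices whose induced graph is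
   partitioned by f bicliques with both sides of size at least two, where m - f >= n - bp, and
   conversely any such induced partition yields bp <= n - (m - f); independent sets are the
   case f = 0.

   (i) For a fixed list of edge-disjoint bicliques, the probability that they partition the graph
   induced by m given vertices is (1 - p)^(m choose 2) rho^(number of edges), rho = p / (1 - p).
   Summing rho^(|A| |B|) over the possible bicliques gives about (1 + rho^2)^m, which is beaten
   by the factor (1 - p)^(m/2) lost by the expected number of independent sets for each
   additional vertex exactly when (1 + rho^2)^2 (1 - p) < 1, that is, when
   4p^3 - 7p^2 + 5p - 1 < 0. A second moment computation shows that the maximum size of
   an independent set is at the threshold of this expectation.

   (ii) A biclique both sides of which are larger than a constant K costs only rho^K per vertex in
   the union bound. If all smaller sides have at most K vertices, then few vertices (the hubs)
   lie in many of them, hence few edges are covered by bicliques whose smaller side meets a hub,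
   whereas a random graph has many edges that no other biclique can cover. By Harris' inequality
   and bounded differences this fails with probability at most exp (- eps m^2), which pays for
   all the choices of bicliques.

   (iii) An induced bipartite graph with parts of r and 2t vertices, the second part being split
   into t pairs of twins, is partitioned by t bicliques, so that bp <= n - (r + t). Such a graph
   is found by the second moment method, and r + t can exceed alpha by a constant factor
   when p^2 + (1 - p)^2 > (1 - p)^(3/2), that is, when the cubic is positive. *)

Require Import Defs.
From HB Require Import structures.
From mathcomp Require Import all_boot all_order all_algebra.
From mathcomp Require Import all_classical all_reals all_analysis.
(* [fintype] and [finset] come again, to prevail over the homonyms of [classical_sets]. *)
From mathcomp Require Import fintype finset bigop ring lra zify.
Set Implicit Arguments. Unset Strict Implicit. Unset Printing Implicit Defensive.
Import Order.TTheory GRing.Theory Num.Theory.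
Local Open Scope ring_scope.

(** * Random subsets *)

(** In (i), the size [k] that [alpha] reaches is defined by an expected number of independent sets
    near [n ^ (d/2)] rather than 1, because the second moment method needs this expectation to be
    large. The price is up to [n ^ (d/2)] expected independent sets of size [k + 1]. The strict
    inequality on [p] pays for it: each biclique then costs a factor of order [n ^ (- d)]. The
    exponent -1/3 comes from the second moment: exchanging one vertex of an independent set
    contributes a factor of about [k ^ 3 / n], which has to be small.

    In (ii), only the smaller sides of the bicliques with a small side are enumerated, which costs
    [exp (O (m log m))]. Their larger sides stay existentially quantified, and the concentration
    argument bounds the probability that any choice of them completes the partition.

    In (iii), the log-correlation of two copies of the bipartite template is quadratic in their
    overlap. It is bounded by [(1 - de) log n] per shared vertex; the sum over all copies then
    factors over the vertices of the template. *)

Lemma eq_ler d (R : porderType d) (x y : R) : x = y -> (x <= y)%O.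
Proof. by move=> ->. Qed.

Lemma setU1_ind (T : finType) (P : {set T} -> Prop) :
  P set0 -> (forall e (D : {set T}), e \notin D -> P D -> P (e |: D)) ->
  forall D, P D.
Proof.
move=> P0 PU D; have [k] := ubnP #|D|; elim: k D => // k IH D ltDk.
have [->//|/set0Pn[e eD]] := eqVneq D set0.
rewrite -(setD1K eD); apply: PU; first by rewrite !inE eqxx.
by apply: IH; move: ltDk; rewrite (cardsD1 e D) eD.
Qed.

Section RandomSubset.
Variables (R : realType) (T : finType) (p : R).
Implicit Types (D E L : {set T}) (f g : {set T} -> R).

(** Expectation over a random subset of density [p]. The ground set [D] is arbitrary so that the
    coordinates can be revealed one at a time. *)
Definition mu (D : {set T}) (f : {set T} -> R) : R :=
  \sum_(E : {set T} | E \subset D) p ^+ #|E| * (1 - p) ^+ (#|D| - #|E|) * f E.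

Lemma mu_set0 f : mu set0 f = f set0.
Proof.
rewrite /mu (big_pred1 set0) => [|E]; last by rewrite /= subset0.
by rewrite cards0 !expr0 !mul1r.
Qed.

Lemma mu_setU1 e (D : {set T}) f : e \notin D ->
  mu (e |: D) f = (1 - p) * mu D f + p * mu D (fun E => f (e |: E)).
Proof.
move=> eD; rewrite /mu (bigID (fun E : {set T} => e \in E)) /= addrC.
congr (_ + _).
  rewrite big_distrr /=; apply: eq_big => [E|E /andP[EeD eE]].
    apply/andP/idP => [[EeD eE]|ED]; last first.
      by split; [apply: subset_trans ED (subsetUr _ _) | apply: contra eD; apply: (subsetP ED)].
    by apply/subsetP => x xE; move/subsetP: EeD => /(_ x xE) /setU1P[xe|//]; rewrite -xe xE in eE.
  have ED : E \subset D.
    by apply/subsetP => x xE; move/subsetP: EeD => /(_ x xE) /setU1P[xe|//]; rewrite -xe xE in eE.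
  rewrite cardsU1 eD add1n subSn ?subset_leq_card // exprS; ring.
rewrite (reindex_onto (fun E => e |: E) (fun E => E :\ e)) /=; last first.
  by move=> E /andP[_ eE]; rewrite setD1K.
rewrite big_distrr /=; apply: eq_big => [E|E].
  rewrite setU11 andbT; apply/andP/idP => [[EeD /eqP eE]|ED].
    rewrite -eE; apply/subsetP => x; rewrite !inE => /andP[xe].
    by move=> xE; move/subsetP: EeD => /(_ x); rewrite !inE xE => /(_ isT); rewrite (negPf xe).
  split; first exact: setUS.
  rewrite setU1K //; apply: contra eD; exact: (subsetP ED).
move=> /andP[/andP[EeD _] /eqP eE].
have eNE : e \notin E by rewrite -eE !inE eqxx.
rewrite !cardsU1 eD eNE !add1n subSS exprS; ring.
Qed.

Lemma eq_mu D f g : (forall E : {set T}, E \subset D -> f E = g E) -> mu D f = mu D g.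
Proof. by move=> fg; apply: eq_bigr => E ED; rewrite fg. Qed.

Lemma muD D f g : mu D (fun E => f E + g E) = mu D f + mu D g.
Proof. by rewrite /mu -big_split; apply: eq_bigr => E _; rewrite mulrDr. Qed.

Lemma muZ D a f : mu D (fun E => a * f E) = a * mu D f.
Proof. by rewrite /mu big_distrr; apply: eq_bigr => E _ /=; rewrite mulrCA. Qed.

Lemma mu_sum D (I : Type) (r : seq I) (P : pred I) (F : I -> {set T} -> R) :
  mu D (fun E => \sum_(i <- r | P i) F i E) = \sum_(i <- r | P i) mu D (F i).
Proof.
by rewrite /mu exchange_big /=; apply: eq_bigr => E _; rewrite big_distrr.
Qed.

Lemma mu_cst D a : mu D (fun=> a) = a.
Proof.
elim/setU1_ind: D => [|e D eD IH]; first by rewrite mu_set0.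
by rewrite mu_setU1 // IH; ring.
Qed.

Lemma mu_split D1 D2 f : [disjoint D1 & D2] ->
  mu (D1 :|: D2) f = mu D2 (fun E2 => mu D1 (fun E1 => f (E1 :|: E2))).
Proof.
elim/setU1_ind: D2 f => [|e D eD IH] f dis.
  rewrite mu_set0 setU0; apply: eq_mu => E _; by rewrite setU0.
have [eD1 dis'] : e \notin D1 /\ [disjoint D1 & D].
  split; first by apply: contraL dis => eD1; apply/pred0Pn; exists e; rewrite /= eD1 setU11.
  by apply: disjointWr dis; exact: subsetUr.
rewrite setUCA mu_setU1 ?inE ?negb_or ?eD1 // mu_setU1 // !IH //.
congr (_ + _ * _); apply: eq_mu => E2 _; apply: eq_mu => E1 _; by rewrite setUCA.
Qed.

Lemma mu_marginal D1 D f : D1 \subset D -> mu D (fun E => f (E :&: D1)) = mu D1 f.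
Proof.
move=> sD; rewrite -{1}(setID D D1) (setIidPr sD) mu_split; last first.
  by rewrite disjoint_sym disjoints_subset; apply/subsetP => x; rewrite !inE => /andP[].
rewrite -[RHS](mu_cst (D :\: D1)); apply: eq_mu => E2 /subsetP E2s.
apply: eq_mu => E1 /subsetP E1s; congr f; apply/setP => x; rewrite !inE.
case: (boolP (x \in E1)) => [/E1s -> //|_] /=.
by case: (boolP (x \in E2)) => // /E2s; rewrite !inE => /andP[/negPf ->].
Qed.

Hypothesis p01 : 0 <= p <= 1.

Let p_ge0 : 0 <= p. Proof. by case/andP: p01. Qed.
Let q_ge0 : 0 <= 1 - p. Proof. by rewrite subr_ge0; case/andP: p01. Qed.

Lemma le_mu D f g : (forall E : {set T}, E \subset D -> f E <= g E) -> mu D f <= mu D g.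
Proof.
move=> fg; apply: ler_sum => E ED; apply: ler_wpM2l; last exact: fg.
by rewrite mulr_ge0 // exprn_ge0.
Qed.

Lemma mu_ge0 D f : (forall E : {set T}, E \subset D -> 0 <= f E) -> 0 <= mu D f.
Proof. by move=> f0; rewrite -(mu_cst D 0); exact: le_mu. Qed.

Lemma mu_eq0 D : mu D (fun E => (E == set0)%:R) = (1 - p) ^+ #|D|.
Proof.
rewrite /mu (bigD1 set0) ?sub0set //= big1 => [|E /andP[_ /negPf ->]]; last by rewrite mulr0.
by rewrite cards0 expr0 eqxx subn0 mul1r mulr1 addr0.
Qed.

Lemma mu_disjoint D D' : D' \subset D ->
  mu D (fun E => [disjoint E & D']%:R) = (1 - p) ^+ #|D'|.
Proof.
move=> sD; rewrite -mu_eq0 -(mu_marginal _ sD).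
by apply: eq_mu => E _; rewrite -setI_eq0.
Qed.

(** Removing [L] from a set that contains it divides the weight of the set by
    [(p / (1 - p)) ^ #|L|], and this removal is injective. It reaches only the sets that miss [L],
    whence an inequality. *)
Lemma mu_plant D L g : p < 1 -> L \subset D -> (forall E, 0 <= g E) ->
  mu D (fun E => (L \subset E)%:R * g (E :\: L)) <= (p / (1 - p)) ^+ #|L| * mu D g.
Proof.
move=> p1; have q0 : 0 < 1 - p by rewrite subr_gt0.
elim/setU1_ind: L D => [|e L eL IH] D LD g0.
  rewrite cards0 expr0 mul1r; apply: le_mu => E _; by rewrite sub0set mul1r setD0.
have eD : e \in D by apply: (subsetP LD); rewrite setU11.
have LD' : L \subset D :\ e.
  by rewrite subsetD1 eL andbT; apply: subset_trans LD; exact: subsetUr.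
have eN : e \notin D :\ e by rewrite !inE eqxx.
rewrite -(setD1K eD) !mu_setU1 // (eq_mu (g := fun=> 0)); last first.
  move=> E /subsetP ED; rewrite subUset sub1set.
  case: (boolP (e \in E)) => [/ED|_]; first by rewrite !inE eqxx.
  by rewrite mul0r.
rewrite mu_cst mulr0 add0r.
rewrite (eq_mu (g := fun E => (L \subset E)%:R * g (E :\: L))); last first.
  move=> E /subsetP ED; have eE : e \notin E by apply/negP => /ED; rewrite !inE eqxx.
  congr (_%:R * g _).
    by rewrite subUset sub1set setU11 /= -[in RHS](setU1K eE) subsetD1 eL andbT.
  apply/setP => x; rewrite !inE; case: (eqVneq x e) => //= ->.
  by rewrite (negPf eE) andbF.
rewrite cardsU1 eL exprS mulrDr.
apply: (@le_trans _ _ (p * ((p / (1 - p)) ^+ #|L| * mu (D :\ e) g))).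
  by rewrite ler_wpM2l // IH.
set X := _ ^+ _; have X0 : 0 <= X by rewrite exprn_ge0 // divr_ge0.
have m0 : 0 <= mu (D :\ e) g by apply: mu_ge0.
have m1 : 0 <= mu (D :\ e) (fun E => g (e |: E)) by apply: mu_ge0.
rewrite (_ : p / (1 - p) * X * ((1 - p) * mu (D :\ e) g) = p * (X * mu (D :\ e) g)); last first.
  by field; rewrite gt_eqF.
by rewrite lerDl !mulr_ge0 // invr_ge0 ltW.
Qed.

(** Averaging over one coordinate preserves monotonicity, and the covariance due to a single
    coordinate is [p (1 - p)] times the product of the two decrements. *)
Lemma harris D (f g : {set T} -> R) :
  (forall E e, f (e |: E) <= f E) -> (forall E e, g (e |: E) <= g E) ->
  mu D f * mu D g <= mu D (fun E => f E * g E).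
Proof.
elim/setU1_ind: D f g => [|e D eD IH] f g fd gd; first by rewrite !mu_set0.
have E2 h : mu (e |: D) h = mu D (fun E => (1 - p) * h E + p * h (e |: E)).
  by rewrite mu_setU1 // muD !muZ.
rewrite !E2; apply: le_trans (IH _ _ _ _) _.
- by move=> E x; apply: lerD; apply: ler_wpM2l => //; rewrite setUCA.
- by move=> E x; apply: lerD; apply: ler_wpM2l => //; rewrite setUCA.
apply: le_mu => E _; rewrite -subr_ge0.
have -> : (1 - p) * (f E * g E) + p * (f (e |: E) * g (e |: E)) -
  ((1 - p) * f E + p * f (e |: E)) * ((1 - p) * g E + p * g (e |: E)) =
  ((1 - p) * p) * ((f E - f (e |: E)) * (g E - g (e |: E))) by ring.
by rewrite !mulr_ge0 // subr_ge0.
Qed.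

Lemma expR_le_quad (y : R) : y <= 1 / 2 -> expR y <= 1 + y + 2 * y ^+ 2.
Proof.
move=> y2; have y1 : 0 < 1 - y by lra.
have : 1 - y <= expR (- y) by rewrite -[1 - y]/(1 + - y); exact: expR_ge1Dx.
rewrite expRN => H.
have H2 : expR y <= (1 - y)^-1.
  by rewrite -[leLHS]invrK lef_pV2 ?posrE ?invr_gt0 ?expR_gt0.
apply: le_trans H2 _; rewrite -div1r ler_pdivrMr //.
have -> : (1 + y + 2 * y ^+ 2) * (1 - y) = 1 + y ^+ 2 * (1 - 2 * y) by ring.
rewrite lerDl mulr_ge0 ?sqr_ge0 //; lra.
Qed.

(** Averaging [f] over one coordinate keeps the differences below [c]. The deviation from that
    average has mean zero, so the quadratic bound on the exponential gives a factor
    [1 + 2 (l c) ^ 2] per coordinate. *)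
Lemma bounded_difference_mgf D (c l : R) (f : {set T} -> R) : 0 <= l -> 0 <= c ->
  l * c <= 1 / 2 ->
  (forall E e, e \in D -> `|f (e |: E) - f E| <= c) ->
  mu D (fun E => expR (- l * f E)) <=
  expR (- l * mu D f + #|D|%:R * (2 * (l * c) ^+ 2)).
Proof.
move=> l0 c0 lc; elim/setU1_ind: D f => [|e D eD IH] f fL.
  by rewrite !mu_set0 cards0 mul0r addr0.
have E2 h : mu (e |: D) h = mu D (fun E => (1 - p) * h E + p * h (e |: E)).
  by rewrite mu_setU1 // muD !muZ.
set h := fun E => (1 - p) * f E + p * f (e |: E).
have := IH h; rewrite !E2 -/h => /(_ _) IHh.
apply: (@le_trans _ _ (expR (2 * (l * c) ^+ 2) * mu D (fun E => expR (- l * h E)))).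
  rewrite -muZ; apply: le_mu => E _.
  set u := f E; set v := f (e |: E).
  have dv : `|v - u| <= c by apply: fL; rewrite setU11.
  have /andP[dv1 dv2] : - c <= v - u <= c by rewrite -ler_norml.
  have ld : l * `|v - u| <= l * c by apply: ler_wpM2l.
  have b1 : `|l * (v - u)| <= l * c by rewrite normrM (ger0_norm l0).
  have sq : (l * (v - u)) ^+ 2 <= (l * c) ^+ 2.
    by rewrite -[(l * (v - u)) ^+ 2]real_normK ?num_real // lerXn2r ?nnegrE // mulr_ge0.
  have /andP[b2 b3] : - (l * c) <= l * (v - u) <= l * c by rewrite -ler_norml.
  have [pp0 pp1] : 0 <= p /\ p <= 1 by case/andP: p01.
  have e1 : expR (p * (l * (v - u))) <= 1 + p * (l * (v - u)) + 2 * (p * (l * (v - u))) ^+ 2.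
    by apply: expR_le_quad; nra.
  have e2 : expR (- (1 - p) * (l * (v - u))) <=
     1 + (- (1 - p) * (l * (v - u))) + 2 * (- (1 - p) * (l * (v - u))) ^+ 2.
    by apply: expR_le_quad; nra.
  have -> : - l * u = - l * h E + p * (l * (v - u)) by rewrite /h -/u -/v; ring.
  have -> : - l * v = - l * h E + - (1 - p) * (l * (v - u)) by rewrite /h -/u -/v; ring.
  rewrite !expRD; move: (expR (p * _)) (expR (- (1 - p) * _)) e1 e2 => a1 a2 e1 e2.
  have -> : (1 - p) * (expR (- l * h E) * a1) + p * (expR (- l * h E) * a2) =
    expR (- l * h E) * ((1 - p) * a1 + p * a2) by ring.
  rewrite [leRHS]mulrC ler_wpM2l ?expR_ge0 //.
  apply: (@le_trans _ _ (1 + 2 * (l * c) ^+ 2)); last exact: expR_ge1Dx.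
  set d := l * (v - u) in e1 e2 sq *.
  (* The linear terms cancel: the deviations [p d] and [- (1 - p) d] have weights [1 - p] and
     [p]. *)
  apply: (@le_trans _ _ (1 + (2 * (p * (1 - p))) * d ^+ 2)).
    apply: (@le_trans _ _ ((1 - p) * (1 + p * d + 2 * (p * d) ^+ 2) + p * (1 + (- (1 - p) * d) + 2 * (- (1 - p) * d) ^+ 2))).
      by rewrite lerD // ler_wpM2l.
    by apply: eq_ler; ring.
  rewrite lerD2l; apply: (@le_trans _ _ (2 * d ^+ 2)); last by rewrite ler_wpM2l.
  by rewrite ler_wpM2r ?sqr_ge0 //; nra.
move: IHh; set X := 2 * _ => IHh.
rewrite cardsU1 eD add1n -natr1 mulrDl mul1r addrA expRD mulrC ler_wpM2r ?expR_ge0 //.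
apply: IHh => E x xD; rewrite /h.
have -> : (1 - p) * f (x |: E) + p * f (e |: (x |: E)) - ((1 - p) * f E + p * f (e |: E))
   = (1 - p) * (f (x |: E) - f E) + p * (f (x |: (e |: E)) - f (e |: E)).
  by rewrite setUCA; ring.
apply: le_trans (ler_normD _ _) _.
have xD' : x \in e |: D by rewrite inE xD orbT.
rewrite !normrM (ger0_norm p_ge0) (ger0_norm q_ge0).
have := ler_wpM2l q_ge0 (fL E x xD'); have := ler_wpM2l p_ge0 (fL (e |: E) x xD').
lra.
Qed.

Lemma mu_lower_tail D (c t : R) (f : {set T} -> R) : 0 < c -> 0 <= t ->
  t <= #|D|%:R * c -> (0 < #|D|)%N ->
  (forall E e, e \in D -> `|f (e |: E) - f E| <= c) ->
  mu D (fun E => (f E <= mu D f - t)%R%:R) <= expR (- (t ^+ 2 / (8 * #|D|%:R * c ^+ 2))).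
Proof.
move=> c0 t0 tN N0 fL; set N : R := #|D|%:R.
have N0' : 0 < N by rewrite ltr0n.
(* This minimises the exponent [- l t + 2 N (l c) ^ 2]; the hypothesis [t <= N c] gives
   [l c <= 1 / 4]. *)
pose l := t / (4 * N * c ^+ 2).
have l0 : 0 <= l by rewrite divr_ge0 // !mulr_ge0 // ?ltW // exprn_gt0.
have lc : l * c = t / (4 * N * c) by rewrite /l; field; rewrite !gt_eqF.
have lc2 : l * c <= 1 / 2.
  rewrite lc ler_pdivrMr ?mulr_gt0 //; rewrite -/N in tN.
  have := mulr_gt0 N0' c0; lra.
have M := bounded_difference_mgf l0 (ltW c0) lc2 fL.
apply: (@le_trans _ _ (expR (l * (mu D f - t)) * mu D (fun E => expR (- l * f E)))).
  rewrite -muZ; apply: le_mu => E _; rewrite -expRD; case: (boolP (f E <= _)) => [H|_]; last exact: expR_ge0.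
  rewrite -[leLHS]expR0 ler_expR; have := ler_wpM2l l0 H; lra.
apply: (le_trans (ler_wpM2l (expR_ge0 _) M)).
rewrite -expRD ler_expR lc -/N /l; apply: eq_ler; field; by rewrite !gt_eqF.
Qed.

End RandomSubset.

(** * Biclique decompositions *)

Lemma sum_tnth_count (T : Type) k (F : k.-tuple T) (P : pred T) :
  (\sum_(i < k) (P (tnth F i) : nat))%N = count P F.
Proof. by rewrite -sum1_count big_tuple [RHS]big_mkcond; apply: eq_bigr => i _; case: (P _). Qed.

Section Decompositions.
Variable n : nat.
Implicit Types (x y z : 'I_n) (E : {set 'I_n * 'I_n}) (A B M : {set 'I_n}) (AB : {set 'I_n} * {set 'I_n})
  (s : seq ({set 'I_n} * {set 'I_n})).

Definition pairs M := [set u in upper_pairs n | (u.1 \in M) && (u.2 \in M)].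

Definition bedges AB := [set u in upper_pairs n | in_biclique AB u.1 u.2].

(** The case [x = y] is included on purpose: no vertex is adjacent to itself, so the two sides of
    each biclique are disjoint within [M]. Only the traces of the bicliques on [M] matter. *)
Definition decomposes E M s := forall x y, x \in M -> y \in M ->
  count (fun AB => in_biclique AB x y) s = adj E x y :> nat.

Definition nonstar M AB := (1 < #|AB.1 :&: M|)%N && (1 < #|AB.2 :&: M|)%N.

(** The first side is the smaller one: the union bounds split according to its size. *)
Definition proper_biclique M AB :=
  [&& AB.1 \subset M, AB.2 \subset M, [disjoint AB.1 & AB.2],
     (1 < #|AB.1|)%N & (#|AB.1| <= #|AB.2|)%N].

Lemma adjC E x y : adj E x y = adj E y x.
Proof. by rewrite /adj orbC. Qed.

Lemma in_bicliqueC AB x y : in_biclique AB x y = in_biclique AB y x.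
Proof. by rewrite /in_biclique orbC. Qed.

Lemma adj_irr E x : E \subset upper_pairs n -> adj E x x = false.
Proof.
move=> /subsetP EU; rewrite /adj orbb; apply/negP => /EU.
by rewrite inE ltnn.
Qed.

Lemma adjE E x y : E \subset upper_pairs n -> (x < y)%N -> adj E x y = ((x, y) \in E).
Proof.
move=> /subsetP EU xy; rewrite /adj; case: (boolP ((y, x) \in E)) => [/EU|]; last by rewrite orbF.
by rewrite inE /=; lia.
Qed.

(** A biclique with at most one vertex of [M] on some side covers nothing once that side is deleted
    from [M]. Dropping both does not decrease [#|M| - size s]. *)
Lemma decomposes_reduce E M s : E \subset upper_pairs n -> decomposes E M s ->
  exists M' s', [/\ decomposes E M' s', all (nonstar M') s' &
    (#|M| + size s' <= #|M'| + size s)%N].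
Proof.
move=> EU; have [k] := ubnP (size s); elim: k s M => // k IH s M szk dec.
have [ns|/allPn[AB ABs nns]] := boolP (all (nonstar M) s); first by exists M, s.
have [X [cX HX]] : exists X : {set 'I_n}, (#|X :&: M| <= 1)%N /\
    forall x y, x \notin X -> y \notin X -> in_biclique AB x y = false.
  move: nns; rewrite negb_and -!leqNgt => /orP[c1|c1].
    exists AB.1; split=> // x y /negPf x1 /negPf y1; by rewrite /in_biclique x1 y1.
  exists AB.2; split=> // x y /negPf x1 /negPf y1; by rewrite /in_biclique x1 y1 !andbF.
have szr : (size (rem AB s)).+1 = size s.
  by rewrite size_rem // prednK //; case: (s) ABs.
have [||M' [s' [d' n' sz']]] := IH (rem AB s) (M :\: X).
- by rewrite -ltnS szr.
- move=> x y; rewrite !inE => /andP[xX xM] /andP[yX yM].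
  rewrite -(dec x y xM yM); have /permP-> := perm_to_rem ABs.
  by rewrite /= HX.
exists M', s'; split=> //; rewrite -szr addnS.
have := cardsID X M; rewrite setIC => cX'; move: cX cX' sz'; move: #|X :&: M| #|M :\: X| #|M| #|M'| (size s') (size (rem AB s)).
lia.
Qed.

Definition orient M AB :=
  let A := AB.1 :&: M in let B := AB.2 :&: M in
  if (#|A| <= #|B|)%N then (A, B) else (B, A).

Lemma in_orient M AB x y : x \in M -> y \in M ->
  in_biclique (orient M AB) x y = in_biclique AB x y.
Proof.
move=> xM yM; rewrite /orient /in_biclique.
by case: ifP => _ /=; rewrite !inE xM yM !andbT // orbC [_ && (x \in _)]andbC [(y \in _) && _]andbC.
Qed.

Lemma decomposes_proper E M s : E \subset upper_pairs n -> decomposes E M s ->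
  all (nonstar M) s ->
  exists s', [/\ decomposes E M s', all (proper_biclique M) s' & size s' = size s].
Proof.
move=> EU dec ns; exists (map (orient M) s); split; last by rewrite size_map.
  move=> x y xM yM; rewrite count_map -(dec x y xM yM); apply: eq_count => AB /=.
  exact: in_orient.
apply/allP => _ /mapP[AB ABs ->].
have /andP[c1 c2] := allP ns _ ABs.
(* A common vertex [x] would give the pair [(x, x)] a positive count. *)
have dis : [disjoint AB.1 :&: M & AB.2 :&: M].
  rewrite -setI_eq0; apply/eqP/setP => x; rewrite !inE; apply/negP => /andP[/andP[x1 xM] /andP[x2 _]].
  have := dec x x xM xM; rewrite adj_irr //= => /eqP; rewrite -leqn0 leqNgt -has_count.
  by move/negP; apply; apply/hasP; exists AB; rewrite // /in_biclique x1 x2.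
rewrite /proper_biclique /orient; case: ifP => H /=.
  by rewrite !subsetIr dis c1 H.
by rewrite !subsetIr disjoint_sym dis c2 /=; move/negbT: H; rewrite -ltnNge => /ltnW.
Qed.

Lemma bp_le_decomposes E k : E \subset upper_pairs n -> bp_le E k ->
  exists s, size s = k /\ decomposes E setT s.
Proof.
move=> EU /existsP[F /andP[/forallP bicl /forallP part]].
have cnt x y : count (fun AB => in_biclique AB x y) F =
    (\sum_(i < k) (in_biclique (tnth F i) x y : nat))%N.
  by rewrite (sum_tnth_count F (fun AB => in_biclique AB x y)).
exists F; split; first by rewrite size_tuple.
have nb x y i : in_biclique (tnth F i) x y -> adj E x y.
  have /andP[_ /forallP H] := bicl i.
  move=> /orP[] /andP[x1 y1].
    by have /implyP/(_ x1)/forallP/(_ y)/implyP/(_ y1) := H x.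
  by have /implyP/(_ x1)/forallP/(_ x)/implyP/(_ y1) := H y; rewrite adjC.
have lt x y : (x < y)%N -> count (fun AB => in_biclique AB x y) F = adj E x y :> nat.
  move=> xy; rewrite cnt; case: (boolP (adj E x y)) => axy.
    by have /forallP/(_ y)/implyP := part x; rewrite xy axy => /(_ isT)/eqP.
  apply: big1 => i _; apply/eqP; rewrite eqb0; apply: contra axy; exact: nb.
move=> x y _ _; case: (ltngtP x y) => [||/val_inj <-]; first exact: lt.
  move=> /lt; rewrite adjC => <-; apply: eq_count => AB; exact: in_bicliqueC.
rewrite adj_irr // cnt; apply: big1 => i _; apply/eqP; rewrite eqb0.
by apply: contraT => /negbNE/nb; rewrite adj_irr.
Qed.

(** The partition inside [M] is completed by one star for each vertex outside [M]. The second
    conclusion says that the search defining [bp] succeeds. *)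
Lemma decomposes_bp E M s : E \subset upper_pairs n -> decomposes E M s ->
  (size s <= #|M|)%N ->
  (bp E <= n - #|M| + size s)%N /\ bp_le E (bp E).
Proof.
move=> EU dec szM; set k := (n - #|M| + size s)%N.
have Mn : (#|M| <= n)%N by rewrite -[X in (_ <= X)%N]card_ord max_card.
have kn : (k <= n)%N by rewrite /k; lia.
(* [k <= n <= n * n] puts [k] in the search range of [bp]. *)
have kk : (k < (n * n).+1)%N by rewrite ltnS; case: (n) kn => // n' H; nia.
suff ble : bp_le E k.
  have lt : (find (bp_le E) (iota 0 (n * n).+1) <= k)%N.
    rewrite leqNgt; apply/negP => /(before_find 0%N).
    by rewrite nth_iota // add0n ble.
  split=> //; rewrite /bp; set l := iota _ _ in lt *.
  have : (find (bp_le E) l < size l)%N by rewrite size_iota; lia.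
  move=> H; have := H; rewrite -has_find => /(nth_find 0%N).
  by rewrite nth_iota ?add0n // -[X in (_ < X)%N](size_iota 0).
(* An edge with both ends outside [M] is given to the star of its smaller end only. *)
pose star v := ([set v], [set u | adj E v u && ((u \in M) || (v < u)%N)]).
pose t := [seq (AB.1 :&: M, AB.2 :&: M) | AB <- s] ++ [seq star v | v <- enum (~: M)].
have szt : size t == k.
  rewrite size_cat !size_map -cardE; have := cardsC M; rewrite card_ord /k.
  by move=> H; rewrite addnC eqn_add2r -[X in (X - _)%N]H addKn.
have inM AB x y : in_biclique (AB.1 :&: M, AB.2 :&: M) x y =
    [&& x \in M, y \in M & in_biclique AB x y].
  rewrite /in_biclique /= !inE.
  by case: (x \in M); case: (y \in M); rewrite /= ?andbT ?andbF.
apply/existsP; exists (Tuple szt); apply/andP; split.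
  apply/forallP => i; have := mem_tnth i (Tuple szt); move: (tnth _ _) => AB.
  rewrite /= mem_cat => /orP[] /mapP[].
    move=> CD CDs ->; have H x y : x \in CD.1 :&: M -> y \in CD.2 :&: M -> adj E x y.
      rewrite !inE => /andP[x1 xM] /andP[y2 yM].
      have := dec x y xM yM; case: (adj E x y) => // /eqP; rewrite -leqn0 leqNgt -has_count.
      by move=> /negP[]; apply/hasP; exists CD => //; rewrite /in_biclique x1 y2.
    apply/andP; split => /=.
      rewrite -setI_eq0; apply/eqP/setP => x; rewrite in_set0 in_setI; apply/negP => /andP[x1 x2].
      by have := H x x x1 x2; rewrite adj_irr.
    by apply/forallP => x; apply/implyP => x1; apply/forallP => y; apply/implyP => y2; exact: H.
  move=> v _ ->; apply/andP; split => /=.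
    by rewrite disjoints1 inE adj_irr.
  apply/forallP => x; apply/implyP => /set1P ->; apply/forallP => y; apply/implyP.
  by rewrite inE => /andP[].
apply/forallP => x; apply/forallP => y; apply/implyP => /andP[xy axy].
have -> : (\sum_(i < k) (in_biclique (tnth (Tuple szt) i) x y : nat))%N =
   count (fun AB => in_biclique AB x y) t.
  exact: (sum_tnth_count (Tuple szt) (fun AB => in_biclique AB x y)).
rewrite count_cat !count_map.
have cst w : w \in ~: M -> count (pred1 w) (enum (~: M)) = 1%N.
  by move=> wM; rewrite count_uniq_mem ?enum_uniq // mem_enum wM.
have -> : count (preim (fun AB => (AB.1 :&: M, AB.2 :&: M)) (fun AB => in_biclique AB x y)) s
   = ((x \in M) && (y \in M) : nat).
  case: (boolP (x \in M)) => xM; case: (boolP (y \in M)) => yM; last first.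
  - by apply/eqP; rewrite -leqn0 leqNgt -has_count; apply/hasPn => AB _ /=; rewrite inM (negPf xM).
  - by apply/eqP; rewrite -leqn0 leqNgt -has_count; apply/hasPn => AB _ /=; rewrite inM (negPf xM).
  - by apply/eqP; rewrite -leqn0 leqNgt -has_count; apply/hasPn => AB _ /=; rewrite inM (negPf yM) andbF.
  transitivity (adj E x y : nat); last by rewrite axy.
  rewrite -(dec x y xM yM); apply: eq_count => AB /=; by rewrite inM xM yM.
have inS v : in_biclique (star v) x y =
   ((v == x) && ((y \in M) || (x < y)%N)) || ((v == y) && ((x \in M) || (y < x)%N)).
  rewrite /in_biclique /= !inE [x == v]eq_sym [y == v]eq_sym.
  case: (eqVneq v x) => [->|_]; last by case: (eqVneq v y) => [->|_] //=; rewrite [adj E y x]adjC axy.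
  case: (eqVneq x y) => [e|_]; first by move: axy; rewrite e adj_irr.
  by rewrite axy /= !orbF.
have xy' : (y < x)%N = false by lia.
case: (boolP (x \in M)) => xM.
  case: (boolP (y \in M)) => yM /=.
    rewrite [count _ _](_ : _ = 0%N) //; apply/eqP; rewrite -leqn0 leqNgt -has_count.
    apply/hasPn => v; rewrite mem_enum inE => vM /=; rewrite inS.
    by case: eqP vM => [->|_]; [rewrite xM|case: eqP => [->|//]; rewrite yM].
  rewrite -(cst y) ?inE // add0n; apply/eqP; apply: eq_in_count => v; rewrite mem_enum inE => vM /=.
  rewrite inS xM andbT; case: eqP vM => [->|_] //; by rewrite xM.
rewrite -(cst x) ?inE // add0n; apply/eqP; apply: eq_in_count => v; rewrite mem_enum inE => vM /=.
by rewrite inS xy xy' (negPf xM) orbT andbT andbF orbF.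
Qed.

Lemma independent_decomposes E M :
  independent E M <-> decomposes E M [::].
Proof.
split=> [/forallP ind x y xM yM|dec].
  have /implyP/(_ xM)/forallP/(_ y)/implyP/(_ yM)/negPf -> // := ind x.
apply/forallP => x; apply/implyP => xM; apply/forallP => y; apply/implyP => yM.
by have := dec x y xM yM; case: adj.
Qed.

Lemma independent_le_alpha E M : independent E M -> (#|M| <= alpha E)%N.
Proof. by move=> ind; apply: (leq_bigmax_cond (P := fun S => independent E S) (F := fun S => #|S|)). Qed.

Lemma alpha_witness E : exists2 M, independent E M & #|M| = alpha E.
Proof.
have i0 : independent E set0 by apply/forallP => x; rewrite inE.
have [|S iS] := @eq_bigmax_cond _ (fun S => independent E S) (fun S : {set 'I_n} => #|S|); last first.
  by move=> e; exists S; rewrite // /alpha e.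
by apply/card_gt0P; exists set0.
Qed.

Definition properly_decomposed E M f :=
  exists s, [/\ decomposes E M s, all (proper_biclique M) s & size s = f].

(** The maximum independent set serves only to know that [bp E] is attained; an optimal partition is
    then stripped of its stars. *)
Lemma bp_reduce E : E \subset upper_pairs n ->
  exists M f, properly_decomposed E M f /\ (n + f <= #|M| + bp E)%N.
Proof.
move=> EU; have [S iS cS] := alpha_witness E.
have [_ /(bp_le_decomposes EU)[s [szs dec]]] := decomposes_bp EU ((independent_decomposes _ _).1 iS) (leq0n _).
have [M [s' [d' n' sz']]] := decomposes_reduce EU dec.
have [s'' [d'' n'' sz'']] := decomposes_proper EU d' n'.
exists M, (size s''); split; first by exists s''.
by rewrite sz''; move: sz'; rewrite cardsT card_ord szs.
Qed.

Lemma bp_le_alpha E : E \subset upper_pairs n -> (bp E <= n - alpha E)%N.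
Proof.
move=> EU; have [S iS cS] := alpha_witness E.
have [] := decomposes_bp EU ((independent_decomposes _ _).1 iS) (leq0n _).
by rewrite cS addn0.
Qed.

(** [f = 0] is excluded because [M] would then be an independent set larger than [alpha E]. *)
Lemma bp_neq_alpha E : E \subset upper_pairs n -> bp E != (n - alpha E)%N ->
  exists M f, [/\ properly_decomposed E M f, (0 < f)%N & (alpha E + f < #|M|)%N].
Proof.
move=> EU ne; have [M [f [pd le]]] := bp_reduce EU.
have lt : (bp E < n - alpha E)%N by rewrite ltn_neqAle ne bp_le_alpha.
have fM : (alpha E + f < #|M|)%N by lia.
exists M, f; split=> //; rewrite lt0n; apply/eqP => f0; case: pd; rewrite f0 => s [dec _ /size0nil s0].
have := independent_le_alpha ((independent_decomposes E M).2 _); rewrite -s0 => /(_ dec).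
by lia.
Qed.

Lemma card_pairs M : #|pairs M| = 'C(#|M|, 2).
Proof.
elim/setU1_ind: M => [|e M eM IH].
  rewrite cards0 bin0n /=; apply: eq_card0 => u; by rewrite !inE /= andbF.
rewrite cardsU1 eM add1n binS bin1 -IH addnC.
pose h y := if (e < y)%N then (e, y) else (y, e).
have -> : pairs (e |: M) = pairs M :|: [set h y | y in M].
  apply/setP => -[x y]; rewrite !inE /=.
  apply/andP/orP => [[xy /andP[/orP[/eqP xe|xM] /orP[/eqP ye|yM]]]|].
  - by move: xy; rewrite xe ye ltnn.
  - by right; apply/imsetP; exists y => //; rewrite /h -xe xy.
  - by right; apply/imsetP; exists x => //; rewrite /h -ye ltnNge ltnW.
  - by left; rewrite xy xM yM.
  case=> [/and3P[xy xM yM]|/imsetP[z zM]]; first by rewrite xy xM yM !orbT.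
  have ez : e != z by apply: contraNneq eM => ->.
  rewrite /h; case: (ltngtP e z) => [ez' [-> ->]|ez' [-> ->]|/val_inj e']; rewrite ?ez' ?eqxx ?zM ?orbT //.
  by rewrite e' eqxx in ez.
rewrite cardsU card_in_imset; last first.
  move=> y z yM zM; rewrite /h.
  have ey : e != y by apply: contraNneq eM => ->.
  have ez : e != z by apply: contraNneq eM => ->.
  by case: ifP => _; case: ifP => _ [] // H1 H2; rewrite ?H1 ?H2 ?eqxx // -?H1 -?H2 ?eqxx // in ey ez.
rewrite [X in (_ - X)%N](_ : _ = 0%N) ?subn0 //; first exact: addnC.
apply: eq_card0 => -[x y]; rewrite !inE /=.
apply/negP => /andP[/and3P[xy xM yM] /imsetP[z zM]]; rewrite /h.
by case: ifP => _ [e1 e2]; rewrite ?e1 ?e2 (negPf eM) in xM yM.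
Qed.

Lemma pairs_sub M : pairs M \subset upper_pairs n.
Proof. by apply/subsetP => u; rewrite inE => /andP[]. Qed.

Lemma bedges_sub M AB : proper_biclique M AB -> bedges AB \subset pairs M.
Proof.
case/and5P => /subsetP s1 /subsetP s2 _ _ _; apply/subsetP => u.
by rewrite !inE => /andP[-> /orP[] /andP[/s1 -> /s2 ->]].
Qed.

Lemma card_bedges M AB : proper_biclique M AB -> #|bedges AB| = (#|AB.1| * #|AB.2|)%N.
Proof.
case/and5P => _ _ dis _ _; rewrite -cardsX.
pose h (u : 'I_n * 'I_n) := if (u.1 < u.2)%N then u else (u.2, u.1).
have dij x : x \in AB.1 -> x \in AB.2 -> False.
  by move=> x1 x2; move: dis; rewrite -setI_eq0 => /eqP/setP/(_ x); rewrite !inE x1 x2.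
have -> : bedges AB = [set h u | u in finset.setX AB.1 AB.2].
  apply/setP => -[x y]; rewrite !inE /=; apply/andP/imsetP.
    move=> [xy /orP[] /andP[H1 H2]].
      by exists (x, y); rewrite ?inE ?H1 ?H2 // /h /= xy.
    by exists (y, x); rewrite ?inE ?H1 ?H2 // /h /= ltnNge ltnW.
  move=> [[a b]]; rewrite inE /= => /andP[a1 b2]; rewrite /h /= /in_biclique.
  have ab : a != b by apply/eqP => ab; apply: (dij a) => //; rewrite ab.
  case: (ltngtP a b) => [ab' [-> ->]|ab' [-> ->]|/val_inj e]; rewrite ?a1 ?b2 ?orbT //.
  by rewrite e eqxx in ab.
rewrite card_in_imset // => -[a b] [a' b']; rewrite !inE /= => /andP[a1 b2] /andP[a1' b2'].
rewrite /h /=; case: ifP => _; case: ifP => _ [] e1 e2.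
- by rewrite e1 e2.
- by rewrite e1 in a1; case: (dij b').
- by rewrite e1 in b2; case: (dij a').
- by rewrite e1 e2.
Qed.

End Decompositions.

(** * First moment over biclique structures *)

Section UnionBound.
Variables (R : realType) (p : R) (n : nat).
Implicit Types (E : {set 'I_n * 'I_n}) (A B M : {set 'I_n}) (AB : {set 'I_n} * {set 'I_n}).

Lemma Gnp_probE (P : pred {set 'I_n * 'I_n}) :
  Gnp_prob n p P = mu p (upper_pairs n) (fun E => (P E)%:R).
Proof.
rewrite /Gnp_prob /mu [RHS](bigID P) /= [X in _ = _ + X]big1 ?addr0; last first.
  by move=> E /andP[_ /negPf ->]; rewrite mulr0.
by apply: eq_bigr => E /andP[_ ->]; rewrite mulr1.
Qed.

(** State of a partial exposure of the partition: [As] lists smaller sides already chosen, whose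
    partners [Bs] remain free, and [f] bicliques are still unexplored. *)
Definition tiled M (As : seq {set 'I_n}) f E :=
  exists Bs s, [/\ size Bs = size As, size s = f, all (proper_biclique M) s &
    decomposes E M (zip As Bs ++ s)].

Definition small_side M K A := [&& A \subset M, (1 < #|A|)%N & (#|A| < K)%N].

Definition large_biclique M K AB := proper_biclique M AB && (K <= #|AB.1|)%N.

(** Price of exposing one biclique: a small side is merely chosen, whereas a large biclique is
    chosen entirely and its edges are planted. *)
Definition weight M K : R := #|[set A | small_side M K A]|%:R +
  \sum_(AB | large_biclique M K AB) (p / (1 - p)) ^+ (#|AB.1| * #|AB.2|).

Lemma pairsP E M : E \subset pairs M -> E \subset upper_pairs n.
Proof. by move=> H; apply: subset_trans H (pairs_sub M). Qed.

(** Exposure of the next biclique. A small one is recorded in [As]; a large one is removed from the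
    graph, and what is left is still partitioned by the others. *)
Lemma tiledS M K As f E : E \subset pairs M -> tiled M As f.+1 E ->
  (exists2 A, small_side M K A & tiled M (A :: As) f E) \/
  (exists2 AB, large_biclique M K AB & bedges AB \subset E /\ tiled M As f (E :\: bedges AB)).
Proof.
move=> EM; have EU := pairsP EM.
case=> Bs [[|AB s] [szB // [szs] /= /andP[pAB ps] dec]].
have cnt x y : count (fun AB => in_biclique AB x y) (zip As Bs ++ AB :: s) =
   (in_biclique AB x y + count (fun AB => in_biclique AB x y) (zip As Bs ++ s))%N.
  by rewrite !count_cat /= addnCA.
have [lK|ltK] := leqP K #|AB.1|; last first.
  left; exists AB.1; first by case/and5P: pAB => s1 _ _ s2 _; rewrite /small_side s1 s2.
  exists (AB.2 :: Bs), s; split=> //=; first by rewrite szB.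
  move=> x y xM yM; rewrite -(dec x y xM yM) cnt /=.
  by congr (nat_of_bool _ + _)%N; case: AB {pAB dec cnt ltK}.
right; exists AB; first by rewrite /large_biclique pAB lK.
have bE : bedges AB \subset E.
  apply/subsetP => -[x y]; rewrite inE => /andP[xy inb].
  have : (x, y) \in pairs M by apply: (subsetP (bedges_sub pAB)); rewrite inE xy.
  rewrite inE /= => /and3P[_ xM yM]; rewrite inE /= in xy.
  by have := dec x y xM yM; rewrite cnt inb -(adjE EU xy); case: adj.
split=> //; exists Bs, s; split=> // x y xM yM.
have DU : E :\: bedges AB \subset upper_pairs n by apply: subset_trans EU; exact: subsetDl.
have key x' y' : x' \in M -> y' \in M -> (x' < y')%N ->
   count (fun AB0 => in_biclique AB0 x' y') (zip As Bs ++ s) = adj (E :\: bedges AB) x' y' :> nat.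
  move=> xM' yM' xy; have := dec x' y' xM' yM'; rewrite cnt !adjE // !inE /= xy /=.
  by case: (in_biclique AB x' y') => //=; case: ((x', y') \in E) => // -[].
case: (ltngtP x y) => [||/val_inj exy]; first exact: key.
  by move=> yx; rewrite adjC -key //; apply: eq_count => C; exact: in_bicliqueC.
have := dec x y xM yM; rewrite exy !adj_irr // cnt.
by case: in_biclique.
Qed.

Hypothesis p01 : 0 < p < 1.
Let p01' : 0 <= p <= 1. Proof. by case/andP: p01 => /ltW -> /ltW ->. Qed.

(** Induction on [f]: each exposure costs a factor [weight M K], where [mu_plant] pays for the
    removed edges. The bound [t] has to hold for all lists of small sides that can be reached. *)
Lemma tiled_prob M K (f0 : nat) (t : R) As f :
  (forall Bs, all (small_side M K) Bs -> (size Bs <= f0)%N ->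
     mu p (pairs M) (fun E => `[< tiled M Bs 0 E >]%:R) <= t) ->
  all (small_side M K) As -> (size As + f <= f0)%N ->
  mu p (pairs M) (fun E => `[< tiled M As f E >]%:R) <= t * weight M K ^+ f.
Proof.
move=> t0; have p1 : p < 1 by case/andP: p01.
have r0 : 0 <= p / (1 - p) by case/andP: p01 => p0 _; rewrite divr_ge0 ?subr_ge0 // ltW.
elim: f As => [|f IH] As sAs szAs.
  by rewrite expr0 mulr1; apply: t0; rewrite // -[size As]addn0.
apply: (@le_trans _ _ (mu p (pairs M) (fun E =>
   \sum_(A | small_side M K A) `[< tiled M (A :: As) f E >]%:R +
   \sum_(AB | large_biclique M K AB) (bedges AB \subset E)%:R * `[< tiled M As f (E :\: bedges AB) >]%:R))).
  apply: le_mu => // E EM; have [/asboolP H|] := boolP `[< tiled M As f.+1 E >]; last first.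
    by move=> _; rewrite addr_ge0 //; apply: sumr_ge0 => ? _; rewrite ?mulr_ge0 ?ler0n.
  have [[A sA tA]|[AB lAB [bE tAB]]] := tiledS K EM H.
    rewrite (bigD1 A) //= (asboolT tA) -addrA lerDl addr_ge0 //; apply: sumr_ge0 => ? _; rewrite ?mulr_ge0 ?ler0n //.
  rewrite [X in _ + X](bigD1 AB) //= bE (asboolT tAB) mulr1 addrCA lerDl addr_ge0 //; apply: sumr_ge0 => ? _; rewrite ?mulr_ge0 ?ler0n //.
rewrite muD !mu_sum exprS mulrCA mulrDl.
apply: lerD.
  rewrite -sum1_card natr_sum big_distrl /= [leRHS](eq_bigl (small_side M K)); last by move=> A; rewrite inE.
  apply: ler_sum => A sA; rewrite mul1r; apply: IH => /=; first by rewrite sA.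
  by rewrite addSnnS.
rewrite big_distrl /=; apply: ler_sum => AB lAB.
have pAB : proper_biclique M AB by case/andP: lAB.
have g0 E : 0 <= `[< tiled M As f E >]%:R :> R by rewrite ler0n.
apply: le_trans (mu_plant p01' p1 (bedges_sub pAB) g0) _.
rewrite (card_bedges pAB) ler_wpM2l ?exprn_ge0 //; apply: IH => //.
by apply: leq_trans szAs; rewrite addnS.
Qed.

Lemma properly_decomposed_prob M K f (t : R) :
  (forall Bs, all (small_side M K) Bs -> (size Bs <= f)%N ->
     mu p (pairs M) (fun E => `[< tiled M Bs 0 E >]%:R) <= t) ->
  mu p (upper_pairs n) (fun E => `[< properly_decomposed E M f >]%:R) <= t * weight M K ^+ f.
Proof.
move=> tP; apply: le_trans (@tiled_prob M K f t [::] f tP isT (leqnn _)).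
rewrite -(mu_marginal p _ (pairs_sub M)); apply: le_mu => // E EU.
rewrite ler_nat; case: (boolP `[< properly_decomposed _ _ _ >]) => //= /asboolP[s [dec ps szs]].
rewrite lt0b; apply/asboolP; exists [::], s; split=> //= x y xM yM.
rewrite (dec x y xM yM) /adj !inE /= xM yM /= !andbT.
congr nat_of_bool; congr (_ || _).
  by case: (boolP ((x, y) \in E)) => //= /(subsetP EU); rewrite inE /= => ->.
by case: (boolP ((y, x) \in E)) => //= /(subsetP EU); rewrite inE /= => ->.
Qed.

(** For [K = 2] no side is small, so after all exposures nothing but an edgeless graph on [M] is
    left. *)
Lemma properly_decomposed_prob2 M f :
  mu p (upper_pairs n) (fun E => `[< properly_decomposed E M f >]%:R) <=
  (1 - p) ^+ 'C(#|M|, 2) * weight M 2 ^+ f.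
Proof.
apply: properly_decomposed_prob => -[|A Bs] /=; last first.
  by rewrite /small_side; case: (#|A|) => [|[|k]]; rewrite ?andbF.
move=> _ _; rewrite -card_pairs -mu_eq0; apply: le_mu => // E EM.
rewrite ler_nat; case: (boolP `[< tiled _ _ _ _ >]) => //= /asboolP[Bs [s [szB szs _ dec]]].
rewrite lt0b; apply/eqP/setP => -[x y]; rewrite inE; apply/negP => xyE.
have := subsetP EM _ xyE; rewrite !inE /= => /and3P[_ xM yM].
have := dec x y xM yM; rewrite (size0nil szs) (size0nil szB) /=.
by rewrite /adj xyE.
Qed.

End UnionBound.

(** * Estimates for the sum over large bicliques *)

Section Weights.
Variable R : realType.

(** [exp (e x) >= (e x / (k + 1)) ^ (k + 1) = B x ^ (k + 1)], which beats [A x ^ k] as soon as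
    [x >= |A| / B]. *)
Lemma poly_le_expR (A : R) k (e : R) : 0 < e ->
  exists2 x0 : R, 0 < x0 & forall x, x0 <= x -> A * x ^+ k <= expR (e * x).
Proof.
move=> e0; pose B : R := (e / k.+1%:R) ^+ k.+1.
have B0 : 0 < B by rewrite exprn_gt0 // divr_gt0.
exists (1 + `|A| / B) => [|x x0]; first by rewrite ltr_pwDl // divr_ge0 // ltW.
have xp : 0 < x by apply: lt_le_trans x0; rewrite ltr_pwDl // divr_ge0 // ltW.
apply: (@le_trans _ _ ((e * x / k.+1%:R) ^+ k.+1)); last first.
  have -> : expR (e * x) = expR (e * x / k.+1%:R) ^+ k.+1.
    by rewrite -expRM_natl [k.+1%:R * _]mulrC divfK.
  have u0 : 0 <= e * x / k.+1%:R by rewrite divr_ge0 // mulr_ge0 // ltW.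
  rewrite lerXn2r ?nnegrE ?expR_ge0 //.
  by apply: le_trans (expR_ge1Dx _); rewrite lerDr.
have -> : (e * x / k.+1%:R) ^+ k.+1 = B * x * x ^+ k.
  by rewrite /B mulrAC exprMn [in x ^+ k.+1]exprS mulrA.
rewrite ler_wpM2r ?(exprn_ge0 _ (ltW xp)) //.
apply: (@le_trans _ _ `|A|); first exact: ler_norm.
by rewrite -ler_pdivrMl // mulrC; apply: le_trans x0; rewrite lerDr.
Qed.

Lemma ltn_ln_eventually (L0 : R) : exists N, forall n, (N <= n)%N -> L0 <= ln (n%:R : R).
Proof.
exists (Num.truncn (expR L0)).+1 => n nN.
have H : expR L0 <= n%:R.
  apply: ltW; apply: lt_le_trans (truncnS_gt _) _; by rewrite ler_nat.
rewrite -[leLHS]expRK ler_ln // posrE ?expR_gt0 //.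
by apply: lt_le_trans H; exact: expR_gt0.
Qed.

Lemma sum_subset_card (T : finType) (M : {set T}) (G : nat -> R) :
  \sum_(A : {set T} | A \subset M) G #|A| = \sum_(a < #|M|.+1) 'C(#|M|, a)%:R * G a.
Proof.
rewrite (partition_big (fun A : {set T} => inord #|A| : 'I_#|M|.+1) predT) //=.
apply: eq_bigr => a _; rewrite (eq_bigl (fun A => A \in [set B : {set T} | B \subset M & #|B| == a])); last first.
  move=> A; rewrite inE; case: (boolP (A \subset M)) => //= AM.
  by rewrite -val_eqE /= inordK // ltnS subset_leq_card.
rewrite (eq_bigr (fun=> G a)); last by move=> A; rewrite inE => /andP[_ /eqP ->].
by rewrite sumr_const cards_draws mulr_natl.
Qed.

Lemma bin_add_le m a j : (a + j <= m)%N -> ('C(m, a + j) <= 'C(m, a) * 'C(m - a, j))%N.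
Proof.
move=> ajm; have am : (a <= m)%N by lia.
have jm : (j <= m - a)%N by lia.
have H1 := bin_fact ajm; have H2 := bin_fact am; have H3 := bin_fact jm.
have H4 := bin_fact (leq_addr j a); rewrite addKn in H4.
have mj : (m - a - j = m - (a + j))%N by lia.
rewrite mj in H3.
suff -> : ('C(m, a) * 'C(m - a, j) = 'C(m, a + j) * 'C(a + j, a))%N.
  by rewrite leq_pmulr // bin_gt0 leq_addr.
have F0 : (0 < a`! * (j`! * (m - (a + j))`!))%N by rewrite !muln_gt0 !fact_gt0.
apply/eqP; rewrite -(eqn_pmul2r F0); apply/eqP.
transitivity m`!; first by rewrite -H2 -H3; ring.
by rewrite -H1 -H4; ring.
Qed.

(** A set with at least [a] elements is an [a]-set together with a subset of the remaining elements,
    whose sum is [(1 + x) ^ (m - a)]. *)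
Lemma sum_bin_tail (x : R) m a : 0 <= x -> (a <= m)%N ->
  \sum_(b < m.+1 | (a <= b)%N) 'C(m, b)%:R * x ^+ b <= 'C(m, a)%:R * x ^+ a * (1 + x) ^+ m.
Proof.
move=> x0 am.
rewrite -(big_mkord (fun b => (a <= b)%N) (fun b => 'C(m, b)%:R * x ^+ b)).
rewrite (big_cat_nat (n := a)) //=; last by rewrite ltnW.
rewrite big_nat_cond big_pred0 ?add0r; last by move=> b; lia.
rewrite big_mkcond big_nat_cond (eq_bigr (fun b => 'C(m, b)%:R * x ^+ b)); last first.
  by move=> b /andP[/andP[-> _] _].
rewrite -big_nat_cond -{1}[a]add0n big_addn.
apply: (@le_trans _ _ (('C(m, a)%:R * x ^+ a) * (1 + x) ^+ (m - a))); last first.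
  by rewrite ler_wpM2l ?mulr_ge0 ?exprn_ge0 // ler_weXn2l ?leq_subr // lerDl.
rewrite subSn // big_mkord exprDn big_distrr /=; apply: ler_sum => j _.
rewrite expr1n mul1r addnC exprD -[x ^+ j *+ _]mulr_natl.
have -> : ('C(m, a)%:R * x ^+ a * ('C(m - a, j)%:R * x ^+ j) : R) = ('C(m, a) * 'C(m - a, j))%:R * (x ^+ a * x ^+ j).
  by rewrite natrM; ring.
rewrite ler_wpM2r ?mulr_ge0 ?exprn_ge0 // ler_nat bin_add_le //.
by have := ltn_ord j; lia.
Qed.

(* The factor 2 leaves room for a geometric series in [a]. *)
Lemma quasipoly_le_expR (rb d : R) : 0 < rb < 1 -> 0 < d ->
  exists2 Y0 : R, 1 <= Y0 & forall y r a, Y0 <= y -> 0 <= r <= rb -> (1 < a)%N ->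
    (2 * (y ^+ 2 * r ^+ (a - 2))) ^+ a <= expR (d * y).
Proof.
move=> /andP[rb0 rb1] d0; pose l := - ln rb.
have l0 : 0 < l by rewrite oppr_gt0 ln_lt0 // rb0.
have rbE : rb = expR (- l) by rewrite opprK lnK.
pose A := (ln 2 + 2 * l : R).
have A0 : 0 <= A by rewrite addr_ge0 ?ln_ge0 ?mulr_ge0 ?ltW //; lra.
have [w0 w00 w0P] := poly_le_expR ((A + 2) ^+ 2 / (l * d)) 2 (@ltr01 R).
exists (expR (Num.max 1 w0)) => [|y r a yY /andP[r0 rrb] a2].
  rewrite -[leLHS]expR0 ler_expR; by rewrite le_max ler01.
have y0 : 0 < y by apply: lt_le_trans yY; exact: expR_gt0.
pose w := ln y; have yE : y = expR w by rewrite lnK.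
have [w1 w2] : 1 <= w /\ w0 <= w.
  have : Num.max 1 w0 <= w by rewrite -ler_expR -yE.
  by rewrite ge_max => /andP.
have z0 : 2 * (y ^+ 2 * r ^+ (a - 2)) <= expR (A + 2 * w - l * a%:R).
  apply: (@le_trans _ _ (2 * (y ^+ 2 * rb ^+ (a - 2)))).
    rewrite ler_wpM2l // (ler_wpM2l (exprn_ge0 _ (ltW y0))) //.
    by rewrite lerXn2r ?nnegrE // ltW.
  apply: eq_ler; rewrite yE rbE -!expRM_natl -{1}[2]lnK ?posrE // -!expRD; congr expR.
  by rewrite /A natrB //; ring.
have zz0 : 0 <= 2 * (y ^+ 2 * r ^+ (a - 2)) by rewrite !mulr_ge0 ?exprn_ge0 // ltW.
apply: (@le_trans _ _ (expR (A + 2 * w - l * a%:R) ^+ a)).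
  by rewrite lerXn2r ?nnegrE ?expR_ge0.
rewrite -expRM_natl ler_expR.
(* The exponent [a (A + 2 w - l a)] is at most [(A + 2 w) ^ 2 / l] for every [a]: it is quadratic in
   [w = ln y], hence negligible against [y]. *)
have dy : (A + 2 * w) ^+ 2 / l <= d * y.
  have := w0P _ w2; rewrite mul1r -yE => H.
  have H2 : (A + 2 * w) ^+ 2 <= (A + 2) ^+ 2 * w ^+ 2.
    rewrite -exprMn lerXn2r ?nnegrE //; nra.
  rewrite ler_pdivrMr //; apply: le_trans H2 _.
  move: H; rewrite mulrAC ler_pdivrMr ?mulr_gt0 // => H; apply: le_trans H _.
  by apply: eq_ler; ring.
have a0 : (0 : R) <= a%:R by [].
have [u0|u0] := leP (A + 2 * w - l * a%:R) 0.
  by apply: (@le_trans _ _ 0); [exact: mulr_ge0_le0 | rewrite mulr_ge0 // ltW].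
apply: le_trans dy; rewrite ler_pdivlMr //.
set a' := (a%:R : R) in a0 u0 *; nra.
Qed.

Lemma bin_le_expn m a : ('C(m, a) <= m ^ a)%N.
Proof.
elim: a m => [|a IH] [|m]; rewrite ?bin0 // ?bin0n //.
rewrite -(leq_pmul2l (ltn0Sn a)) -mul_bin_diag expnS [X in (_ <= X)%N]mulnCA.
rewrite leq_mul2l /=; apply: leq_trans (IH m) _.
apply: leq_trans (leq_pmull _ (ltn0Sn a)); by case: (a) => [|k]; rewrite ?expn0 ?leq_exp2r ?leqnSn.
Qed.

Lemma sum_half_pow m : \sum_(a < m.+1 | (1 < a)%N) (2^-1 : R) ^+ a <= 1.
Proof.
apply: (@le_trans _ _ (1 - 2^-1 ^+ m)); last first.
  by rewrite lerBlDr lerDl exprn_ge0 // invr_ge0.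
elim: m => [|m IH]; first by rewrite big_mkcond big_ord1 /= expr0 subrr.
rewrite big_mkcond big_ord_recr -big_mkcond /=; apply: le_trans (lerD IH (_ : _ <= 2^-1 ^+ m.+1)) _.
  by case: ifP => // _; rewrite exprn_ge0 // invr_ge0.
rewrite exprS; set u := _ ^+ m; lra.
Qed.

(* Both sides of a biclique are chosen freely: the factor [C(m,a)^2 rho^(a^2)] is
   quasi-polynomial in [m rho], and the remaining vertices of the larger side give [(1 + rho^a)^m]. *)
Lemma weight_large_le (rb d : R) : 0 < rb < 1 -> 0 < d ->
  exists2 Y0 : R, 1 <= Y0 & forall (p : R) n (M : {set 'I_n}) K,
    0 < p < 1 -> p / (1 - p) <= rb -> (1 < K)%N -> Y0 <= #|M|%:R * (p / (1 - p)) ->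
    \sum_(AB | large_biclique M K AB) (p / (1 - p)) ^+ (#|AB.1| * #|AB.2|)
    <= expR (d * (#|M|%:R * (p / (1 - p)))) * (1 + (p / (1 - p)) ^+ K) ^+ #|M|.
Proof.
move=> rb01 d0; have [Y0 Y01 Y0P] := quasipoly_le_expR rb01 d0.
exists Y0 => // p n M K /andP[p0 p1] rle K1; set r := p / (1 - p) => Yy.
have r0 : 0 < r by rewrite divr_gt0 // subr_gt0.
rewrite -/r in rle; clearbody r.
have rb1 : rb < 1 by case/andP: rb01.
set m := #|M| in Yy *.
apply: (@le_trans _ _ (\sum_(A : {set 'I_n} | A \subset M) \sum_(B : {set 'I_n} | B \subset M)
    (if (K <= #|A|)%N && (#|A| <= #|B|)%N then r ^+ (#|A| * #|B|) else 0))).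
  rewrite pair_big_dep /= big_mkcond [leRHS]big_mkcond; apply: ler_sum => -[A B] _ /=.
  case: (boolP (large_biclique M K (A, B))) => [/andP[/and5P[/= -> -> _ _ ->] ->] //|_].
  by do 2?case: ifP => // _; rewrite exprn_ge0 // ltW.
have inner (A : {set 'I_n}) : \sum_(B : {set 'I_n} | B \subset M)
    (if (K <= #|A|)%N && (#|A| <= #|B|)%N then r ^+ (#|A| * #|B|) else 0) =
    \sum_(b < m.+1) 'C(m, b)%:R * (if (K <= #|A|)%N && (#|A| <= b)%N then r ^+ (#|A| * b) else 0).
  exact: (@sum_subset_card _ M (fun b => if (K <= #|A|)%N && (#|A| <= b)%N then r ^+ (#|A| * b) else 0)).
under eq_bigr do rewrite inner.
rewrite (@sum_subset_card _ M (fun a => \sum_(b < m.+1) 'C(m, b)%:R * (if (K <= a)%N && (a <= b)%N then r ^+ (a * b) else 0))) -/m.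
apply: (@le_trans _ _ (\sum_(a < m.+1 | (1 < a)%N) 2^-1 ^+ a * (expR (d * (m%:R * r)) * (1 + r ^+ K) ^+ m))); last first.
  rewrite -big_distrl /= ler_piMl ?sum_half_pow // mulr_ge0 ?expR_ge0 // exprn_ge0 //.
  by rewrite addr_ge0 // exprn_ge0 // ltW.
rewrite [leRHS]big_mkcond /=; apply: ler_sum => a _.
have am : (a <= m)%N by rewrite -ltnS.
have [Ka|aK] := leqP K a; last first.
  rewrite big1 ?mulr0; last by move=> b _; rewrite /= mulr0.
  case: ifP => // _; rewrite !mulr_ge0 ?expR_ge0 ?exprn_ge0 // ?invr_ge0 ?addr_ge0 ?exprn_ge0 // ltW //.
have a1 : (1 < a)%N by apply: leq_trans Ka.
rewrite a1 /=.
have -> : \sum_(b < m.+1) 'C(m, b)%:R * (if (a <= b)%N then r ^+ (a * b) else 0) =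
   \sum_(b < m.+1 | (a <= b)%N) 'C(m, b)%:R * (r ^+ a) ^+ b.
  rewrite [RHS]big_mkcond; apply: eq_bigr => b _; case: ifP => _; by rewrite ?mulr0 // exprM.
apply: (@le_trans _ _ ('C(m, a)%:R * ('C(m, a)%:R * (r ^+ a) ^+ a * (1 + r ^+ a) ^+ m))).
  by rewrite ler_wpM2l // sum_bin_tail // exprn_ge0 // ltW.
have rk k : 0 <= r ^+ k by rewrite exprn_ge0 // ltW.
have rk1 k : 0 <= 1 + r ^+ k by rewrite addr_ge0.
have r1 : r <= 1 by apply: le_trans rle (ltW rb1).
have EE0 := expR_ge0 (d * (m%:R * r)); set EE := expR _ in EE0 *.
rewrite !mulrA; apply: ler_pM; rewrite ?(exprn_ge0 _ (rk1 _)) ?mulr_ge0 ?(exprn_ge0 _ (rk _)) //; last first.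
  rewrite lerXn2r ?nnegrE // lerD2l.
  by apply: ler_wiXn2l; rewrite // ltW.
rewrite -ler_pdivrMl ?exprn_gt0 ?invr_gt0 // -exprVn invrK.
have r01 : 0 <= r <= rb by rewrite ltW.
rewrite /EE; apply: le_trans (Y0P _ _ _ Yy r01 a1).
rewrite exprMn ler_wpM2l ?exprn_ge0 //.
have -> : (m%:R * r) ^+ 2 * r ^+ (a - 2) = m%:R ^+ 2 * r ^+ a.
  by rewrite exprMn -mulrA -exprD subnKC.
rewrite exprMn ler_wpM2r ?(exprn_ge0 _ (rk _)) // exprAC expr2.
rewrite -natrX -!natrM ler_nat; apply: leq_mul; exact: bin_le_expn.
Qed.

End Weights.

(** * Second moment of independent sets *)

Section SecondMoment.
Variable R : realType.

Lemma chebyshev_eq0 (T : finType) (p : R) (D : {set T}) (X : {set T} -> R) :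
  0 <= p <= 1 -> 0 < mu p D X ->
  mu p D (fun E => (X E == 0)%:R) <= mu p D (fun E => X E ^+ 2) / mu p D X ^+ 2 - 1.
Proof.
move=> p01 m0; set m := mu p D X in m0 *.
have -> : mu p D (fun E => X E ^+ 2) / m ^+ 2 - 1 = (mu p D (fun E => X E ^+ 2) - m ^+ 2) / m ^+ 2.
  by rewrite mulrBl divff // expf_neq0 // gt_eqF.
rewrite ler_pdivlMr ?exprn_gt0 // mulrC -muZ.
have -> : mu p D (fun E => X E ^+ 2) - m ^+ 2 = mu p D (fun E => (X E - m) ^+ 2).
  transitivity (mu p D (fun E => X E ^+ 2) + (- (2 * m) * mu p D X + m ^+ 2)).
    by rewrite -/m; ring.
  rewrite -[X in _ + (_ + X) = _](mu_cst p D) -muZ -!muD; apply: eq_mu => E _; ring.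
apply: le_mu => // E _; case: eqP => [->|_]; last by rewrite mulr0 sqr_ge0.
by rewrite mulr1 sub0r sqrrN.
Qed.

Lemma sum_inter_card (T : finType) (S : {set T}) (k : nat) (G : nat -> R) :
  \sum_(B : {set T} | #|B| == k) G #|S :&: B| =
  \sum_(s < #|S|.+1) 'C(#|S|, s)%:R * (if (s <= k)%N then 'C(#|T| - #|S|, k - s)%:R * G s else 0).
Proof.
rewrite -(@sum_subset_card R _ S (fun s => if (s <= k)%N then 'C(#|T| - #|S|, k - s)%:R * G s else 0)).
rewrite (partition_big (fun B => S :&: B) (fun J => J \subset S)) /=; last first.
  by move=> B _; exact: subsetIl.
apply: eq_bigr => J JS.
rewrite (eq_bigr (fun=> G #|J|)); last by move=> B /andP[_ /eqP ->].
rewrite sumr_const; case: leqP => [Jk|kJ]; last first.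
  rewrite [X in _ *+ X]eq_card0 ?mulr0 // => B; rewrite inE; apply/negP => /andP[/eqP cB /eqP JB].
  by have := subset_leq_card (subsetIr S B); rewrite JB cB leqNgt kJ.
rewrite mulr_natl; congr (_ *+ _).
have -> : (#|T| - #|S| = #|~: S|)%N by rewrite -(cardsC S) addKn.
rewrite -cards_draws; set DD := [set _ | _].
have inj : {in DD &, injective (fun B => J :|: B)}.
  move=> B B'; rewrite !inE => /andP[/subsetP BS _] /andP[/subsetP BS' _] /setP e; apply/setP => x.
  have := e x; rewrite !inE; case: (boolP (x \in J)) => //= xJ _.
  have xS := subsetP JS _ xJ.
  by apply/idP/idP => [/BS|/BS']; rewrite inE xS.
rewrite -(card_in_imset inj).
rewrite -cardsE; apply: eq_card => B; rewrite inE.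
apply/andP/imsetP => [[/eqP cB /eqP JB]|[C]].
  exists (B :\: S); last by rewrite -JB setIC setID.
  rewrite inE subDset setUCr subsetT /= -JB setIC -cB.
  by have := cardsID S B; move=> <-; rewrite addKn.
rewrite inE => /andP[CS /eqP cC] ->.
have dis : J :&: C = set0.
  apply/setP => x; rewrite !inE; apply/negP => /andP[/(subsetP JS) xS /(subsetP CS)].
  by rewrite inE xS.
split; first by rewrite cardsU dis cards0 subn0 cC subnKC.
apply/eqP/setP => x; rewrite !inE.
case: (boolP (x \in J)) => [/(subsetP JS) -> //|xJ] /=.
by apply/andP => -[xS /(subsetP CS)]; rewrite inE xS.
Qed.

Lemma pairsI n (S B : {set 'I_n}) : pairs S :&: pairs B = pairs (S :&: B).
Proof.
by apply/setP => u; rewrite !inE; case: (_ < _)%N; case: (u.1 \in S); case: (u.2 \in S);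
  rewrite ?andbF.
Qed.

Lemma independentE n (E : {set 'I_n * 'I_n}) S : E \subset upper_pairs n ->
  independent E S = [disjoint E & pairs S].
Proof.
move=> EU; apply/idP/idP.
  move=> /forallP ind; rewrite -setI_eq0; apply/eqP/setP => -[x y]; rewrite !inE /=.
  apply/negP => /and4P[xyE _ xS yS].
  by have /implyP/(_ xS)/forallP/(_ y)/implyP/(_ yS) := ind x; rewrite /adj xyE.
move=> dis; apply/forallP => x; apply/implyP => xS; apply/forallP => y; apply/implyP => yS.
rewrite /adj negb_or; apply/andP; split; apply/negP => H; have := subsetP EU _ H.
  rewrite inE /= => xy; move: dis; rewrite -setI_eq0 => /eqP/setP/(_ (x, y)).
  by rewrite !inE H xy xS yS.
rewrite inE /= => xy; move: dis; rewrite -setI_eq0 => /eqP/setP/(_ (y, x)).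
by rewrite !inE H xy xS yS.
Qed.

(** Expected number of independent sets of size [k]. *)
Definition EX (p : R) n k : R := 'C(n, k)%:R * (1 - p) ^+ 'C(k, 2).

(** Chebyshev's inequality for the number of independent [k]-sets. Two [k]-sets sharing at most one
    vertex span disjoint sets of pairs; by Vandermonde's identity their share of the normalised
    second moment is at most 1 and cancels against the [- 1]. *)
Lemma alpha_lt_prob (p : R) n k : 0 < p < 1 -> (0 < k <= n)%N ->
  mu p (upper_pairs n) (fun E => (alpha E < k)%N%:R) <=
  \sum_(s < k.+1 | (1 < s)%N)
    ('C(k, s) * 'C(n - k, k - s))%:R / 'C(n, k)%:R / (1 - p) ^+ 'C(s, 2).
Proof.
move=> p01 /andP[k0 kn].
have p01' : 0 <= p <= 1 by case/andP: p01 => /ltW -> /ltW ->.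
have q0 : 0 < 1 - p by rewrite subr_gt0; case/andP: p01.
have qk j : 0 < (1 - p) ^+ j by rewrite exprn_gt0.
have C0 : 0 < ('C(n, k)%:R : R) by rewrite ltr0n bin_gt0.
pose X (E : {set 'I_n * 'I_n}) : R := \sum_(S : {set 'I_n} | #|S| == k) [disjoint E & pairs S]%:R.
have cS : #|[set S : {set 'I_n} | #|S| == k]| = 'C(n, k) by rewrite card_draws card_ord.
have X1 : mu p (upper_pairs n) X = EX p n k.
  rewrite mu_sum (eq_bigr (fun=> (1 - p) ^+ 'C(k, 2))) => [|S /eqP Sk].
    by rewrite sumr_const -cardsE cS /EX mulr_natl.
  by rewrite mu_disjoint ?pairs_sub // card_pairs Sk.
have X2 : mu p (upper_pairs n) (fun E => X E ^+ 2) = 'C(n, k)%:R *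
    ((1 - p) ^+ (2 * 'C(k, 2)) * \sum_(s < k.+1) ('C(k, s) * 'C(n - k, k - s))%:R / (1 - p) ^+ 'C(s, 2)).
  rewrite (eq_mu p (g := fun E => \sum_(S : {set 'I_n} | #|S| == k) \sum_(B : {set 'I_n} | #|B| == k)
     [disjoint E & pairs S :|: pairs B]%:R)); last first.
    move=> E _; rewrite expr2 /X big_distrl /=; apply: eq_bigr => S _.
    rewrite big_distrr /=; apply: eq_bigr => B _; rewrite -natrM mulnb.
    by rewrite -!setI_eq0 setIUr setU_eq0.
  rewrite mu_sum (eq_bigr (fun=> (1 - p) ^+ (2 * 'C(k, 2)) * \sum_(s < k.+1) ('C(k, s) * 'C(n - k, k - s))%:R / (1 - p) ^+ 'C(s, 2))).
    by rewrite sumr_const -cardsE cS mulr_natl.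
  move=> S /eqP Sk; rewrite mu_sum.
  rewrite (eq_bigr (fun B => (1 - p) ^+ (2 * 'C(k, 2)) * ((1 - p) ^- 'C(#|S :&: B|, 2)))); last first.
    move=> B /eqP Bk; rewrite mu_disjoint; last by rewrite subUset !pairs_sub.
    rewrite cardsU pairsI !card_pairs Sk Bk addnn -mul2n expfB_cond // gt_eqF //=.
    have le1 : ('C(#|S :&: B|, 2) <= 'C(k, 2))%N by rewrite -Sk leq_bin2l // subset_leq_card // subsetIl.
    by rewrite mul2n -addnn (leq_trans le1) // leq_addr.
  rewrite -big_distrr /= (sum_inter_card S k (fun s => (1 - p) ^- 'C(s, 2))) Sk card_ord.
  congr (_ * _); apply: eq_bigr => s _; rewrite -ltnS ltn_ord natrM; ring.
have vand : \sum_(s < k.+1) ('C(k, s) * 'C(n - k, k - s))%:R = 'C(n, k)%:R :> R.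
  by rewrite -natr_sum binomial.Vandermonde subnKC.
have mu0 : 0 < mu p (upper_pairs n) X by rewrite X1 mulr_gt0.
apply: (@le_trans _ _ (mu p (upper_pairs n) (fun E => (X E == 0)%:R))).
  apply: le_mu => // E EU; rewrite ler_nat; case: ltnP => // ak.
  suff -> : X E == 0 by [].
  rewrite /X big1 // => S /eqP Sk; rewrite -independentE //.
  case: (boolP (independent E S)) => // /independent_le_alpha.
  by rewrite Sk leqNgt ak.
apply: le_trans (chebyshev_eq0 p01' mu0) _.
rewrite X1 X2 /EX exprMn -exprM mulnC.
set q := _ ^+ (_ * _); have q0' : 0 < q by exact: qk.
have -> (x : R) : 'C(n, k)%:R * (q * x) / ('C(n, k)%:R ^+ 2 * q) = x / 'C(n, k)%:R.
  by field; rewrite !gt_eqF.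
rewrite (bigID (fun s : 'I_k.+1 => (1 < s)%N)) /= mulrDl big_distrl /= -addrA.
rewrite [X in X + _](eq_bigr (fun s : 'I_k.+1 =>
  ('C(k, s) * 'C(n - k, k - s))%:R / 'C(n, k)%:R / (1 - p) ^+ 'C(s, 2))); last first.
  by move=> s _; rewrite mulrAC.
rewrite gerDl subr_le0 ler_pdivrMr // mul1r -vand [leRHS](bigID (fun s : 'I_k.+1 => (1 < s)%N)) /=.
apply: ler_wpDl; first by apply: sumr_ge0.
apply: ler_sum => s s1; have -> : 'C(s, 2) = 0%N by rewrite bin_small // ltnS leqNgt.
by rewrite expr0 invr1 mulr1.
Qed.

End SecondMoment.

(** * Elementary bounds on binomial coefficients *)

Section Binomials.
Variable R : realType.

Lemma bin2_natr k : ('C(k, 2))%:R = k%:R * (k%:R - 1) / 2 :> R.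
Proof.
elim: k => [|k IH]; first by rewrite bin0n mul0r mul0r.
by rewrite binS bin1 natrD IH -natr1; field.
Qed.

Lemma bin_le_pow2 m a : ('C(m, a) <= 2 ^ m)%N.
Proof.
elim: m a => [|m IH] [|a]; rewrite ?bin0 ?bin0n ?expn_gt0 //.
by rewrite binS expnS mul2n -addnn leq_add.
Qed.

Lemma expn_le_bin n j : (j <= n)%N -> (n ^ j <= 'C(n, j) * j ^ j)%N.
Proof.
elim: j n => [|j IH] [|n] // jn; rewrite ltnS in jn.
have H1 : (n.+1 ^ j * j ^ j <= n ^ j * j.+1 ^ j)%N.
  by rewrite -!expnMn; case: (j) jn => // j' jn; rewrite leq_exp2r //; nia.
have H2 : (n.+1 ^ j <= 'C(n, j) * j.+1 ^ j)%N.
  case: (posnP j) => [->|j0]; first by rewrite bin0 !expn0.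
  rewrite -(leq_pmul2r (_ : 0 < j ^ j)%N) ?expn_gt0 ?j0 //; apply: leq_trans H1 _.
  by rewrite mulnAC leq_mul2r IH // orbT.
have := mul_bin_diag n.+1 j => /= H3.
rewrite !expnS; set X := (j.+1 ^ j)%N in H1 H2 *.
rewrite mulnA [('C(_, _) * _)%N]mulnC -H3 -mulnA leq_mul2l /=; exact: H2.
Qed.

Lemma expR1_le4 : expR 1 <= 4 :> R.
Proof.
have -> : (1 : R) = 1 / 2 + 1 / 2 by lra.
rewrite expRD; have := @expR_le_quad R (1 / 2) (lexx _).
have := expR_ge0 (1 / 2 : R); set u := expR _; nra.
Qed.

Lemma fact_ge_expn i : (i%:R : R) ^+ i <= i`!%:R * 4 ^+ i.
Proof.
case: i => [|i]; first by rewrite !expr0 mulr1.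
have e1 := expR1_le4.
have := @expR_ge1Dxn R i.+1%:R i (ler0n _ _).
rewrite -{2}[i.+1%:R]mulr1 expRM_natl => H.
rewrite -ler_pdivrMl ?ltr0n ?fact_gt0 // mulrC.
apply: le_trans (_ : _ <= expR 1 ^+ i.+1) _; first by apply: le_trans H; rewrite lerDr.
by rewrite lerXn2r ?nnegrE ?expR_ge0.
Qed.

Lemma bin_le_expn_div n i : (0 < i)%N -> ('C(n, i))%:R <= (4 * n%:R / i%:R) ^+ i :> R.
Proof.
move=> i0; have i0' : (0 : R) < i%:R by rewrite ltr0n.
rewrite exprMn exprVn ler_pdivlMr ?exprn_gt0 // exprMn.
apply: (@le_trans _ _ (('C(n, i))%:R * (i`!%:R * 4 ^+ i))).
  by rewrite ler_wpM2l // fact_ge_expn.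
rewrite mulrA -natrM bin_ffact mulrC ler_wpM2l ?exprn_ge0 // -natrX ler_nat.
elim: i {i0 i0'} n => [|i IH] [|n] //; rewrite ffactSS expnS leq_mul2l /=.
by apply: leq_trans (IH n) _; case: (i) => // i'; rewrite leq_exp2r.
Qed.

(** The hypergeometric probability of an overlap [s] is at most [(k ^ 2 / n) ^ s]: there are at most
    [k ^ s] common parts, and a random [k]-set contains a given one with probability at most
    [(k / n) ^ s]. *)
Lemma bin_hyper_le n k s : (s <= k <= n)%N ->
  ('C(k, s) * 'C(n - k, k - s) * n ^ s <= 'C(n, k) * (k ^ 2) ^ s)%N.
Proof.
move=> /andP[sk kn].
have H t : (t <= k)%N -> ('C(n - t, k - t) * n ^ t <= 'C(n, k) * k ^ t)%N.
  elim: t => [|t IH] tk; first by rewrite !subn0 !expn0.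
  have := mul_bin_diag (n - t) (k - t.+1).
  rewrite -subnS; have -> : ((k - t.+1).+1 = k - t)%N by lia.
  move=> H2; have nt0 : (0 < n - t)%N by lia.
  rewrite -(leq_pmul2l nt0) !expnS.
  have -> : ((n - t) * ('C(n - t.+1, k - t.+1) * (n * n ^ t)) = ((k - t) * n) * ('C(n - t, k - t) * n ^ t))%N.
    by rewrite mulnA H2; ring.
  have -> : ((n - t) * ('C(n, k) * (k * k ^ t)) = ((n - t) * k) * ('C(n, k) * k ^ t))%N by ring.
  by apply: leq_mul; [nia | apply: IH; lia].
have H1 : ('C(n - k, k - s) <= 'C(n - s, k - s))%N by rewrite leq_bin2l //; lia.
apply: leq_trans (_ : k ^ s * ('C(n - s, k - s) * n ^ s) <= _)%N.
  by rewrite -mulnA; apply: leq_mul; [exact: bin_le_expn | rewrite leq_mul2r H1 orbT].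
by rewrite -expnM mulSn mul1n expnD [X in (_ <= X)%N]mulnCA leq_mul2l H ?orbT.
Qed.

End Binomials.

Section IndependentSets.
Variable R : realType.

Definition cp (p : R) := - ln (1 - p).

Lemma cpE p : p < 1 -> 1 - p = expR (- cp p).
Proof. by move=> p1; rewrite opprK lnK // posrE subr_gt0. Qed.

Lemma cp_bounds p : 0 < p < 1 / 2 -> [/\ p <= cp p, cp p <= 2 * p & cp p <= 1].
Proof.
move=> /andP[p0 p2]; have q0 : 0 < 1 - p by lra.
have H1 : p <= cp p.
  by rewrite lerNr; have := @le_ln1Dx R (- p); apply; lra.
have H2 : cp p <= p / (1 - p).
  rewrite /cp -lnV ?posrE //; have -> : ln (1 - p)^-1 = ln (1 + p / (1 - p)) by congr ln; field; rewrite gt_eqF.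
  apply: le_ln1Dx; apply: (@lt_trans _ _ 0); [lra | exact: divr_gt0].
have H3 : p / (1 - p) <= 2 * p by rewrite ler_pdivrMr //; nra.
split=> //; first exact: le_trans H2 H3.
by apply: le_trans H2 _; rewrite ler_pdivrMr //; lra.
Qed.

Lemma expR_bin2 (c : R) k : expR (- c) ^+ 'C(k, 2) = expR (- (c * (k%:R * (k%:R - 1) / 2))).
Proof. by rewrite -expRM_natl bin2_natr; congr expR; ring. Qed.

(** The overlap [s] is at most [k / 6], or at least [k - k / N], or in between. In each range the
    term is a power of a ratio that is at most [n ^ (- 1 / (4 N))]; towards [s = k] it also has the
    factor [1 / EX]. *)
Lemma second_moment_term (n k N s : nat) (c L delta : R) :
  n%:R = expR L -> 0 < c <= 1 -> (0 < k <= n)%N -> (6 <= N)%N ->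
  expR 1 * 64 <= expR (L / (4 * N%:R)) ->
  32 * N%:R * 2 ^+ N * expR (1 / 2) <= expR (L / 24) ->
  c * (k%:R - 1) <= 2 * L -> k%:R <= expR ((1 / 3 - 1 / (2 * N%:R)) * L) ->
  L <= c * k%:R -> expR (- (c * k%:R / 2)) <= 8 * k%:R / n%:R ->
  expR (delta * L) <= 'C(n, k)%:R * expR (- c) ^+ 'C(k, 2) ->
  (1 < s <= k)%N ->
  ('C(k, s) * 'C(n - k, k - s))%:R / 'C(n, k)%:R / expR (- c) ^+ 'C(s, 2) <=
  expR (- (L / (4 * N%:R))) ^+ s + expR (- (delta * L)) * expR (- (L / (4 * N%:R))) ^+ (k - s).
Proof.
move=> nE /andP[c0 c1] /andP[k0 kn] N6 hL1 hL2 F1 F2 F4 F5 EXk /andP[s1 sk].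
set x := expR (- (L / (4 * N%:R))).
have n0 : (0 : R) < n%:R by rewrite nE expR_gt0.
have k0' : (0 : R) < k%:R by rewrite ltr0n.
have kr1 : (1 : R) <= k%:R by rewrite ler1n.
have N0 : (0 : R) < N%:R by rewrite ltr0n; apply: leq_trans N6.
have N6' : (6 : R) <= N%:R by rewrite ler_nat.
have C0 : (0 : R) < 'C(n, k)%:R by rewrite ltr0n bin_gt0.
have x0 : 0 <= x by exact: expR_ge0.
have ck2 : c * k%:R <= 2 * L + 1 by lra.
have L0 : 0 <= L.
  have := expR_gt0 (delta * L); nra.
have LN : L / N%:R <= L / 6 by rewrite ler_wpM2l // lef_pV2 ?posrE.
have LN0 : 0 <= L / N%:R by rewrite divr_ge0 // ltW.
have e4 : L / (4 * N%:R) = (L / N%:R) / 4 by field; rewrite gt_eqF.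
have e2 : (1 / 3 - 1 / (2 * N%:R)) * L = L / 3 - (L / N%:R) / 2 by field; rewrite gt_eqF.
rewrite e2 in F2.
(* Small overlap: [k ^ 2 / n] is below [n ^ (- 1/3)], while the gain [exp (c (s - 1) / 2)] is at
   most [n ^ (1/6)]. *)
have [s6|s6] := leqP (6 * s) k.
  apply: (@le_trans _ _ (x ^+ s)); last by rewrite lerDl mulr_ge0 ?expR_ge0 // exprn_ge0.
  have -> : (expR (- c) ^+ 'C(s, 2))^-1 = expR (c * (s%:R - 1) / 2) ^+ s.
    by rewrite expR_bin2 -expRN opprK -expRM_natl; congr expR; ring.
  apply: (@le_trans _ _ ((k%:R ^+ 2 / n%:R) ^+ s * expR (c * (s%:R - 1) / 2) ^+ s)).
    rewrite ler_wpM2r ?exprn_ge0 ?expR_ge0 // exprMn exprVn ler_pdivrMr // mulrAC ler_pdivlMr ?exprn_gt0 //.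
    rewrite -!natrX -!natrM ler_nat mulnC [X in (_ <= X)%N]mulnC mulnC; apply: bin_hyper_le; by rewrite sk kn.
  rewrite -exprMn lerXn2r ?nnegrE ?mulr_ge0 ?divr_ge0 ?exprn_ge0 ?expR_ge0 //.
  have c6 : c * (s%:R - 1) / 2 <= L / 6.
    have : 6 * s%:R <= (k%:R : R) by rewrite -natrM ler_nat.
    move=> ?; nra.
  apply: (@le_trans _ _ (expR (2 * (L / 3 - L / N%:R / 2) - L + L / 6))).
    rewrite expRD expRB -nE; apply: ler_pM; rewrite ?divr_ge0 ?exprn_ge0 ?expR_ge0 ?ler_expR //.
    rewrite ler_wpM2r ?invr_ge0 // expRM_natl lerXn2r ?nnegrE ?expR_ge0 //.
  by rewrite ler_expR e4; lra.
(* From here on [i] vertices are exchanged. Up to the factor [1 / EX], the term is at most the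
   number of exchanges times [E ^ i], the probability that the new pairs are absent. *)
pose i := (k - s)%N; have si : s = (k - i)%N by rewrite /i subKn.
have ik : (i < k)%N by rewrite /i ltn_subrL k0 andbT ltnW.
apply: (@le_trans _ _ (expR (- (delta * L)) * x ^+ (k - s))); last by rewrite lerDr exprn_ge0.
rewrite -/i.
pose E := expR (- (c * (2 * k%:R - i%:R - 1) / 2)).
have sR : s%:R = k%:R - i%:R :> R by rewrite si natrB // ltnW.
apply: (@le_trans _ _ (expR (- (delta * L)) * ('C(k, i)%:R * 'C(n, i)%:R * E ^+ i))).
  have Ci : 'C(k, s) = 'C(k, i) by rewrite si bin_sub // ltnW.
  rewrite Ci -/i natrM -mulrA.
  have -> : 'C(n, k)%:R^-1 / expR (- c) ^+ 'C(s, 2) =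
     ('C(n, k)%:R * expR (- c) ^+ 'C(k, 2))^-1 * E ^+ i.
    rewrite invfM -mulrA; congr (_ * _); rewrite !expR_bin2 -!expRN -expRM_natl -expRD; congr expR.
    by rewrite sR; field.
  have E0 : 0 <= E ^+ i by rewrite exprn_ge0 ?expR_ge0.
  have I1 : ('C(n, k)%:R * expR (- c) ^+ 'C(k, 2))^-1 <= expR (- (delta * L)).
    by rewrite [leRHS]expRN lef_pV2 ?posrE ?expR_gt0 // mulr_gt0 // exprn_gt0 // expR_gt0.
  set v := _^-1 in I1 *; have v0 : 0 <= v by rewrite invr_ge0 mulr_ge0 // exprn_ge0 // expR_ge0.
  rewrite mulrCA; apply: ler_pM => //; first by rewrite mulr_ge0 // mulr_ge0.
  by rewrite ler_wpM2r // ler_wpM2l // ler_nat leq_bin2l // leq_subr.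
rewrite ler_wpM2l ?expR_ge0 //.
have [i0|i0] := posnP i; first by rewrite i0 !bin0 !expr0 !mulr1.
have i0' : (0 : R) < i%:R by rewrite ltr0n.
(* For [i <= k / N], [E] is [(k / n) ^ 2] up to a constant and [n ^ (1 / N)], so [k n E] is about
   [k ^ 3 / n]. This is the place that needs [k] below [n ^ (1 / 3)]. *)
have [iN|iN] := leqP (N * i) k.
  apply: (@le_trans _ _ ((k%:R * n%:R * E) ^+ i)).
    rewrite !exprMn ler_wpM2r ?exprn_ge0 ?expR_ge0 // -!natrX ler_pM // ler_nat; exact: bin_le_expn.
  rewrite lerXn2r ?nnegrE ?mulr_ge0 ?expR_ge0 //.
  have iNR : N%:R * i%:R <= (k%:R : R) by rewrite -natrM ler_nat.
  have EE : E <= (8 * k%:R / n%:R) ^+ 2 * expR (L / N%:R + 1).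
    have -> : E = expR (- (c * k%:R / 2)) ^+ 2 * expR (c * (i%:R + 1) / 2).
      by rewrite /E -expRM_natl -expRD; congr expR; field.
    apply: ler_pM; rewrite ?exprn_ge0 ?expR_ge0 ?ler_expR //.
      by rewrite lerXn2r ?nnegrE ?expR_ge0 // divr_ge0 // mulr_ge0.
    have ci : c * i%:R <= (2 * L + 1) / N%:R.
      by rewrite ler_pdivlMr // -mulrA [i%:R * _]mulrC; apply: le_trans ck2; rewrite ler_wpM2l // ltW.
    have N1 : 1 / N%:R <= (1 : R) by rewrite ler_pdivrMr // mul1r; lra.
    have e5 : (2 * L + 1) / N%:R = 2 * (L / N%:R) + 1 / N%:R by field; rewrite gt_eqF.
    rewrite e5 in ci.
    lra.
  apply: (@le_trans _ _ (k%:R * n%:R * ((8 * k%:R / n%:R) ^+ 2 * expR (L / N%:R + 1)))).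
    by rewrite ler_wpM2l // mulr_ge0.
  have -> : k%:R * n%:R * ((8 * k%:R / n%:R) ^+ 2 * expR (L / N%:R + 1)) =
     64 * (k%:R ^+ 3 / n%:R * expR (L / N%:R + 1)) by field; rewrite gt_eqF.
  have k3 : k%:R ^+ 3 <= expR (L - L / N%:R * (3 / 2)).
    have -> : L - L / N%:R * (3 / 2) = 3%:R * (L / 3 - L / N%:R / 2) by field; rewrite gt_eqF.
    by rewrite expRM_natl lerXn2r ?nnegrE ?expR_ge0.
  apply: (@le_trans _ _ (64 * (expR (L - L / N%:R * (3 / 2)) / expR L * expR (L / N%:R + 1)))).
    by rewrite ler_wpM2l // ler_wpM2r ?expR_ge0 // nE ler_wpM2r // invr_ge0 expR_ge0.
  have -> : expR (L - L / N%:R * (3 / 2)) / expR L * expR (L / N%:R + 1) = expR 1 * expR (- (L / N%:R / 2)).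
    by rewrite -expRN -!expRD; congr expR; field; rewrite gt_eqF.
  rewrite mulrA [64 * _]mulrC.
  apply: (@le_trans _ _ (expR (L / (4 * N%:R)) * expR (- (L / N%:R / 2)))).
    by rewrite ler_wpM2r ?expR_ge0.
  by rewrite -expRD ler_expR e4; lra.
(* Middle range: [k <= N i] turns [2 ^ k] into a constant to the power [i], and the common part,
   with more than [k / 6] vertices, gives a factor [n ^ (- 1 / 12)] per exchange. *)
have kNi : (k%:R : R) <= N%:R * i%:R by rewrite -natrM ler_nat ltnW.
apply: (@le_trans _ _ ((2 ^+ N * (4 * n%:R * N%:R / k%:R) * E) ^+ i)).
  rewrite (exprMn i) (exprMn i) ler_wpM2r ?exprn_ge0 ?expR_ge0 //.
  apply: ler_pM => //.
    rewrite -exprM -natrX ler_nat; apply: leq_trans (bin_le_pow2 _ _) _.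
    by rewrite leq_exp2l // ltnW.
  apply: le_trans (bin_le_expn_div R _ i0) _.
  rewrite lerXn2r ?nnegrE ?divr_ge0 ?mulr_ge0 //.
  rewrite -[leRHS]mulrA ler_wpM2l ?mulr_ge0 // ler_pdivlMr // mulrC ler_pdivrMr //.
rewrite lerXn2r ?nnegrE ?mulr_ge0 ?exprn_ge0 ?expR_ge0 ?invr_ge0 //.
have EE : E <= 8 * k%:R / n%:R * (expR (1 / 2) * expR (- (L / 12))).
  have -> : E = expR (- (c * k%:R / 2)) * expR (- (c * (s%:R - 1) / 2)).
    by rewrite /E -expRD sR; congr expR; field.
  rewrite -[expR (1 / 2) * _]expRD; apply: ler_pM; rewrite ?expR_ge0 ?ler_expR //.
  have : (k%:R : R) <= 6 * s%:R by rewrite -natrM ler_nat ltnW.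
  move=> ?; nra.
apply: (@le_trans _ _ (2 ^+ N * (4 * n%:R * N%:R / k%:R) * (8 * k%:R / n%:R * (expR (1 / 2) * expR (- (L / 12)))))).
  by rewrite ler_wpM2l // !mulr_ge0 ?exprn_ge0 ?invr_ge0.
have -> : 2 ^+ N * (4 * n%:R * N%:R / k%:R) * (8 * k%:R / n%:R * (expR (1 / 2) * expR (- (L / 12)))) =
   32 * N%:R * 2 ^+ N * expR (1 / 2) * expR (- (L / 12)) by field; rewrite !gt_eqF.
apply: (@le_trans _ _ (expR (L / 24) * expR (- (L / 12)))).
  by rewrite ler_wpM2r ?expR_ge0.
by rewrite -expRD ler_expR e4; lra.
Qed.

End IndependentSets.

(** * The independence number *)

Section SparseRegime.
Variable R : realType.

Lemma geometric_le2 (x : R) k : 0 <= x <= 1 / 2 -> \sum_(s < k) x ^+ s <= 2.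
Proof.
move=> /andP[x0 x2]; apply: (@le_trans _ _ (2 - 2 * (1 / 2) ^+ k)); last first.
  by rewrite gerBl mulr_ge0 // exprn_ge0 //; lra.
elim: k => [|k IH]; first by rewrite big_ord0 expr0 mulr1 subrr.
rewrite big_ord_recr /=; apply: le_trans (lerD IH (_ : _ <= (1 / 2) ^+ k)) _.
  by rewrite lerXn2r ?nnegrE //; lra.
rewrite exprS; set u := _ ^+ k; lra.
Qed.

Lemma geometric_le2x (x : R) k : 0 <= x <= 1 / 2 -> \sum_(s < k.+1 | (0 < s)%N) x ^+ s <= 2 * x.
Proof.
move=> x02; rewrite big_mkcond big_ord_recl /= add0r.
rewrite (eq_bigr (fun s : 'I_k => x ^+ s * x)) => [|s _]; last by rewrite exprSr.
by rewrite -big_distrl /= ler_wpM2r ?geometric_le2 //; case/andP: x02.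
Qed.

Lemma exists_threshold_size (p L d : R) n : (1 < n)%N -> n%:R = expR L -> 0 < p < 1 ->
  0 < d <= 1 ->
  exists k, [/\ (0 < k < n)%N, expR (d * L) <= EX p n k & EX p n k.+1 < expR (d * L)].
Proof.
move=> n1 nE /andP[p0 p1] /andP[d0 d1].
have L0 : 0 < L by rewrite -expR_gt1 -nE ltr1n.
have ex : exists j, EX p n j.+2 < expR (d * L).
  exists (n - 2)%N; have -> : (n - 2).+2 = n by lia.
  rewrite /EX binn mul1r; apply: le_lt_trans (_ : 1 < _); last by rewrite expR_gt1 mulr_gt0.
  by rewrite exprn_ile1 //; lra.
case: (ex_minnP ex) => j jP jmin; exists j.+1; split=> //.
  have := jmin (n - 2)%N; have -> : (n - 2).+2 = n by lia.
  rewrite /EX binn mul1r => /(_ _) H; apply/andP; split=> //.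
  suff : (j <= n - 2)%N by lia.
  apply: H; apply: le_lt_trans (_ : 1 < _); last by rewrite expR_gt1 mulr_gt0.
  by rewrite exprn_ile1 //; lra.
case: j jP jmin => [|j] jP jmin.
  by rewrite /EX bin1 bin_small // expr0 mulr1 nE ler_expR; nra.
by rewrite leNgt; apply/negP => /jmin; rewrite ltnn.
Qed.

(** [EX p n k >= 1] bounds [k] from above, and [EX p n k.+1 < n ^ d] bounds it from below, each
    after extraction of a root. Half of the margin [1 / N] in the exponent of [p] absorbs the
    logarithm in the upper bound on [k]. *)
Lemma threshold_size_bounds (p L d : R) (n k N : nat) : n%:R = expR L -> 0 < p < 1 / 2 ->
  expR (- ((1 / 3 - 1 / N%:R) * L)) <= p -> (6 <= N)%N ->
  0 < d <= 1 / 3 -> 0 < L -> 2 + 2 * L <= expR (1 / (2 * N%:R) * L) ->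
  (0 < k < n)%N -> expR (d * L) <= EX p n k -> EX p n k.+1 < expR (d * L) ->
  let c := cp p in
  [/\ c * (k%:R - 1) <= 2 * L, k%:R <= expR ((1 / 3 - 1 / (2 * N%:R)) * L),
      L <= c * k%:R, expR (- (c * k%:R / 2)) <= 8 * k%:R / n%:R &
      n%:R / k.+1%:R * expR (- (c * k%:R / 2)) <= expR 1].
Proof.
move=> nE p02 pN N6 /andP[d0 d3] L0 hL /andP[k0 kn] EXk EXk1 c.
have [c1 c2 c3] := cp_bounds p02.
have [p0 p2] := andP p02.
have p1 : p < 1 by lra.
have c0 : 0 < c by apply: lt_le_trans c1.
have k0' : (0 : R) < k%:R by rewrite ltr0n.
have kr1 : (1 : R) <= k%:R by rewrite ler1n.
have N0 : (0 : R) < N%:R by rewrite ltr0n; apply: leq_trans N6.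
have F1 : c * (k%:R - 1) <= 2 * L.
  have : 1 <= EX p n k.
    by apply: le_trans EXk; rewrite -[leLHS]expR0 ler_expR mulr_ge0 // ltW.
  rewrite /EX cpE // -/c expR_bin2 => H.
  have : 1 <= n%:R ^+ k * expR (- (c * (k%:R * (k%:R - 1) / 2))).
    apply: le_trans H _; rewrite ler_wpM2r ?expR_ge0 // -natrX ler_nat; exact: bin_le_expn.
  rewrite nE -expRM_natl -expRD -[leLHS]expR0 ler_expR => {}H.
  have : 0 <= k%:R * (2 * L - c * (k%:R - 1)) by nra.
  by rewrite pmulr_rge0 // subr_ge0.
have F2 : k%:R + 1 <= expR ((1 / 3 - 1 / (2 * N%:R)) * L).
  have k1 : k%:R + 1 <= 2 + 2 * L / c.
    by rewrite -lerBlDl ler_pdivlMr //; lra.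
  apply: le_trans k1 _.
  have ci : c^-1 <= expR ((1 / 3 - 1 / N%:R) * L).
    rewrite -[leRHS]invrK -expRN lef_pV2 ?posrE ?expR_gt0 //; exact: le_trans pN c1.
  have E1 : 1 <= expR ((1 / 3 - 1 / N%:R) * L).
    rewrite -[leLHS]expR0 ler_expR mulr_ge0 ?(ltW L0) // subr_ge0.
    by rewrite !div1r lef_pV2 ?posrE // ler_nat (leq_trans _ N6).
  apply: (@le_trans _ _ ((2 + 2 * L) * expR ((1 / 3 - 1 / N%:R) * L))).
    move: ci E1; set E := expR _ => ci E1; rewrite [(2 + 2 * L) * E]mulrDl lerD ?ler_peMr //.
    by rewrite ler_wpM2l // mulr_ge0 // ltW.
  apply: (@le_trans _ _ (expR (1 / (2 * N%:R) * L) * expR ((1 / 3 - 1 / N%:R) * L))).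
    by rewrite ler_wpM2r ?expR_ge0.
  by rewrite -expRD ler_expR; apply: eq_ler; field; rewrite gt_eqF.
have kS : (k.+1%:R : R) = k%:R + 1 by rewrite -natr1.
pose l := ln (k%:R + 1 : R).
have lE : k%:R + 1 = expR l by rewrite lnK // posrE; lra.
have l3 : l <= L / 3.
  have : l <= (1 / 3 - 1 / (2 * N%:R)) * L by rewrite -ler_expR -lE.
  move=> H; apply: le_trans H _.
  rewrite mulrBl div1r [_^-1 * L]mulrC gerBl mulr_ge0 ?ltW //.
  by rewrite divr_gt0 // mulr_gt0.
(* Logarithm of the root of order [k + 1] of [EX p n k.+1 < n ^ d], with [l = ln (k + 1)]. *)
have F3 : L - l - c * k%:R / 2 <= d * L / (k%:R + 1).
  have k1n : (k.+1 <= n)%N by [].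
  have H : (n%:R / k.+1%:R) ^+ k.+1 * expR (- (c * (k.+1%:R * (k.+1%:R - 1) / 2))) <= expR (d * L) :> R.
    apply: le_trans (ltW EXk1); rewrite /EX cpE // -/c expR_bin2 ler_wpM2r ?expR_ge0 //.
    rewrite exprMn exprVn ler_pdivrMr ?exprn_gt0 // -!natrX -natrM ler_nat; exact: expn_le_bin.
  rewrite ler_pdivlMr; last by lra.
  move: H; rewrite kS nE lE -expRN -expRD -expRM_natl -expRD ler_expR -lE kS.
  by move=> H; apply: le_trans H; apply: eq_ler; field.
have k1r : 0 < k%:R + 1 :> R by lra.
have d2 : d * L <= L / 3 by have := ler_wpM2r (ltW L0) d3; lra.
have F4 : L <= c * k%:R.
  have : d * L / (k%:R + 1) <= d * L / 2.
    by rewrite ler_wpM2l ?lef_pV2 ?posrE ?mulr_ge0 ?(ltW d0) ?(ltW L0) //; lra.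
  lra.
have kL : L <= k%:R by apply: le_trans F4 _; rewrite ler_piMl // ltW.
have F5 : d * L / (k%:R + 1) <= 1.
  by rewrite ler_pdivrMr // mul1r; lra.
have F6 : n%:R / k.+1%:R * expR (- (c * k%:R / 2)) <= expR 1 :> R.
  by rewrite nE kS lE -expRN -!expRD ler_expR; lra.
split=> //; first by apply: le_trans F2; rewrite lerDl.
have n0 : 0 < n%:R :> R by rewrite nE expR_gt0.
move: F6; rewrite mulrAC ler_pdivrMr ?ltr0n // kS => F6.
rewrite ler_pdivlMr // mulrC; apply: le_trans F6 _.
have := @expR1_le4 R; have := expR_ge0 (1 : R); nra.
Qed.

(* At the threshold size the expected number of independent sets is still large,
   and the second moment is governed by nearly disjoint and nearly equal pairs. *)
Lemma alpha_lower (N : nat) (d e : R) : (6 <= N)%N -> 0 < d <= 1 / 3 -> 0 < e ->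
  exists L0 : R, forall (n : nat) (p : R), L0 <= ln n%:R ->
    0 < p < 1 / 2 -> expR (- ((1 / 3 - 1 / N%:R) * ln n%:R)) <= p ->
  exists k, [/\ (0 < k < n)%N, mu p (upper_pairs n) (fun E => (alpha E < k)%N%:R) <= e,
    EX p n k.+1 < expR (d * ln n%:R), ln n%:R <= cp p * k%:R &
    n%:R / k.+1%:R * expR (- (cp p * k%:R / 2)) <= expR 1].
Proof.
move=> N6 /[dup] d03 /andP[d0 d3] e0.
have N0 : (0 : R) < N%:R by rewrite ltr0n; apply: leq_trans N6.
have N4 : (0 : R) < 1 / (4 * N%:R) by rewrite divr_gt0 // mulr_gt0.
have N2 : (0 : R) < 1 / (2 * N%:R) by rewrite divr_gt0 // mulr_gt0.
have [x1 x10 H1] := poly_le_expR (expR 1 * 64 + 2 + 4 / e) 0 N4.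
have p24 : (0 : R) < 1 / 24 by lra.
have [x2 x20 H2] := poly_le_expR (32 * N%:R * 2 ^+ N * expR (1 / 2) : R) 0 p24.
have [x3 x30 H3] := poly_le_expR (4 : R) 1 N2.
have [x4 x40 H4] := poly_le_expR (4 / e) 0 d0.
exists (1 + x1 + x2 + x3 + x4) => n p; set L := ln _ => hL p02 pN.
have L1 : 1 <= L by lra.
have n1 : (1 < n)%N.
  rewrite ltnNge; apply/negP => n1; have : L <= 0 by apply: ln_le0; rewrite -[1]/(1%:R) ler_nat.
  lra.
have nE : n%:R = expR L by rewrite lnK // posrE ltr0n ltnW.
have {}H1 : expR 1 * 64 + 2 + 4 / e <= expR (L / (4 * N%:R)).
  by have := H1 L; rewrite expr0 mulr1 [1 / _ * L]mulrC div1r; apply; lra.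
have {}H2 : 32 * N%:R * 2 ^+ N * expR (1 / 2) <= expR (L / 24).
  by have := H2 L; rewrite expr0 mulr1 [1 / 24 * L]mulrC [1 / 24]div1r; apply; lra.
have {}H3 : 2 + 2 * L <= expR (1 / (2 * N%:R) * L).
  by apply: le_trans (H3 L _); rewrite ?expr1; lra.
have {}H4 : 4 / e <= expR (d * L).
  by have := H4 L; rewrite expr0 mulr1; apply; lra.
have p01 : 0 < p < 1 by lra.
have d01 : 0 < d <= 1 by lra.
have [k [/[dup] k0n /andP[k0 kn] EXk EXk1]] := exists_threshold_size n1 nE p01 d01.
have Lp : 0 < L by lra.
have [F1 F2 F4 F5 F6] := threshold_size_bounds nE p02 pN N6 d03 Lp H3 k0n EXk EXk1.
exists k; split=> //.
have [c1 c2 c3] := cp_bounds p02.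
have c01 : 0 < cp p <= 1 by rewrite c3 andbT; apply: lt_le_trans c1; case/andP: p02.
apply: le_trans (alpha_lt_prob p01 _) _; first by rewrite k0 ltnW.
rewrite cpE; last by case/andP: p01.
set x := expR (- (L / (4 * N%:R))).
have e4 : 0 <= 4 / e by rewrite divr_ge0 // ltW.
have e1 := expR_gt0 (1 : R).
have xh : x <= 1 / 2.
  rewrite /x expRN div1r lef_pV2 ?posrE ?expR_gt0 //.
  by apply: le_trans H1; lra.
have x0 : 0 <= x := expR_ge0 _.
have xe : x <= e / 4.
  rewrite /x expRN -[e / 4]invf_div lef_pV2 ?posrE ?expR_gt0 ?divr_gt0 //.
  by apply: le_trans H1; lra.
have de : expR (- (d * L)) <= e / 4.
  by rewrite expRN -[e / 4]invf_div lef_pV2 ?posrE ?expR_gt0 ?divr_gt0.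
apply: (@le_trans _ _ (\sum_(s < k.+1 | (1 < s)%N) (x ^+ s + expR (- (d * L)) * x ^+ (k - s)))).
  apply: ler_sum => s s1.
  apply: (second_moment_term nE c01 _ N6 _ H2 F1 F2 F4 F5).
  - by rewrite k0 ltnW.
  - by apply: le_trans H1; lra.
  - by rewrite /EX cpE // in EXk; case/andP: p01.
  - by rewrite s1 -ltnS ltn_ord.
rewrite big_split /= -big_distrr /=.
have xx : 0 <= x <= 1 / 2 by rewrite x0.
have S1 : \sum_(s < k.+1 | (1 < s)%N) x ^+ s <= 2 * x.
  apply: le_trans (geometric_le2x k xx).
  rewrite big_mkcond [leRHS]big_mkcond; apply: ler_sum => s _.
  by case: (nat_of_ord s) => [|[|j]] //=; rewrite ?exprn_ge0.
have S2 : \sum_(s < k.+1 | (1 < s)%N) x ^+ (k - s) <= 2.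
  apply: le_trans (geometric_le2 k.+1 xx).
  rewrite [leRHS](reindex_inj rev_ord_inj) /= big_mkcond; apply: ler_sum => s _.
  by rewrite subSS; case: ifP => // _; rewrite exprn_ge0.
have S3 : expR (- (d * L)) * \sum_(s < k.+1 | (1 < s)%N) x ^+ (k - s) <= e / 4 * 2.
  by apply: ler_pM => //; apply: sumr_ge0 => s _; exact: exprn_ge0.
lra.
Qed.

(* With [m = k + 1 + j] vertices there are at most [j] bicliques, and passing from [k + 1] to [m]
   vertices costs a factor [(n / (k + 1)) phi^(k/2)] per biclique once [weight^j] is absorbed. *)
Lemma bad_structure_prob (p d : R) (n k : nat) (e1 x : R) : 0 < p < 1 -> (0 < k < n)%N ->
  (forall M : {set 'I_n}, (k < #|M|)%N -> weight p M 2 <= expR ((1 / 2 - d) * (cp p * #|M|%:R))) ->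
  0 < d <= 1 / 2 -> EX p n k.+1 <= e1 ->
  n%:R / k.+1%:R * expR (- (cp p * k%:R / 2)) * expR (- (d * (cp p * k%:R))) <= x -> 0 <= x <= 1 / 4 ->
  mu p (upper_pairs n) (fun E => `[< exists M f, [/\ properly_decomposed E M f, (0 < f)%N & (k + f < #|M|)%N] >]%:R)
    <= 4 * (e1 * x).
Proof.
move=> p01 /andP[k0 kn] hW /andP[d0 d2] hE hx /andP[x0 x4].
have p01' : 0 <= p <= 1 by case/andP: p01 => /ltW -> /ltW ->.
have p1 : p < 1 by case/andP: p01.
have pp0 : 0 < p by case/andP: p01.
set c := cp p in hW hx *.
have c0 : 0 < c by rewrite oppr_gt0 ln_lt0 //; lra.
pose V m : R := expR ((1 / 2 - d) * (c * m%:R)).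
have V1 m : 1 <= V m.
  by rewrite -[leLHS]expR0 ler_expR mulr_ge0 ?(mulr_ge0 (ltW c0)) //; lra.
pose G m : R := if (k.+1 < m)%N then (m - k.+1)%:R * ((1 - p) ^+ 'C(m, 2) * V m ^+ (m - k.+1)) else 0.
have q0 j : 0 <= (1 - p) ^+ j by rewrite exprn_ge0 //; lra.
apply: (@le_trans _ _ (\sum_(M : {set 'I_n} | M \subset setT) G #|M|)).
  apply: (@le_trans _ _ (mu p (upper_pairs n) (fun E => \sum_(M : {set 'I_n} | M \subset setT)
     \sum_(f < n.+1 | (0 < f)%N && (k + f < #|M|)%N) `[< properly_decomposed E M f >]%:R))).
    apply: le_mu => // E _; case: (boolP `[< _ >]) => [/asboolP[M [f [pd f0 fM]]]|_]; last first.
      by rewrite sumr_ge0 // => M _; rewrite sumr_ge0.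
    have fn : (f < n.+1)%N.
      rewrite ltnS; apply: leq_trans (_ : #|M| <= n)%N; first by apply: leq_trans (ltnW fM); exact: leq_addl.
      by rewrite -[X in (_ <= X)%N]card_ord max_card.
    rewrite (bigD1 M) ?subsetT //= (bigD1 (Ordinal fn)) ?f0 ?fM //= (asboolT pd) -addrA lerDl addr_ge0 // sumr_ge0 // => M' _.
    by rewrite sumr_ge0.
  rewrite mu_sum; apply: ler_sum => M _; rewrite mu_sum.
  rewrite /G; case: ltnP => [kM|Mk]; last first.
    rewrite big_pred0 // => f; apply/negP => /andP[f0 fM].
    by move: (leq_trans fM Mk); rewrite ltnS -[X in (_ <= X)%N]addn0 leq_add2l leqNgt f0.
  have W0 : 0 <= weight p M 2.
    by rewrite addr_ge0 // sumr_ge0 // => AB _; rewrite exprn_ge0 // divr_ge0 //; lra.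
  apply: (@le_trans _ _ (\sum_(f < n.+1 | (0 < f)%N && (k + f < #|M|)%N) (1 - p) ^+ 'C(#|M|, 2) * V #|M| ^+ (#|M| - k.+1))).
    apply: ler_sum => f /andP[f0 fM]; apply: le_trans (properly_decomposed_prob2 p01 _ _) _.
    rewrite ler_wpM2l //; apply: (@le_trans _ _ (V #|M| ^+ f)).
      by rewrite lerXn2r ?nnegrE ?expR_ge0 // hW // ltnW.
    by rewrite ler_weXn2l // leq_subRL ?addSn // ltnW.
  rewrite sumr_const -[leLHS]mulr_natl ler_wpM2r ?(mulr_ge0 (q0 _)) ?exprn_ge0 ?expR_ge0 // ler_nat.
  rewrite cardE -(size_map val) -[X in (_ <= X)%N](size_iota 1).
  apply: uniq_leq_size => [|y /mapP[f]]; first by rewrite map_inj_uniq ?enum_uniq //; exact: val_inj.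
  rewrite mem_enum unfold_in => /andP[f0 fM] ->; rewrite mem_iota f0 /= add1n ltnS.
  by rewrite leq_subRL ?addSn // ltnW.
rewrite (sum_subset_card [set: 'I_n] G) cardsT card_ord.
have EXS j : EX p n (k.+1 + j) <= e1 * ((n%:R / k.+1%:R) ^+ j * expR (- (c * (j%:R * (2 * k%:R + 1 + j%:R) / 2)))).
  rewrite /EX cpE // -/c expR_bin2.
  have B i : 'C(n, k.+1 + i)%:R <= 'C(n, k.+1)%:R * (n%:R / k.+1%:R) ^+ i :> R.
    elim: i => [|i IH]; first by rewrite addn0 expr0 mulr1.
    rewrite addnS exprSr mulrA; apply: le_trans (ler_wpM2r _ IH); last by rewrite divr_ge0.
    rewrite mulrA ler_pdivlMr ?ltr0n // -!natrM ler_nat.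
    have := mul_bin_left n (k.+1 + i) => H.
    apply: leq_trans (_ : (k.+1 + i).+1 * 'C(n, (k.+1 + i).+1) <= _)%N.
      by rewrite mulnC leq_mul2r ltnW ?orbT // ltnS leq_addr.
    by rewrite H mulnC leq_mul2l leq_subr orbT.
  apply: (@le_trans _ _ ('C(n, k.+1)%:R * (n%:R / k.+1%:R) ^+ j * expR (- (c * ((k.+1 + j)%:R * ((k.+1 + j)%:R - 1) / 2))))).
    by rewrite ler_wpM2r ?expR_ge0.
  have -> : - (c * ((k.+1 + j)%:R * ((k.+1 + j)%:R - 1) / 2)) =
     - (c * (k.+1%:R * (k.+1%:R - 1) / 2)) + - (c * (j%:R * (2 * k%:R + 1 + j%:R) / 2)).
    by rewrite natrD -natr1; field.
  rewrite expRD.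
  set A := 'C(n, _)%:R; set Bj := _ ^+ j; set F1 := expR _; set F2 := expR _.
  have -> : A * Bj * (F1 * F2) = (A * F1) * (Bj * F2) by ring.
  rewrite ler_wpM2r ?mulr_ge0 ?exprn_ge0 ?divr_ge0 ?expR_ge0 //.
  by apply: le_trans hE; rewrite /EX cpE // -/c expR_bin2.
have e10 : 0 <= e1 by apply: le_trans hE; rewrite mulr_ge0.
apply: (@le_trans _ _ (\sum_(m < n.+1) if (k.+1 < m)%N then e1 * (2 * x) ^+ (m - k.+1) else 0)).
  apply: ler_sum => m _; rewrite /G; case: ifP => [km|_]; last by rewrite mulr0.
  pose j := (m - k.+1)%N; have mE : nat_of_ord m = (k.+1 + j)%N by rewrite /j subnKC // ltnW.
  rewrite -/j mE.
  have -> (C q v : R) : C * (j%:R * (q * v)) = j%:R * (C * q * v) by ring.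
  rewrite -/(EX p n (k.+1 + j)).
  apply: (@le_trans _ _ (j%:R * (e1 * ((n%:R / k.+1%:R) ^+ j * expR (- (c * (j%:R * (2 * k%:R + 1 + j%:R) / 2)))) * V (k.+1 + j)%N ^+ j))).
    by rewrite ler_wpM2l // ler_wpM2r ?exprn_ge0 ?expR_ge0 //; exact: EXS.
  (* The number [j] of values of [f] is absorbed by doubling the ratio of the geometric series. *)
  have jp : (j%:R : R) <= 2 ^+ j by rewrite -natrX ler_nat ltnW // ltn_expl.
  have -> : j%:R * (e1 * ((n%:R / k.+1%:R) ^+ j * expR (- (c * (j%:R * (2 * k%:R + 1 + j%:R) / 2)))) * V (k.+1 + j)%N ^+ j)
    = e1 * (j%:R * ((n%:R / k.+1%:R) * expR (- (c * k%:R / 2)) * expR (- (d * (c * (k.+1 + j)%:R)))) ^+ j).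
    rewrite !exprMn -!expRM_natl.
    set Bj := (n%:R ^+ j * _ : R).
    have -> : expR (- (c * (j%:R * (2 * k%:R + 1 + j%:R) / 2))) =
      expR (j%:R * - (c * k%:R / 2)) * expR (j%:R * - (d * (c * (k.+1 + j)%:R))) * expR (- (j%:R * ((1 / 2 - d) * (c * (k.+1 + j)%:R)))).
      by rewrite -!expRD; congr expR; rewrite natrD -natr1; field.
    rewrite expRN; field; by rewrite gt_eqF ?expR_gt0.
  rewrite ler_wpM2l // [in leRHS]exprMn; apply: ler_pM => //.
  rewrite lerXn2r ?nnegrE ?mulr_ge0 ?invr_ge0 ?expR_ge0 //.
  apply: le_trans hx; rewrite ler_wpM2l ?mulr_ge0 ?invr_ge0 ?expR_ge0 // ler_expR.
  rewrite lerN2 (ler_wpM2l (ltW d0)) // (ler_wpM2l (ltW c0)) // ler_nat.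
  by apply: leq_trans (leq_addr _ _).
rewrite -big_mkcond /= -(big_mkord (fun m => (k.+1 < m)%N) (fun m => e1 * (2 * x) ^+ (m - k.+1))).
rewrite (big_cat_nat (n := k.+1)) //=; last by rewrite ltnW // ltnS.
rewrite big_nat_cond big_pred0 ?add0r; last by move=> m; case: ltngtP => //= H1; rewrite andbF.
rewrite -{1}[k.+1]add0n big_addn -big_distrr /=.
rewrite mulrCA ler_wpM2l //.
have -> : 4 * x = 2 * (2 * x) by ring.
have x2 : 0 <= 2 * x <= 1 / 2 by lra.
apply: le_trans (geometric_le2x (n - k.+1) x2).
rewrite subSn // big_mkord; apply: eq_ler; apply: eq_big => [i|i _]; last by rewrite addnK.
by rewrite -{1}[k.+1]add0n ltn_add2r.
Qed.

End SparseRegime.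

(** * The equality regime *)

Section PartOne.
Variable R : realType.

Lemma whp_compl (p : nat -> R) (A : forall n, pred {set 'I_n * 'I_n}) :
  (forall e : R, 0 < e -> exists n0, forall n, (n0 <= n)%N ->
     0 <= p n <= 1 /\ mu (p n) (upper_pairs n) (fun E => (~~ A n E)%:R) <= e) ->
  whp (fun n => Gnp_prob n (p n) (A n)).
Proof.
move=> H; apply/cvgrPdist_le => e e0; have [n0 Hn0] := H e e0.
exists n0 => // n /= nn0; have [pn le] := Hn0 n nn0.
rewrite Gnp_probE; have -> : 1 - mu (p n) (upper_pairs n) (fun E => (A n E)%:R) =
    mu (p n) (upper_pairs n) (fun E => (~~ A n E)%:R).
  rewrite [RHS](eq_mu (p n) (g := fun E => 1 + -1 * (A n E)%:R)); last first.
    by move=> E _; rewrite mulN1r; case: (A n E); rewrite /= ?subrr ?subr0.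
  by rewrite muD muZ mu_cst mulN1r.
rewrite ger0_norm //; apply: mu_ge0 => // E _; exact: ler0n.
Qed.

Lemma mu_orb (T : finType) (p : R) (D : {set T}) (P P1 P2 : {set T} -> bool) e1 e2 : 0 <= p <= 1 ->
  (forall E : {set T}, E \subset D -> P E -> P1 E || P2 E) ->
  mu p D (fun E => (P1 E)%:R) <= e1 -> mu p D (fun E => (P2 E)%:R) <= e2 ->
  mu p D (fun E => (P E)%:R) <= e1 + e2.
Proof.
move=> p01 H H1 H2; apply: le_trans (lerD H1 H2); rewrite -muD; apply: le_mu => // E ED.
rewrite -natrD ler_nat; case: (P E) (H E ED) => //= /(_ isT).
by case: (P1 E); case: (P2 E).
Qed.

(** Of the slack [2 d], half pays for the quasi-polynomial factor. The threshold bears on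
    [cp p * #|M|], so a single [Y0] serves densities that tend to 0. *)
Lemma weight2_le (d rb : R) : 0 < rb < 1 -> 0 < d <= 1 / 4 ->
  exists Y0 : R, forall (p : R) n (M : {set 'I_n}), 0 < p < 1 / 2 -> p / (1 - p) <= rb ->
    1 + (p / (1 - p)) ^+ 2 <= expR ((1 / 2 - 2 * d) * cp p) -> Y0 <= cp p * #|M|%:R ->
    weight p M 2 <= expR ((1 / 2 - d) * (cp p * #|M|%:R)).
Proof.
move=> rb01 /andP[d0 d4]; have d20 : 0 < d / 2 by rewrite divr_gt0.
have [Y0 _ HY] := weight_large_le rb01 d20.
exists (2 * Y0) => p n M p02 rle r2 Yle.
have [c1 c2 c3] := cp_bounds p02; have [p0 p2] := andP p02.
have p01 : 0 < p < 1 by lra.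
have r1 : p <= p / (1 - p) by rewrite ler_pdivlMr; nra.
have r3 : p / (1 - p) <= 2 * p by rewrite ler_pdivrMr; nra.
rewrite /weight (_ : [set A | small_side M 2 A] = set0) ?cards0 ?add0r; last first.
  by apply/setP => A; rewrite !inE /small_side; case: #|A| => [|[|k]]; rewrite ?andbF.
set m : R := #|M|%:R in Yle *; have m0 : 0 <= m by [].
apply: le_trans (HY p n M 2 p01 rle _ _) _ => //.
  by rewrite -/m; nra.
rewrite -/m; apply: (@le_trans _ _ (expR (d / 2 * (m * (p / (1 - p)))) * expR ((1 / 2 - 2 * d) * cp p) ^+ #|M|)).
  rewrite ler_wpM2l ?expR_ge0 // lerXn2r ?nnegrE ?expR_ge0 //.
  by rewrite addr_ge0 // sqr_ge0.
rewrite -expRM_natl -/m -expRD ler_expR.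
have : m * (p / (1 - p)) <= m * (2 * cp p) by rewrite ler_wpM2l //; lra.
nra.
Qed.

(** The size [k] is taken at the threshold [n ^ (d / 2)]. When [alpha >= k], a discrepancy needs a
    set [M] with more than [k + f] vertices and [f > 0] bicliques. *)
Lemma bp_eq_alpha_whp (p : nat -> R) (N n0 : nat) (rb d : R) : (6 <= N)%N -> 0 < rb < 1 ->
  0 < d <= 1 / 4 ->
  (forall n, (n0 <= n)%N -> [/\ 0 < p n < 1 / 2, expR (- ((1 / 3 - 1 / N%:R) * ln n%:R)) <= p n,
     p n / (1 - p n) <= rb & 1 + (p n / (1 - p n)) ^+ 2 <= expR ((1 / 2 - 2 * d) * cp (p n))]) ->
  whp (fun n => Gnp_prob n (p n) (fun E => bp E == (n - alpha E)%N)).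
Proof.
move=> N6 rb01 /[dup] d04 /andP[d0 d4] Hp; apply: whp_compl => e e0.
have d2 : 0 < d / 2 <= 1 / 3 by lra.
have d20 : 0 < d / 2 by lra.
have e2 : 0 < e / 2 by lra.
have [L1 HL1] := alpha_lower N6 d2 e2.
have [Y0 HY] := weight2_le rb01 d04.
have [x1 x10 H1] := poly_le_expR (8 * expR 1 / e) 0 d20.
have [x2 x20 H2] := poly_le_expR (4 * expR 1) 0 d0.
have [n1 Hn1] := @ltn_ln_eventually R (`|L1| + `|Y0| + x1 + x2).
exists (maxn n0 n1) => n; rewrite geq_max => /andP[nn0 nn1].
have [p02 pN rle r2] := Hp n nn0.
set L : R := ln n%:R in pN *; have LL : `|L1| + `|Y0| + x1 + x2 <= L := Hn1 n nn1.
have [A1 A2] : L1 <= `|L1| /\ Y0 <= `|Y0| by split; exact: ler_norm.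
have [B1 B2] : 0 <= `|L1| /\ 0 <= `|Y0| by [].
have p01 : 0 < p n < 1 by lra.
have p01' : 0 <= p n <= 1 by lra.
split=> //.
have L1L : L1 <= L by lra.
have [k [k0n ak EXk Lck Fk]] := HL1 n (p n) L1L p02 pN.
have ee : e = e / 2 + e / 2 by lra.
rewrite [leRHS]ee.
apply: (mu_orb (P1 := fun E => (alpha E < k)%N)
  (P2 := fun E => `[< exists M f, [/\ properly_decomposed E M f, (0 < f)%N & (k + f < #|M|)%N] >])) => //.
  move=> E EU /(bp_neq_alpha EU)[M [f [pd f0 fM]]].
  case: ltnP => //= ka; apply/asboolP; exists M, f; split=> //.
  by apply: leq_ltn_trans fM; rewrite leq_add2r.
have c0 : 0 < cp (p n) by have [c1 _ _] := cp_bounds p02; apply: lt_le_trans c1; case/andP: p02.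
(* Cost of one biclique: [n ^ (- d)] against the [n ^ (d / 2)] independent sets of size [k + 1],
   which leaves [n ^ (- d / 2)]. *)
pose x := expR 1 * expR (- (d * L)).
have xe : 4 * (expR (d / 2 * L) * x) <= e / 2.
  have := H1 L; rewrite expr0 mulr1 => H.
  have {}H : 8 * expR 1 / e <= expR (d / 2 * L) by apply: H; lra.
  have -> : 4 * (expR (d / 2 * L) * x) = 4 * expR 1 / expR (d / 2 * L).
    rewrite /x -expRN [expR (d / 2 * L) * _]mulrCA -expRD mulrA; congr (_ * expR _); by field.
  rewrite ler_pdivrMr ?expR_gt0 //; move: H; rewrite ler_pdivrMr //; lra.
apply: le_trans xe; apply: (bad_structure_prob (d := d)) k0n _ _ _ _ _ => //.
- move=> M kM; apply: HY => //; apply: (@le_trans _ _ L); first by lra.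
  by apply: le_trans Lck _; rewrite ler_pM2l // ler_nat ltnW.
- lra.
- exact: ltW.
- by rewrite /x; apply: ler_pM => //; rewrite ?mulr_ge0 ?invr_ge0 ?expR_ge0 ?ler_expR // lerN2 ler_wpM2l // ltW.
rewrite /x mulr_ge0 ?expR_ge0 //= expRN ler_pdivrMr ?expR_gt0 //.
have := H2 L; rewrite expr0 mulr1 => H.
have {}H : 4 * expR 1 <= expR (d * L) by apply: H; lra.
lra.
Qed.

Lemma bp_eq_alpha_constant (p : R) : 0 < p < 1 / 2 -> 4 * p ^+ 3 - 7 * p ^+ 2 + 5 * p - 1 < 0 ->
  whp (fun n => Gnp_prob n p (fun E => bp E == (n - alpha E)%N)).
Proof.
move=> ph pol; have [pp p2] := andP ph.
have [c1 c2 c3] := cp_bounds ph.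
have c0 : 0 < cp p by lra.
have q0 : 0 < 1 - p by lra.
set r := p / (1 - p).
have r0 : 0 < r by rewrite divr_gt0.
have r1 : r < 1 by rewrite /r ltr_pdivrMr //; lra.
pose l := ln (1 + r ^+ 2).
have lE : 1 + r ^+ 2 = expR l by rewrite lnK // posrE addr_gt0 // exprn_gt0.
have lc : l < cp p / 2.
  suff H : (1 + r ^+ 2) ^+ 2 < expR (cp p).
    by move: H; rewrite lE -expRM_natl ltr_expR; lra.
  have -> : expR (cp p) = (1 - p)^-1 by rewrite -[cp p]opprK expRN -cpE //; lra.
  rewrite -[ltRHS]mul1r ltr_pdivlMr //.
  have -> : (1 + r ^+ 2) ^+ 2 * (1 - p) = 1 + p * (4 * p ^+ 3 - 7 * p ^+ 2 + 5 * p - 1) / (1 - p) ^+ 3.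
    by rewrite /r; field; rewrite gt_eqF.
  by rewrite gtrDl pmulr_llt0 ?invr_gt0 ?exprn_gt0 // pmulr_rlt0.
(* The second entry is the largest [d] for which [l <= (1 / 2 - 2 * d) * cp p]. *)
pose d := Num.min (1 / 4) ((1 / 2 - l / cp p) / 2).
have lc2 : l / cp p < 1 / 2 by rewrite ltr_pdivrMr //; lra.
have d0 : 0 < d <= 1 / 4.
  apply/andP; split; last by rewrite /d ge_min lexx.
  by rewrite /d lt_min; apply/andP; split; lra.
have dl : d <= (1 / 2 - l / cp p) / 2 by rewrite /d ge_min lexx orbT.
(* With [N = 6] the density only has to exceed [n ^ (- 1 / 6)]. *)
have [n0 Hn0] := @ltn_ln_eventually R (- ln p * 6).
apply: (@bp_eq_alpha_whp (fun=> p) 6 n0 r d) => // [|n nn0]; first by rewrite r0.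
split=> //; last first.
  rewrite -/r lE ler_expR; have := ler_wpM2r (ltW c0) dl.
  have -> : (1 / 2 - l / cp p) / 2 * cp p = cp p / 4 - l / 2 by field; rewrite gt_eqF.
  lra.
rewrite -[leRHS]lnK ?posrE // ler_expR; have := Hn0 n nn0; lra.
Qed.

Lemma bp_eq_alpha_power (g : R) : - (1 / 3) < g < 0 ->
  whp (fun n => Gnp_prob n ((n%:R : R) `^ g) (fun E => bp E == (n - alpha E)%N)).
Proof.
move=> /andP[g3 g0].
pose N := maxn 6 (Num.truncn (1 / (g + 1 / 3))).+1.
have N6 : (6 <= N)%N by exact: leq_maxl.
have N0 : (0 : R) < N%:R by rewrite ltr0n; apply: leq_trans N6.
have Ng : 1 / N%:R <= g + 1 / 3.
  rewrite ler_pdivrMr // mulrC -ler_pdivrMr; last by lra.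
  apply: ltW; apply: lt_le_trans (truncnS_gt _) _; rewrite ler_nat; exact: leq_maxr.
(* Beyond [n0] the density is at most [1 / 8], and the square of [p / (1 - p)] is then below
   [3 / 8 * cp p], which is the requirement for [d = 1 / 16]. *)
have [n0 Hn0] := @ltn_ln_eventually R (1 + ln 8 / (- g)).
apply: (@bp_eq_alpha_whp _ N n0 (1 / 2) (1 / 16)) => // [||n nn0]; [lra|lra|].
have := Hn0 n nn0; set L : R := ln n%:R => hL.
have l8 : 0 <= ln 8 / (- g) :> R by rewrite divr_ge0 ?ln_ge0 //; lra.
have n0' : n%:R != 0 :> R.
  rewrite pnatr_eq0; apply/negP => /eqP nE0; have : L <= 0 by rewrite /L nE0 ln0.
  lra.
have pE : n%:R `^ g = expR (g * L) by rewrite /powR (negPf n0').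
have p8 : n%:R `^ g <= 1 / 8.
  rewrite pE -[leRHS]lnK ?posrE; last by lra.
  rewrite ler_expR div1r lnV ?posrE // -lerN2 opprK -mulNr mulrC -ler_pdivrMr; lra.
have pp : 0 < n%:R `^ g by rewrite pE expR_gt0.
set p := n%:R `^ g in pE p8 pp *.
have ph : 0 < p < 1 / 2 by lra.
have [c1 c2 c3] := cp_bounds ph.
have q0 : 0 < 1 - p by lra.
have r87 : p / (1 - p) <= 8 / 7 * p by rewrite ler_pdivrMr //; nra.
have r0 : 0 < p / (1 - p) by rewrite divr_gt0.
split=> //; last 2 first.
- lra.
- apply: le_trans (expR_ge1Dx _) _; rewrite ler_expR; set r := p / (1 - p) in r87 r0 *; nra.
rewrite pE ler_expR -mulNr ler_wpM2r //; lra.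
Qed.

End PartOne.

(** * Isolated edges *)

Section IsolatedEdges.
Variables (n t K D : nat) (A : 'I_t -> {set 'I_n}) (M : {set 'I_n}).
Hypothesis AM : forall i, small_side M K (A i).
Hypothesis tM : (t <= #|M|)%N.
Implicit Types (E : {set 'I_n * 'I_n}) (x y z u v w : 'I_n) (i j : 'I_t).

Definition deg v := #|[set i | v \in A i]|.

Definition hub := [set v | (D < deg v)%N].

Definition hubfree i := [disjoint A i & hub].

(* The edge [xz] lies in no biclique whose left side is hub-free and contains [x]. *)
Definition blocked E x z :=
  [forall i, [&& hubfree i, x \in A i & z \notin A i] ==> [exists y in A i :\ x, ~~ adj E y z]].

(** Either end may be the one on the left side, hence the two conditions. Whatever the right sides,
    such an edge can be covered only by a biclique whose left side meets [hub]. *)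
Definition lone_edge E x z := [&& adj E x z, blocked E x z & blocked E z x].

Let A_sub i : A i \subset M. Proof. by case/and3P: (AM i). Qed.
Let A_small i : (#|A i| <= K)%N. Proof. by case/and3P: (AM i) => _ _ /ltnW. Qed.

Lemma sum_deg : (\sum_(v in M) deg v = \sum_i #|A i|)%N.
Proof.
transitivity (\sum_(v in M) \sum_i (v \in A i : nat))%N.
  apply: eq_bigr => v _; rewrite /deg -sum1_card big_mkcond /=.
  by apply: eq_bigr => i _; rewrite inE; case: (v \in A i).
rewrite exchange_big /=; apply: eq_bigr => i _; rewrite -sum1_card.
rewrite big_mkcond [RHS]big_mkcond; apply: eq_bigr => v _.
case: (boolP (v \in A i)) => [/(subsetP (A_sub i)) -> //|_]; by case: ifP.
Qed.

Lemma card_hub : (#|hub| * D <= #|M| * K)%N.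
Proof.
have hM : hub \subset M.
  apply/subsetP => v; rewrite inE => Dd; have : (0 < deg v)%N by apply: leq_ltn_trans Dd.
  by case/card_gt0P => i; rewrite inE => /(subsetP (A_sub i)).
apply: (@leq_trans (\sum_(v in hub) deg v)).
  rewrite -sum_nat_const; apply: leq_sum => v; rewrite inE; exact: ltnW.
apply: (@leq_trans (\sum_(v in M) deg v)).
  rewrite [X in (_ <= X)%N](big_setID hub) /= (setIidPr hM); exact: leq_addr.
rewrite sum_deg; apply: (@leq_trans (\sum_(i < t) K)); first exact: leq_sum.
by rewrite sum_nat_const card_ord leq_mul2r tM orbT.
Qed.

(** A lone edge has an end [z] in some [B i] and the other end in [A i], where [A i] meets [hub].
    For fixed [z], a hub of [A i] determines [i], because the edge from that hub to [z] is covered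
    once. So at most [#|hub|] indices occur, each with at most [K] other ends. *)
Lemma few_isolated E (B : 'I_t -> {set 'I_n}) (G : {set 'I_n}) : E \subset upper_pairs n ->
  G \subset M ->
  (forall x y, x \in M -> y \in M -> (\sum_i (in_biclique (A i, B i) x y : nat))%N = adj E x y) ->
  (#|[set u in pairs G | lone_edge E u.1 u.2]| <= 2 * (#|M| * (K * #|hub|)))%N.
Proof.
move=> EU GM dec.
have cov x y i : x \in M -> y \in M -> in_biclique (A i, B i) x y -> adj E x y.
  move=> xM yM inb; have := dec x y xM yM; rewrite (bigD1 i) //= inb.
  by case: (adj E x y).
have dis i y : y \in M -> y \in B i -> y \notin A i.
  move=> yM yB; apply/negP => yA; have := cov y y i yM yM; rewrite adj_irr // => /(_ _).
  by move=> H; suff : false by []; apply: H; rewrite /in_biclique /= yA yB.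
have one i j v z : v \in M -> z \in M -> v \in A i -> z \in B i -> v \in A j -> z \in B j -> i = j.
  move=> vM zM v1 z1 v2 z2; apply/eqP; apply: contraT => ij.
  have := dec v z vM zM; rewrite (bigD1 i) //= (bigD1 j) ?(eq_sym j) //=.
  by rewrite /in_biclique /= v1 z1 v2 z2 /=; case: (adj E v z).
pose S := [set w : 'I_n * 'I_n | (w.2 \in M) && [exists i, [&& ~~ hubfree i, w.1 \in A i & w.2 \in B i]]].
have isoS x z i : x \in M -> z \in M -> blocked E x z -> x \in A i -> z \in B i -> (x, z) \in S.
  move=> xM zM /forallP/(_ i)/implyP bl xA zB; rewrite inE /= zM; apply/existsP; exists i.
  rewrite xA zB !andbT; apply/negP => fr.
  have := bl _; rewrite fr xA dis // => /(_ isT)/existsP[y /andP[]].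
  rewrite !inE => /andP[_ yA] /negP; apply; apply: (cov _ _ i) => //; first exact: (subsetP (A_sub i)).
  by rewrite /in_biclique /= yA zB.
pose sw (w : 'I_n * 'I_n) := (w.2, w.1).
apply: (@leq_trans (#|S :|: sw @: S|)).
  apply: subset_leq_card; apply/subsetP => -[x z]; rewrite !inE /= => /andP[/and3P[xz xG zG] /and3P[axz b1 b2]].
  have [xM zM] := (subsetP GM _ xG, subsetP GM _ zG).
  have : exists i, in_biclique (A i, B i) x z.
    have := dec x z xM zM; rewrite axz; case: (pickP (fun i => in_biclique (A i, B i) x z)) => [i inb _|H]; first by exists i.
    by rewrite big1 // => i _; rewrite H.
  move=> [i /orP[] /andP[/= H1 H2]]; apply/orP.
    by left; have := isoS x z i xM zM b1 H1 H2; rewrite inE.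
  by right; apply/imsetP; exists (z, x) => //; exact: (isoS z x i).
apply: leq_trans (leq_card_setU _ _) _.
suff cS : (#|S| <= #|M| * (K * #|hub|))%N.
  by rewrite mul2n -addnn leq_add // (leq_trans (leq_imset_card _ _)).
have -> : (#|S| = \sum_x \sum_z (if (x, z) \in S then 1 else 0))%N.
  by rewrite -sum1_card big_mkcond pair_bigA; apply: eq_bigr => -[].
rewrite exchange_big /= -sum_nat_const [X in (_ <= X)%N]big_mkcond /=; apply: leq_sum => z _.
case: ifP => zM; last by rewrite big1 // => x _; rewrite inE /= zM.
pose J := [set i | ~~ hubfree i & z \in B i].
apply: (@leq_trans (\sum_(i in J) K)%N); last first.
  rewrite sum_nat_const mulnC leq_mul2l; apply/orP; right.
  pose h i := if [pick v in A i :&: hub] is Some v then v else z.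
  have hP i : i \in J -> h i \in A i :&: hub.
    rewrite inE => /andP[nf _]; rewrite /h; case: pickP => // H.
    by move: nf; rewrite /hubfree -setI_eq0 => /set0Pn[v]; rewrite [_ \in _]H.
  have hinj : {in J &, injective h}.
    move=> i j iJ jJ e; have := hP i iJ; have := hP j jJ; rewrite -e !inE => /andP[v2 _] /andP[v1 _].
    move: iJ jJ; rewrite !inE => /andP[_ z1] /andP[_ z2].
    by apply: (one i j (h i) z) => //; exact: (subsetP (A_sub i)).
  rewrite -(card_in_imset hinj); apply: subset_leq_card; apply/subsetP => _ /imsetP[i iJ ->].
  by have := hP i iJ; rewrite inE => /andP[].
apply: (@leq_trans (\sum_x \sum_(i in J) (x \in A i : nat))%N).
  apply: leq_sum => x _; case: ifP => //; rewrite inE /= zM => /existsP[i /and3P[nf xA zB]].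
  by rewrite (bigD1 i) /= ?inE ?nf ?zB // xA.
rewrite exchange_big /=; apply: leq_sum => i _; apply: leq_trans (A_small i).
by rewrite -sum1_card [X in (_ <= X)%N]big_mkcond /=; apply: leq_sum => x _; case: (x \in A i).
Qed.

(** The vertices that share a hub-free left side with [v]. Discarding the sets that meet [hub] is
    what bounds its size: other vertices lie in at most [D] left sides. *)
Definition nbh v := v |: \bigcup_(i | hubfree i && (v \in A i)) A i.

Lemma card_nbh v : (#|nbh v| <= 1 + D * K)%N.
Proof.
rewrite /nbh cardsU1; apply: leq_add; first exact: leq_b1.
have [vh|vh] := boolP (v \in hub).
  rewrite big_pred0 ?cards0 // => i; apply/negP => /andP[fr vi].
  by move: fr; rewrite /hubfree -setI_eq0 => /eqP/setP/(_ v); rewrite in_setI vi vh in_set0.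
apply: (@leq_trans (\sum_(i | hubfree i && (v \in A i)) #|A i|)).
  elim/big_rec2: _ => [|i k U _ IH]; first by rewrite cards0.
  by apply: leq_trans (leq_card_setU _ _) _; rewrite leq_add2l.
apply: (@leq_trans (\sum_(i | v \in A i) K)).
  rewrite big_mkcond [X in (_ <= X)%N]big_mkcond; apply: leq_sum => i _.
  by case: (hubfree i); case: (v \in A i) => //=.
rewrite sum_nat_const leq_mul2r; apply/orP; right.
by move: vh; rewrite inE -leqNgt /deg cardsE.
Qed.

Lemma adjU1 E u w y z : adj ((u, w) |: E) y z =
  [|| (y == u) && (z == w), (y == w) && (z == u) | adj E y z].
Proof.
rewrite /adj !inE !xpair_eqE.
by case: (y == u); case: (z == w); case: (y == w); case: (z == u); case: ((y, z) \in E); case: ((z, y) \in E).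
Qed.

(** The pairs whose status may depend on the edge [uw]: blocking [xz] looks only at pairs [yz] with
    [y] in a hub-free left side containing [x], that is, with [x] in [nbh y]. *)
Definition touched u w := [set v : 'I_n * 'I_n |
  [|| (v.2 == w) && (v.1 \in nbh u), (v.2 == u) && (v.1 \in nbh w),
      (v.1 == w) && (v.2 \in nbh u) | (v.1 == u) && (v.2 \in nbh w)]].

Lemma card_touched u w : (#|touched u w| <= 4 * (1 + D * K))%N.
Proof.
have c x (U : {set 'I_n}) : (#|[set (y, x) | y in U]| <= #|U|)%N by exact: leq_imset_card.
have c' x (U : {set 'I_n}) : (#|[set (x, y) | y in U]| <= #|U|)%N by exact: leq_imset_card.
apply: (@leq_trans #|([set (y, w) | y in nbh u] :|: [set (y, u) | y in nbh w]) :|: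
   ([set (w, y) | y in nbh u] :|: [set (u, y) | y in nbh w])|).
  apply: subset_leq_card; apply/subsetP => -[x z]; rewrite inE /= => /or4P T.
  rewrite 3!in_setU; case: T => /andP[/eqP -> H]; apply/orP.
  - by left; apply/orP; left; apply/imsetP; exists x.
  - by left; apply/orP; right; apply/imsetP; exists x.
  - by right; apply/orP; left; apply/imsetP; exists z.
  - by right; apply/orP; right; apply/imsetP; exists z.
apply: leq_trans (leq_card_setU _ _) _.
apply: leq_trans (leq_add (leq_card_setU _ _) (leq_card_setU _ _)) _.
have H1 := leq_trans (c w (nbh u)) (card_nbh u).
have H2 := leq_trans (c u (nbh w)) (card_nbh w).
have H3 := leq_trans (c' w (nbh u)) (card_nbh u).
have H4 := leq_trans (c' u (nbh w)) (card_nbh w).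
rewrite (_ : 4 * (1 + D * K) = (1 + D * K + (1 + D * K)) + (1 + D * K + (1 + D * K)))%N; last by ring.
by rewrite !leq_add.
Qed.

Lemma blocked_untouched E u w x z : (x, z) \notin touched u w ->
  blocked ((u, w) |: E) x z = blocked E x z.
Proof.
move=> nt; apply: eq_forallb => i; case: (boolP [&& _, _ & _]) => //= /and3P[fr xA zA].
apply: eq_existsb => y; case: (boolP (y \in A i :\ x)) => //=; rewrite !inE => /andP[yx yA].
congr (~~ _); rewrite adjU1.
have xn : x \in nbh y.
  by rewrite !inE; apply/orP; right; apply/bigcupP; exists i => //; rewrite fr.
case: eqP => [yu|_] /=.
  case: eqP => [zw|_] /=.
    by move: nt; rewrite inE /= zw eqxx -yu xn.
  by case: eqP => [yw|_] //=; case: eqP => [zu|_] //=; move: nt; rewrite inE /= zu eqxx -yw xn /= orbT.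
by case: eqP => [yw|_] //=; case: eqP => [zu|_] //=; move: nt; rewrite inE /= zu eqxx -yw xn /= orbT.
Qed.

Lemma isolated_untouched E u w x z : (x, z) \notin touched u w ->
  lone_edge ((u, w) |: E) x z = lone_edge E x z.
Proof.
move=> nt; have nt' : (z, x) \notin touched u w.
  move: nt; rewrite [_ \in touched _ _]inE [X in _ -> ~~ X]inE /=; apply: contra.
  by case/or4P => ->; rewrite ?orbT.
rewrite /lone_edge !blocked_untouched //; congr (_ && _); rewrite adjU1.
case: eqP => [xu|_] /=.
  case: eqP => [zw|_] /=; first by move: nt; rewrite inE /= zw eqxx xu setU11.
  by case: eqP => [xw|_] //=; case: eqP => [zu|_] //=; move: nt; rewrite inE /= zu eqxx xw setU11 /= orbT.
by case: eqP => [xw|_] //=; case: eqP => [zu|_] //=; move: nt; rewrite inE /= zu eqxx xw setU11 /= orbT.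
Qed.

(** One edge changes the status of touched pairs only, and there are at most [4 (1 + D K)] of
    these. *)
Lemma isolated_lipschitz (R : realType) (G : {set 'I_n}) E (e : 'I_n * 'I_n) :
  `| #|[set u in pairs G | lone_edge (e |: E) u.1 u.2]|%:R -
     #|[set u in pairs G | lone_edge E u.1 u.2]|%:R | <= (4 * (1 + D * K))%:R :> R.
Proof.
case: e => u w; set S1 := [set _ in _ | _]; set S2 := [set _ in _ | _].
have H (S T : {set 'I_n * 'I_n}) : S :\: touched u w \subset T -> (#|S| <= #|T| + 4 * (1 + D * K))%N.
  move=> ST; rewrite -(cardsID (touched u w) S) [X in (X <= _)%N]addnC; apply: leq_add; first exact: subset_leq_card.
  by apply: leq_trans (card_touched u w); rewrite subset_leq_card // subsetIr.
have H1 : (#|S1| <= #|S2| + 4 * (1 + D * K))%N.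
  apply: H; apply/subsetP => -[x z]; rewrite inE => /andP[nt].
  by rewrite !inE /= isolated_untouched.
have H2 : (#|S2| <= #|S1| + 4 * (1 + D * K))%N.
  apply: H; apply/subsetP => -[x z]; rewrite inE => /andP[nt].
  by rewrite !inE /= isolated_untouched.
rewrite ler_distl lerBlDr -!natrD !ler_nat H1 andbT.
by rewrite addnC in H2 *.
Qed.

End IsolatedEdges.

(** * Harris' inequality for families of forbidden subsets *)

Section HarrisFamilies.
Variables (R : realType) (T : finType) (p : R).
Hypothesis p01 : 0 <= p <= 1.
Implicit Types (C D E : {set T}).

Let p_ge0 : 0 <= p. Proof. by case/andP: p01. Qed.

Lemma mu_superset D C : mu p D (fun E => (C \subset E)%:R) <= p ^+ #|C|.
Proof.
elim/setU1_ind: C D => [|e C eC IH] D.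
  rewrite cards0 expr0 -[leRHS](mu_cst p D); apply: le_mu => // E _; by rewrite lern1 leq_b1.
rewrite cardsU1 eC exprS; have [eD|eD] := boolP (e \in D); last first.
  apply: (@le_trans _ _ 0); last by rewrite mulr_ge0 // exprn_ge0.
  rewrite -(mu_cst p D 0); apply: le_mu => // E ED; rewrite subUset sub1set.
  by rewrite (_ : e \in E = false) //; apply: contraNF eD; exact: (subsetP ED).
have eN : e \notin D :\ e by rewrite !inE eqxx.
rewrite -(setD1K eD) mu_setU1 // (eq_mu p (g := fun=> 0)); last first.
  move=> E ED; rewrite subUset sub1set (_ : e \in E = false) //.
  by apply: contraNF eN; exact: (subsetP ED).
rewrite mu_cst mulr0 add0r ler_wpM2l //; apply: le_trans (IH (D :\ e)).
apply: le_mu => // E ED; rewrite ler_nat subUset sub1set setU11 /=.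
have eE : e \notin E by apply: contra eN; exact: (subsetP ED).
by rewrite -{2}(setU1K eE) subsetD1 eC andbT.
Qed.

Lemma harris_family D (Cs : seq {set T}) :
  \prod_(C <- Cs) (1 - p ^+ #|C|) <= mu p D (fun E => \prod_(C <- Cs) (~~ (C \subset E))%:R).
Proof.
elim: Cs => [|C Cs IH].
  rewrite big_nil -[leLHS](mu_cst p D); apply: le_mu => // E _; by rewrite big_nil.
rewrite big_cons (eq_mu p (g := fun E => (~~ (C \subset E))%:R * \prod_(C <- Cs) (~~ (C \subset E))%:R)); last first.
  by move=> E _; rewrite big_cons.
have dec C' E e : (~~ (C' \subset e |: E))%:R <= (~~ (C' \subset E))%:R :> R.
  rewrite ler_nat; case: (boolP (C' \subset E)) => [H|_]; last exact: leq_b1.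
  by rewrite (subset_trans H (subsetUr _ _)).
apply: le_trans (harris p01 _ _ _); last 2 first.
- by move=> E e; exact: dec.
- by move=> E e; apply: ler_prod => C' _; rewrite ler0n dec.
have p1 k : p ^+ k <= 1 by apply: exprn_ile1 => //; case/andP: p01.
apply: ler_pM => //; first by rewrite subr_ge0.
  by elim/big_rec: _ => // C' x _ x0; rewrite mulr_ge0 // subr_ge0.
rewrite (eq_mu p (g := fun E => 1 + -1 * (C \subset E)%:R)); last first.
  by move=> E _; rewrite mulN1r; case: (C \subset E); rewrite /= ?subrr ?subr0.
by rewrite muD muZ mu_cst mulN1r lerB // mu_superset.
Qed.

(** [1 - y >= exp (- 2 y)] for [0 <= y <= 1 / 2], which holds because [(1 - y) (1 + 2 y) >= 1]. *)
Lemma prod_ge_expR (Cs : seq {set T}) : p <= 1 / 2 -> all (fun C => (0 < #|C|)%N) Cs ->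
  expR (- (2 * \sum_(C <- Cs) p ^+ #|C|)) <= \prod_(C <- Cs) (1 - p ^+ #|C|).
Proof.
move=> p2; elim: Cs => [|C Cs IH] /=; first by rewrite !big_nil mulr0 oppr0 expR0.
move=> /andP[C0 Cs0]; rewrite !big_cons mulrDr opprD expRD; apply: ler_pM; rewrite ?expR_ge0 ?IH //.
set y := p ^+ _; have y0 : 0 <= y by rewrite exprn_ge0.
have y2 : y <= 1 / 2.
  rewrite /y -(prednK C0) exprS; apply: le_trans p2; rewrite ler_piMr //.
  by apply: exprn_ile1 => //; case/andP: p01.
have y12 : 0 < 1 + 2 * y by lra.
rewrite expRN; apply: (@le_trans _ _ (1 + 2 * y)^-1).
  by rewrite lef_pV2 ?posrE ?expR_gt0 //; exact: expR_ge1Dx.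
by rewrite -div1r ler_pdivrMr //; nra.
Qed.

End HarrisFamilies.

Section TilingProbability.
Variables (R : realType) (n t K D : nat) (A : 'I_t -> {set 'I_n}) (M : {set 'I_n}) (p : R).
Hypothesis AM : forall i, small_side M K (A i).
Hypothesis tM : (t <= #|M|)%N.
Hypothesis p02 : 0 < p < 1 / 2.
Implicit Types (E : {set 'I_n * 'I_n}) (x y z u v w : 'I_n) (i j : 'I_t).

Let p01 : 0 <= p <= 1. Proof. by move: p02; lra. Qed.
Let p_ge0 : 0 <= p. Proof. by case/andP: p01. Qed.
Let q_ge0 : 0 <= 1 - p. Proof. by rewrite subr_ge0; case/andP: p01. Qed.
Let A_sub i : A i \subset M. Proof. by case/and3P: (AM i). Qed.
Let A_gt1 i : (1 < #|A i|)%N. Proof. by case/and3P: (AM i). Qed.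

(** For [z] outside [A i], the summand is the probability that [z] is adjacent to all of [A i]
    except possibly [x], that is, that [i] prevents [xz] from being blocked. *)
Definition wt x : R := \sum_(i | x \in A i) p ^+ #|A i|.-1.

Definition good := [set x in M | wt x <= 2].

(** A left side with [a] vertices contributes at most [a p ^ (a - 1) <= 1], since [p < 1 / 2] and
    [a <= 2 ^ (a - 1)]. The average weight is thus at most 1, and by Markov's inequality half of the
    vertices are good. *)
Lemma sum_wt : \sum_(x in M) wt x <= #|M|%:R.
Proof.
rewrite /wt -[leRHS]mulr1.
apply: (@le_trans _ _ (\sum_(i < t) (1 : R))); last first.
  by rewrite sumr_const card_ord mulr_natl ler_nat.
rewrite (exchange_big_dep xpredT) //=; apply: ler_sum => i _.
apply: (@le_trans _ _ (\sum_(x in A i) p ^+ #|A i|.-1)).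
  rewrite big_mkcond [leRHS]big_mkcond; apply: ler_sum => x _.
  have p0 : 0 <= p ^+ #|A i|.-1 by rewrite exprn_ge0 //; lra.
  by case: (x \in M); case: (x \in A i).
rewrite sumr_const -mulr_natl; set a := #|A i|; have a1 : (1 < a)%N := A_gt1 i.
apply: (@le_trans _ _ (2 ^+ a.-1 * (1 / 2) ^+ a.-1)).
  apply: ler_pM => //; first by rewrite exprn_ge0 //; lra.
    by rewrite -natrX ler_nat -{1}(prednK (ltnW a1)) ltn_expl.
  by rewrite lerXn2r ?nnegrE //; move: p02; lra.
by rewrite -exprMn (_ : 2 * (1 / 2) = 1 :> R) ?expr1n //; field.
Qed.

Lemma card_good : (#|M| <= 2 * #|good|)%N.
Proof.
have gM : good \subset M by apply/subsetP => x; rewrite inE => /andP[].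
have H : 2 * #|M :\: good|%:R <= #|M|%:R :> R.
  apply: le_trans sum_wt; rewrite (big_setID good) /= mulr_natr -sumr_const.
  have wt0 x : 0 <= wt x by apply: sumr_ge0 => i _; rewrite exprn_ge0 //; lra.
  rewrite addrC; apply: ler_wpDr; first by apply: sumr_ge0.
  by apply: ler_sum => x; rewrite !inE => /andP[H xM]; move: H; rewrite xM /= -ltNge => /ltW.
rewrite -natrM ler_nat in H; have := cardsID good M; rewrite (setIidPr gM); lia.
Qed.

Definition pr y z := if (y < z)%N then (y, z) else (z, y).

(** The edges whose simultaneous presence keeps [i] from blocking [xz]. *)
Definition blockset i x z := [set pr y z | y in A i :\ x].

Lemma card_blockset i x z : x \in A i -> z \notin A i -> #|blockset i x z| = #|A i|.-1.
Proof.
move=> xA zA; have inj : {in A i :\ x &, injective (fun y => pr y z)}.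
  move=> y y'; rewrite !inE => /andP[_ yA] /andP[_ yA']; rewrite /pr.
  have yz : y != z by apply: contraNneq zA => <-.
  have yz' : y' != z by apply: contraNneq zA => <-.
  case: ifP => _; case: ifP => _ [] // e1 e2.
    by rewrite e1 eqxx in yz.
  by rewrite e2 eqxx in yz.
by rewrite /blockset (card_in_imset inj) [in RHS](cardsD1 x) xA.
Qed.

Lemma adj_pr E y z : E \subset upper_pairs n -> y != z -> adj E y z = (pr y z \in E).
Proof.
move=> EU yz; rewrite /pr; case: ltngtP => [yz'|zy|/val_inj e]; first exact: adjE.
  by rewrite adjC adjE.
by rewrite e eqxx in yz.
Qed.

Definition blocksets x z :=
  [seq blockset i x z | i <- index_enum 'I_t & [&& hubfree D A i, x \in A i & z \notin A i]].

Lemma blocked_of_blocksets E x z : E \subset upper_pairs n ->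
  all (fun C : {set 'I_n * 'I_n} => ~~ (C \subset E)) (blocksets x z) -> blocked D A E x z.
Proof.
move=> EU /allP H; apply/forallP => i; apply/implyP => /[dup] Hi /and3P[fr xA zA].
have : blockset i x z \in blocksets x z.
  by apply/mapP; exists i => //; rewrite mem_filter Hi mem_index_enum.
move=> /H; case/subsetPn => _ /imsetP[y yA ->] nE; apply/existsP; exists y; rewrite yA /=.
rewrite adj_pr //; apply: contraNneq zA => <-; by move: yA; rewrite inE => /andP[].
Qed.

Lemma blocksets_weight x z :
  \sum_(C <- blocksets x z) p ^+ #|C| <= wt x.
Proof.
rewrite big_map big_filter /wt big_mkcond [leRHS]big_mkcond; apply: ler_sum => i _.
have p0 : 0 <= p ^+ #|A i|.-1 by rewrite exprn_ge0 //; lra.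
case: ifP => [/and3P[_ xA zA]|_]; first by rewrite xA card_blockset.
by case: ifP.
Qed.

Lemma blocksets_gt0 x z : all (fun C : {set 'I_n * 'I_n} => (0 < #|C|)%N) (blocksets x z).
Proof.
apply/allP => C /mapP[i]; rewrite mem_filter => /andP[/and3P[_ xA zA] _] ->.
by rewrite card_blockset // -ltnS prednK // ltnW.
Qed.

(** The conditions that no blocking set is contained in [E] are decreasing, so Harris' inequality
    gives at least [exp (- 2 (wt x + wt z)) >= exp (- 8)]. None of these sets contains [(x, z)],
    whence the separate factor [p]. *)
Lemma isolated_prob x z : x \in good -> z \in good -> (x < z)%N ->
  p * expR (- 8) <= mu p (pairs M) (fun E => (lone_edge D A E x z)%:R).
Proof.
rewrite !inE => /andP[xM wx] /andP[zM wz] xz.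
have xz' : x != z by apply: contraTneq xz => ->; rewrite ltnn.
pose Cs := blocksets x z ++ blocksets z x.
have notin C : C \in Cs -> (x, z) \notin C.
  rewrite mem_cat => /orP[] /mapP[i]; rewrite mem_filter => /andP[/and3P[_ xA zA] _] ->.
    apply/imsetP => -[y]; rewrite !inE /pr => /andP[yx yA].
    case: ifP => _ []; first by move=> e1; move: yx; rewrite e1 eqxx.
    by move=> e1 _; case/eqP: xz'.
  apply/imsetP => -[y]; rewrite !inE /pr => /andP[yx yA].
  case: ifP => _ []; first by move=> _ e2; case/eqP: xz'; rewrite e2.
  by move=> e2; move: yx; rewrite e2 eqxx.
apply: (@le_trans _ _ (mu p (pairs M) (fun E => ((x, z) \in E)%:R * \prod_(C <- Cs) (~~ (C \subset E))%:R))); last first.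
  apply: le_mu => // E EM; have EU := pairsP EM.
  case: (boolP ((x, z) \in E)) => [xzE|_]; last by rewrite mul0r.
  rewrite mul1r; have [allC|/allPn[C CC nC]] := boolP (all (fun C : {set 'I_n * 'I_n} => ~~ (C \subset E)) Cs); last first.
    by rewrite (perm_big _ (perm_to_rem CC)) big_cons (negPf nC) /= mul0r.
  move: (allC); rewrite all_cat => /andP[a1 a2].
  rewrite /lone_edge adjE // xzE !blocked_of_blocksets // big1_seq // => C /andP[_ CC].
  by rewrite (allP allC C CC).
have xzM : (x, z) \in pairs M by rewrite !inE /= xz xM zM.
have eN : (x, z) \notin pairs M :\ (x, z) by rewrite !inE eqxx.
have prod0 (F : {set 'I_n * 'I_n} -> bool) : 0 <= \prod_(C <- Cs) (F C)%:R :> R by apply: prodr_ge0.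
rewrite -(setD1K xzM) mu_setU1 //; apply: ler_wpDl.
  by rewrite mulr_ge0 //; apply: mu_ge0 => // E _; rewrite mulr_ge0.
rewrite ler_wpM2l //; apply: (@le_trans _ _ (\prod_(C <- Cs) (1 - p ^+ #|C|))).
  apply: le_trans (prod_ge_expR p01 _ _); last 2 first.
  - by move: p02; lra.
  - by rewrite all_cat !blocksets_gt0.
  rewrite ler_expR lerN2 big_cat /=.
  have := blocksets_weight x z; have := blocksets_weight z x; lra.
apply: le_trans (harris_family p01 (pairs M :\ (x, z)) Cs) _.
apply: le_mu => // E _; rewrite setU11 mul1r big_seq [leRHS]big_seq.
apply: eq_ler; apply: eq_bigr => C CC; congr ((~~ _)%:R).
rewrite -subDset (_ : C :\ (x, z) = C) //; apply/setDidPl.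
by rewrite disjoint_sym disjoints1 notin.
Qed.

Lemma expected_isolated : (4 <= #|M|)%N ->
  p * expR (- 8) * (#|M|%:R ^+ 2 / 16) <=
  mu p (pairs M) (fun E => #|[set u in pairs good | lone_edge D A E u.1 u.2]|%:R).
Proof.
move=> m4.
rewrite (eq_mu p (g := fun E => \sum_(u in pairs good) (lone_edge D A E u.1 u.2)%:R)); last first.
  move=> E _; rewrite -sum1_card natr_sum big_mkcond [RHS]big_mkcond /=; apply: eq_bigr => u _.
  by rewrite inE; case: (u \in pairs good); case: lone_edge.
rewrite mu_sum; apply: (@le_trans _ _ (\sum_(u in pairs good) p * expR (- 8))); last first.
  apply: ler_sum => -[x z] /=; rewrite !inE /= => /and3P[xz xg zg]; apply: isolated_prob => //.
    by rewrite inE.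
  by rewrite inE.
rewrite sumr_const -[leRHS]mulr_natr ler_wpM2l ?mulr_ge0 ?expR_ge0 //.
rewrite card_pairs bin2_natr.
have := card_good; rewrite -(ler_nat R) natrM; set g : R := #|good|%:R.
have : 4 <= (#|M|%:R : R) by rewrite ler_nat.
set m : R := #|M|%:R; nra.
Qed.

(* In a tiled graph every lone edge lies in a biclique whose left side meets a hub, so there are few
   of them, whereas a random graph has many. *)
Lemma tiling_prob : (4 <= #|M|)%N -> 64 * K%:R ^+ 2 <= p * expR (- 8) * D%:R -> (0 < D)%N ->
  mu p (pairs M) (fun E => `[< exists B : 'I_t -> {set 'I_n}, forall x y, x \in M -> y \in M ->
    (\sum_i (in_biclique (A i, B i) x y : nat))%N = adj E x y >]%:R) <=
  expR (- ((p * expR (- 8)) ^+ 2 / (256 ^+ 2 * (1 + D * K)%:R ^+ 2) * #|M|%:R ^+ 2)).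
Proof.
move=> m4 HD D0; set q := p * expR (- 8) in HD *.
have q0 : 0 < q by rewrite mulr_gt0 ?expR_gt0 //; move: p02; lra.
have q1 : q <= 1.
  have : expR (- 8) <= 1 :> R by rewrite expR_le1; lra.
  have := expR_ge0 (- 8 : R); rewrite /q; move: p02; nra.
set m : R := #|M|%:R; have m4' : 4 <= m by rewrite ler_nat.
set dk : R := (1 + D * K)%:R.
have dk1 : 1 <= dk by rewrite ler1n.
pose N E : R := #|[set u in pairs good | lone_edge D A E u.1 u.2]|%:R.
have EN := expected_isolated m4; rewrite -/q -/m -/(N _) in EN.
have goodM : good \subset M by apply/subsetP => x; rewrite inE => /andP[].
have cP : (#|pairs M|%:R : R) = m * (m - 1) / 2 by rewrite card_pairs bin2_natr.
have cP0 : (0 < #|pairs M|)%N by rewrite -(ltr0n R) cP; nra.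
have lip E e : e \in pairs M -> `|N (e |: E) - N E| <= 4 * dk.
  by move=> _; have := @isolated_lipschitz n t K D A M AM R good E e; rewrite natrM.
have c0 : 0 < 4 * dk by lra.
have t0 : 0 <= q * m ^+ 2 / 32 by rewrite !mulr_ge0 ?exprn_ge0 // ltW.
have tN : q * m ^+ 2 / 32 <= #|pairs M|%:R * (4 * dk).
  have m20 : 0 <= m ^+ 2 by rewrite sqr_ge0.
  have h1 : m * (m - 1) / 2 * 4 <= m * (m - 1) / 2 * (4 * dk) by rewrite ler_wpM2l; [|nra|lra].
  have h2 : q * m ^+ 2 <= m ^+ 2 by rewrite ler_piMl.
  rewrite cP; apply: le_trans h1; nra.
have := mu_lower_tail p01 c0 t0 tN cP0 lip => H.
(* [q m ^ 2 / 32] is half of the lower bound on the expectation. A tiled graph has at most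
   [2 m ^ 2 K ^ 2 / D] lone edges, and [HD] makes this at most [q m ^ 2 / 32]. *)
apply: (@le_trans _ _ (mu p (pairs M) (fun E => (N E <= mu p (pairs M) N - q * m ^+ 2 / 32)%R%:R))).
  apply: le_mu => // E EM; rewrite ler_nat; case: (boolP `[< _ >]) => //= /asboolP[B dec].
  rewrite lt0b; apply: (@le_trans _ _ (q * m ^+ 2 / 32)); last by rewrite /m in EN *; lra.
  have F := few_isolated D AM (pairsP EM) goodM dec.
  apply: le_trans (_ : (2 * (#|M| * (K * #|hub D A|)))%:R <= _); first by rewrite ler_nat; exact: F.
  have Hh := card_hub D AM tM; rewrite -(ler_nat R) !natrM in Hh.
  have D0' : (0 : R) < D%:R by rewrite ltr0n.
  rewrite !natrM -/m in Hh *; set h : R := #|hub D A|%:R in Hh *.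
  rewrite -(ler_pM2r D0').
  have K0 : (0 : R) <= K%:R by [].
  have m0 : 0 <= m by lra.
  have X1 : 2 * (m * (K%:R * h)) * D%:R <= 2 * m * K%:R * (m * K%:R).
    rewrite (_ : _ * D%:R = 2 * m * K%:R * (h * D%:R)); last by ring.
    by rewrite ler_wpM2l // !mulr_ge0.
  apply: le_trans X1 _.
  have := ler_wpM2r (sqr_ge0 m) HD; lra.
apply: le_trans H _; rewrite ler_expR lerN2 cP -/dk.
have dk0 : 0 < dk by lra.
have mm : 0 < m * (m - 1) by nra.
rewrite ler_pdivlMr; last by rewrite !mulr_gt0 ?exprn_gt0 //; lra.
have -> : q ^+ 2 / (256 ^+ 2 * dk ^+ 2) * m ^+ 2 * (8 * (m * (m - 1) / 2) * (4 * dk) ^+ 2) =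
  q ^+ 2 * m ^+ 2 * (m * (m - 1)) / 32 ^+ 2 by field; rewrite gt_eqF.
have -> : (q * m ^+ 2 / 32) ^+ 2 = q ^+ 2 * m ^+ 2 * (m * m) / 32 ^+ 2 by field.
rewrite ler_wpM2r ?invr_ge0 ?sqr_ge0 // ler_wpM2l ?mulr_ge0 ?sqr_ge0 //.
by rewrite ler_wpM2l; lra.
Qed.

End TilingProbability.

Section TiledProbability.
Variable R : realType.

Lemma tiled0_prob (p : R) (n K D : nat) (M : {set 'I_n}) (As : seq {set 'I_n}) : 0 < p < 1 / 2 ->
  all (small_side M K) As -> (size As <= #|M|)%N -> (4 <= #|M|)%N ->
  64 * K%:R ^+ 2 <= p * expR (- 8) * D%:R -> (0 < D)%N ->
  mu p (pairs M) (fun E => `[< tiled M As 0 E >]%:R) <=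
  expR (- ((p * expR (- 8)) ^+ 2 / (256 ^+ 2 * (1 + D * K)%:R ^+ 2) * #|M|%:R ^+ 2)).
Proof.
move=> p02 sAs szAs m4 HD D0.
pose A (i : 'I_(size As)) := nth set0 As i.
have AM i : small_side M K (A i) by apply: (allP sAs); exact: mem_nth.
apply: le_trans (tiling_prob AM szAs p02 m4 HD D0).
have p01 : 0 <= p <= 1 by lra.
apply: le_mu => // E EM; rewrite ler_nat; case: (boolP `[< tiled _ _ _ _ >]) => //= /asboolP.
move=> [Bs [s [szB /size0nil -> _ dec]]]; rewrite lt0b; apply/asboolP.
exists (fun i => nth set0 Bs i) => x y xM yM; rewrite -(dec x y xM yM) cats0.
have szz : size (zip As Bs) == size As by rewrite size_zip szB minnn.
rewrite -(sum_tnth_count (Tuple szz) (fun AB => in_biclique AB x y)); apply: eq_bigr => i _.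
by rewrite (tnth_nth (set0, set0)) /= nth_zip.
Qed.

End TiledProbability.

(** * The lower bound *)

Section PartTwo.
Variable R : realType.

Lemma card_small_side n (M : {set 'I_n}) K : (0 < #|M|)%N ->
  #|[set B | small_side M K B]|%:R <= 2 * #|M|%:R ^+ K.+1 :> R.
Proof.
move=> M0; set m := #|M| in M0 *.
apply: (@le_trans _ _ (\sum_(B : {set 'I_n} | B \subset M) (if (#|B| < K)%N then 1 else 0 : R))).
  rewrite -sum1_card natr_sum big_mkcond [leRHS]big_mkcond; apply: ler_sum => B _.
  rewrite inE /small_side; case: (B \subset M) => //=; case: ltnP => //= _; case: ifP => //.
rewrite (@sum_subset_card R _ M (fun b => if (b < K)%N then 1 else 0)) -/m.
apply: (@le_trans _ _ (\sum_(b < m.+1) m%:R ^+ K)).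
  apply: ler_sum => b _; case: ifP => bK; last by rewrite mulr0 exprn_ge0.
  rewrite mulr1; apply: (@le_trans _ _ (m%:R ^+ b)); first by rewrite -natrX ler_nat bin_le_expn.
  by rewrite ler_weXn2l ?ler1n // ltnW.
rewrite sumr_const card_ord -[leLHS]mulr_natl.
have -> : 2 * m%:R ^+ K.+1 = (2 * m%:R) * m%:R ^+ K :> R by rewrite exprS mulrA.
rewrite ler_wpM2r ?exprn_ge0 //.
by rewrite -natrM ler_nat mul2n -addnn -addn1 leq_add2l.
Qed.

(* The cost of large bicliques is [exp (3 rho^K m^2)] whereas the gain of [tiled0_prob] is
   [exp (- eps m^2)] with [eps] only polynomially small in [K]. *)
Lemma properly_decomposed_large (p : R) : 0 < p < 1 / 2 ->
  exists eps m1 : R, 0 < eps /\ forall n (M : {set 'I_n}) f, m1 <= #|M|%:R -> (f <= #|M|)%N ->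
    mu p (upper_pairs n) (fun E => `[< properly_decomposed E M f >]%:R) <=
    expR (- (eps * #|M|%:R ^+ 2)).
Proof.
move=> p02; have [p0 p2] := andP p02; have p01 : 0 < p < 1 by lra.
set r := p / (1 - p); have r0 : 0 < r by rewrite divr_gt0 //; lra.
have r1 : r < 1 by rewrite /r ltr_pdivrMr; lra.
set q := p * expR (- 8); have q0 : 0 < q by rewrite mulr_gt0 ?expR_gt0.
have q1 : q <= 1.
  have : expR (- 8) <= 1 :> R by rewrite expR_le1; lra.
  have := expR_ge0 (- 8 : R); rewrite /q; nra.
pose l := - ln r; have l0 : 0 < l by rewrite oppr_gt0 ln_lt0 // r0.
have rE : r = expR (- l) by rewrite opprK lnK.
(* From [1 + D K <= 66 K ^ 3 / q] one gets [e0 >= q ^ 4 / (C0 K ^ 6)], and [K] is chosen to make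
   this at least [6 r ^ K]. The weights cost [3 r ^ K m ^ 2], so half of [e0] survives. *)
pose C0 : R := (256 * 66) ^+ 2.
have C00 : 0 < C0 by apply: exprn_gt0; apply: mulr_gt0; rewrite ltr0n.
have [x0 x00 Hx0] := poly_le_expR (6 * C0 / q ^+ 4) 6 l0.
pose K := (Num.truncn x0).+2.
have K2 : (1 < K)%N by [].
have Kx : x0 <= K%:R.
  by apply: ltW; apply: lt_le_trans (truncnS_gt _) _; rewrite ler_nat.
have K1 : (1 : R) <= K%:R by rewrite ler1n.
pose D := (Num.truncn (64 * K%:R ^+ 2 / q)).+1.
have HD : 64 * K%:R ^+ 2 <= q * D%:R.
  by rewrite -ler_pdivrMl // mulrC; apply: ltW; exact: truncnS_gt.
have HD2 : D%:R <= 64 * K%:R ^+ 2 / q + 1.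
  by rewrite /D -natr1 lerD2r truncn_le divr_ge0 ?mulr_ge0 ?exprn_ge0 // ltW.
pose e0 := q ^+ 2 / (256 ^+ 2 * (1 + D * K)%:R ^+ 2).
have rK0 : 0 < r ^+ K by rewrite exprn_gt0.
have k3 : 1 <= K%:R ^+ 3 / q.
  by rewrite ler_pdivlMr // mul1r; apply: le_trans q1 _; apply: exprn_ege1.
have dk : (1 + D * K)%:R <= 66 * K%:R ^+ 3 / q :> R.
  rewrite natrD natrM; apply: (@le_trans _ _ (1 + (64 * K%:R ^+ 2 / q + 1) * K%:R)).
    by rewrite lerD2l ler_wpM2r.
  have -> : 1 + (64 * K%:R ^+ 2 / q + 1) * K%:R = 64 * (K%:R ^+ 3 / q) + 1 + K%:R.
    by field; rewrite gt_eqF.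
  have -> : 66 * K%:R ^+ 3 / q = 64 * (K%:R ^+ 3 / q) + K%:R ^+ 3 / q + K%:R ^+ 3 / q.
    by field; rewrite gt_eqF.
  have k4 : K%:R <= K%:R ^+ 3 / q.
    rewrite ler_pdivlMr //; apply: (@le_trans _ _ K%:R); first by rewrite ler_piMr.
    by apply: ler_eXnr.
  by rewrite -addrA -[leRHS]addrA lerD2l lerD.
have e0K : 6 * r ^+ K <= e0.
  have e1 : q ^+ 4 / (C0 * K%:R ^+ 6) <= e0.
    have -> : q ^+ 4 / (C0 * K%:R ^+ 6) = q ^+ 2 / (256 ^+ 2 * (66 * K%:R ^+ 3 / q) ^+ 2).
      by rewrite /C0; field; rewrite !gt_eqF // ltr0n.
    rewrite ler_wpM2l ?sqr_ge0 // lef_pV2 ?posrE ?mulr_gt0 ?exprn_gt0 ?invr_gt0 ?ltr0n //.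
    rewrite ler_wpM2l ?sqr_ge0 // lerXn2r ?nnegrE ?mulr_ge0 ?exprn_ge0 ?invr_ge0 // ltW //.
  apply: le_trans e1; have := Hx0 _ Kx; rewrite ler_pdivlMr ?mulr_gt0 ?exprn_gt0 ?ltr0n // => H.
  have rKE : r ^+ K = (expR (l * K%:R))^-1 by rewrite -expRN rE -expRM_natl; congr expR; ring.
  rewrite rKE mulrAC ler_pdivrMr ?expR_gt0 //.
  move: H; rewrite mulrAC ler_pdivrMr ?exprn_gt0 // => H.
  by rewrite mulrA [leRHS]mulrC.
have r01 : 0 < r < 1 by rewrite r0.
have [Y0 Y01 HY] := weight_large_le r01 rK0.
have [x1 x10 Hx1] := poly_le_expR (2 : R) K.+1 rK0.
exists (e0 / 2), (4 + x1 + Y0 / r); split.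
  by rewrite divr_gt0 //; apply: lt_le_trans e0K; rewrite mulr_gt0.
move=> n M f mM fM; set m : R := #|M|%:R in mM *.
have Yr : 0 <= Y0 / r by rewrite divr_ge0 ?(ltW r0) //; exact: (le_trans ler01 Y01).
have m4 : 4 <= m by lra.
have m4' : (4 <= #|M|)%N by rewrite -(ler_nat R).
have M0 : (0 < #|M|)%N by apply: leq_trans m4'.
have W3 : weight p M K <= expR (3 * (r ^+ K * m)).
  have S1 : 2 * m ^+ K.+1 <= expR (r ^+ K * m) by apply: Hx1; lra.
  have S2 : 2 <= expR (r ^+ K * m).
    by apply: le_trans S1; rewrite ler_peMr //; apply: exprn_ege1; lra.
  have S3 : \sum_(AB | large_biclique M K AB) r ^+ (#|AB.1| * #|AB.2|) <= expR (2 * (r ^+ K * m)).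
    apply: le_trans (HY p n M K p01 (lexx _) K2 _) _; rewrite -/m -/r.
      by rewrite -ler_pdivrMr //; lra.
    have -> : 2 * (r ^+ K * m) = r ^+ K * m + m * r ^+ K by ring.
    rewrite expRD; apply: ler_pM; rewrite ?expR_ge0 ?exprn_ge0 ?addr_ge0 ?(ltW rK0) //.
      rewrite ler_expR ler_wpM2l ?(ltW rK0) // ler_piMr //; lra.
    rewrite expRM_natl lerXn2r ?nnegrE ?expR_ge0 ?addr_ge0 ?(ltW rK0) //.
    exact: expR_ge1Dx.
  rewrite /weight -/r; apply: le_trans (lerD (card_small_side K M0) S3) _; rewrite -/m.
  have -> : 3 * (r ^+ K * m) = r ^+ K * m + r ^+ K * m + r ^+ K * m by ring.
  have -> : 2 * (r ^+ K * m) = r ^+ K * m + r ^+ K * m by ring.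
  rewrite !expRD; set e := expR (r ^+ K * m) in S1 S2 *; nra.
have W0 : 0 <= weight p M K.
  by rewrite addr_ge0 // sumr_ge0 // => AB _; rewrite exprn_ge0 // ltW.
apply: le_trans (properly_decomposed_prob p01 (K := K) (t := expR (- (e0 * m ^+ 2))) _) _.
  move=> Bs sBs szBs; apply: tiled0_prob => //; exact: leq_trans szBs fM.
apply: (@le_trans _ _ (expR (- (e0 * m ^+ 2)) * expR (3 * (r ^+ K * m)) ^+ f)).
  by rewrite ler_wpM2l ?expR_ge0 // lerXn2r ?nnegrE ?expR_ge0.
rewrite -expRM_natl -expRD ler_expR.
have fm : f%:R * (3 * (r ^+ K * m)) <= m * (3 * (r ^+ K * m)).
  by rewrite ler_wpM2r ?ler_nat ?(mulr_ge0 (ler0n _ _)) ?(mulr_ge0 (ltW rK0)) // /m ler_nat.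
have := ler_wpM2r (sqr_ge0 m) e0K; lra.
Qed.

(** With [alpha >= k >= ln n], a violation gives a set [M] with more than [C ln n] vertices. For
    these [eps #|M| ^ 2 >= 4 ln n #|M|], which beats the [n ^ #|M|] choices of [M] as well as the
    choices of its size and of [f]. *)
Lemma bp_lower (p : R) : 0 < p < 1 / 2 -> exists C : R, 0 < C /\
  whp (fun n => Gnp_prob n p (fun E => n%:R - C * (alpha E)%:R <= (bp E)%:R)).
Proof.
move=> p02; have [p0 p2] := andP p02.
have p01 : 0 <= p <= 1 by lra.
have [eps [m1 [eps0 Hm]]] := properly_decomposed_large p02.
(* The first term yields the exponent [4 L #|M|]; the summand 1 makes [#|M|] exceed [m1] for large
   [n]. *)
pose C := 4 / eps + 1; have C0 : 0 < C by rewrite addr_gt0 // divr_gt0.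
exists C; split => //; apply: whp_compl => e e0.
have e2 : 0 < e / 2 by lra.
have d3 : (0 : R) < 1 / 3 <= (1 / 3 : R) by rewrite lexx andbT divr_gt0.
have [L1 HL1] := alpha_lower (leqnn 6) d3 e2.
have [x1 x10 H1] := poly_le_expR (8 / e) 0 (@ltr01 R).
have [n1 Hn1] := @ltn_ln_eventually R (1 + `|L1| + `|m1| + x1 + - ln p * 6 + `|ln p|).
exists (maxn 1 n1) => n; rewrite geq_max => /andP[n0 nn1]; split=> //.
set L : R := ln n%:R; have LL : 1 + `|L1| + `|m1| + x1 + - ln p * 6 + `|ln p| <= L := Hn1 n nn1.
have [A1 A2] : L1 <= `|L1| /\ m1 <= `|m1| by split; exact: ler_norm.
have [B1 B2] : 0 <= `|L1| /\ 0 <= `|m1| by [].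
have lp : ln p <= 0 by apply: ln_le0; lra.
have nlp := normr_ge0 (ln p).
have nE : n%:R = expR L by rewrite lnK // posrE ltr0n.
have L1L : L1 <= L by lra.
have pN : expR (- ((1 / 3 - 1 / 6) * L)) <= p.
  by rewrite -[leRHS]lnK ?posrE // ler_expR; lra.
have [k [k0n ak _ Lck _]] := HL1 n p L1L p02 pN.
rewrite -/L in Lck.
have kL : L <= k%:R.
  have [c1 c2 c3] := cp_bounds p02; apply: le_trans Lck _; rewrite ler_piMl //.
have ee : e = e / 2 + e / 2 by lra.
rewrite [leRHS]ee.
apply: (mu_orb (P1 := fun E => (alpha E < k)%N)
  (P2 := fun E => `[< exists M f, [/\ properly_decomposed E M f, (f <= #|M|)%N & C * L <= #|M|%:R] >])) => //.
  move=> E EU; rewrite -ltNge => bpC; case: ltnP => //= ka; apply/asboolP.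
  have [M [f [pd le]]] := bp_reduce EU; exists M, f.
  have H : (bp E)%:R < n%:R - C * L :> R.
    apply: lt_le_trans bpC _; rewrite lerB // (ler_wpM2l (ltW C0)) //.
    by apply: le_trans kL _; rewrite ler_nat.
  rewrite -(ler_nat R) !natrD in le.
  have CL : 0 <= C * L by rewrite mulr_ge0 ?(ltW C0) //; lra.
  have f0 : (0 : R) <= f%:R by [].
  by split=> //; [rewrite -(ler_nat R); lra | lra].
apply: (@le_trans _ _ (\sum_(M : {set 'I_n} | M \subset setT)
    (if C * L <= #|M|%:R then n.+1%:R * expR (- (4 * L * #|M|%:R)) else 0))).
  apply: (@le_trans _ _ (mu p (upper_pairs n) (fun E => \sum_(M : {set 'I_n} | M \subset setT)
     \sum_(f < n.+1 | (f <= #|M|)%N && (C * L <= #|M|%:R)) `[< properly_decomposed E M f >]%:R))).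
    apply: le_mu => // E _; case: (boolP `[< _ >]) => [/asboolP[M [f [pd fM CM]]]|_]; last first.
      by rewrite sumr_ge0 // => M _; rewrite sumr_ge0.
    have fn : (f < n.+1)%N.
      by rewrite ltnS; apply: leq_trans fM _; rewrite -[X in (_ <= X)%N]card_ord max_card.
    rewrite (bigD1 M) ?subsetT //= (bigD1 (Ordinal fn)) ?fM ?CM //= (asboolT pd) -addrA lerDl addr_ge0 // sumr_ge0 // => M' _.
    by rewrite sumr_ge0.
  rewrite mu_sum; apply: ler_sum => M _; rewrite mu_sum; case: ifP => CM; last first.
    by rewrite big_pred0 // => f; rewrite andbF.
  apply: (@le_trans _ _ (\sum_(f < n.+1) expR (- (4 * L * #|M|%:R)))); last first.
    by rewrite sumr_const card_ord -[leLHS]mulr_natl.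
  rewrite big_mkcond; apply: ler_sum => f _; case: ifP => [/andP[fM _]|_]; last exact: expR_ge0.
  have eL : 4 / eps * L <= #|M|%:R by apply: le_trans CM; rewrite ler_wpM2r //; rewrite /C; lra.
  have mM : m1 <= #|M|%:R.
    apply: le_trans CM; have : 0 <= 4 / eps * L by rewrite mulr_ge0 ?divr_ge0 ?(ltW eps0) //; lra.
    rewrite /C mulrDl mul1r; lra.
  apply: le_trans (Hm n M f mM fM) _; rewrite ler_expR lerN2 expr2 mulrA ler_wpM2r //.
  have -> : 4 * L = eps * (4 / eps * L) by field; rewrite gt_eqF.
  by rewrite ler_wpM2l // ltW.
rewrite (sum_subset_card [set: 'I_n] (fun m => if C * L <= m%:R then n.+1%:R * expR (- (4 * L * m%:R)) else 0)) cardsT card_ord.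
apply: (@le_trans _ _ (\sum_(m < n.+1) n.+1%:R * expR (- (3 * L)))).
  apply: ler_sum => m _; case: ifP => Cm; last by rewrite mulr0 mulr_ge0 ?expR_ge0.
  have m1' : 1 <= (m%:R : R).
    rewrite ler1n lt0n; apply/negP => /eqP m0; move: Cm; rewrite m0 leNgt mulr_gt0 //; lra.
  rewrite mulrCA ler_wpM2l //; apply: (@le_trans _ _ (expR L ^+ m * expR (- (4 * L * m%:R)))).
    by rewrite ler_wpM2r ?expR_ge0 // -nE -natrX ler_nat bin_le_expn.
  rewrite -expRM_natl -expRD ler_expR; have : 0 <= L by lra.
  nra.
rewrite sumr_const card_ord -[leLHS]mulr_natl mulrA.
have n2 : n.+1%:R <= 2 * expR L :> R.
  by rewrite -nE -natrM ler_nat mul2n -addnn -addn1 leq_add2l.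
apply: (@le_trans _ _ (2 * expR L * (2 * expR L) * expR (- (3 * L)))).
  by rewrite ler_wpM2r ?expR_ge0 // ler_pM.
have -> : 2 * expR L * (2 * expR L) * expR (- (3 * L)) = 4 / expR L.
  have -> : 2 * expR L * (2 * expR L) * expR (- (3 * L)) = 4 * (expR L * expR L * expR (- (3 * L))) by ring.
  by rewrite -!expRD -expRN; congr (_ * expR _); ring.
rewrite ler_pdivrMr ?expR_gt0 //.
have := H1 L; rewrite expr0 mulr1 mul1r => H.
have {}H : 8 / e <= expR L by apply: H; lra.
by move: H; rewrite ler_pdivrMr // => H; lra.
Qed.

End PartTwo.

(** * Planting twins *)

Section Constraints.
Variables (R : realType) (T : finType) (p : R).
Hypothesis p02 : 0 < p < 1 / 2.
Implicit Types (D E : {set T}) (e : T).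

Let p01 : 0 <= p <= 1. Proof. by move: p02; lra. Qed.
Let p_ge0 : 0 <= p. Proof. by case/andP: p01. Qed.
Let q_ge0 : 0 <= 1 - p. Proof. by rewrite subr_ge0; case/andP: p01. Qed.

(* [inl e] requires [e] to be absent, [inr (e, e')] requires [e] and [e'] to be both present or both absent. *)
Definition cstr := (T + T * T)%type.

Definition holds E (c : cstr) : bool :=
  match c with inl e => e \notin E | inr (e1, e2) => (e1 \in E) == (e2 \in E) end.

Definition coords (c : cstr) : {set T} :=
  match c with inl e => [set e] | inr (e1, e2) => [set e1; e2] end.

Definition proper_cstr (c : cstr) := match c with inl _ => true | inr (e1, e2) => e1 != e2 end.

(** Bounds the probability of the constraint whatever has been revealed outside [D]. If one pair of
    a twin constraint is still random, it must match the other, with probability [p] or [1 - p],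
    hence at most [1 - p] as [p < 1 / 2]. *)
Definition cost D (c : cstr) : R :=
  match c with
  | inl e => if e \in D then 1 - p else 1
  | inr (e1, e2) => if e1 \in D then (if e2 \in D then p ^+ 2 + (1 - p) ^+ 2 else 1 - p)
                    else (if e2 \in D then 1 - p else 1)
  end.

(** [E1] consists of the edges already revealed as present, [D] is still random, and all other pairs
    are absent. *)
Definition PP D E1 (cs : seq cstr) : R := mu p D (fun E => (all (holds (E :|: E1)) cs)%:R).

Lemma PP_peel e D E1 cs : e \in D ->
  PP D E1 cs = (1 - p) * PP (D :\ e) E1 cs + p * PP (D :\ e) (e |: E1) cs.
Proof.
move=> eD; rewrite /PP -{1}(setD1K eD) mu_setU1 ?inE ?eqxx //.
by congr (_ + _ * _); apply: eq_mu => E _; rewrite setUCA setUA.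
Qed.

Lemma PP_ge0 D E1 cs : 0 <= PP D E1 cs.
Proof. by apply: mu_ge0. Qed.

Lemma PP_drop D E1 c cs : [disjoint coords c & D] ->
  PP D E1 (c :: cs) = (holds E1 c)%:R * PP D E1 cs.
Proof.
move=> dis; rewrite /PP -muZ; apply: eq_mu => E ED /=; rewrite -natrM mulnb; congr ((nat_of_bool (_ && _))%:R).
have nE x : x \in coords c -> x \in E :|: E1 = (x \in E1).
  move=> xc; rewrite inE; case: (boolP (x \in E)) => // /(subsetP ED) xD.
  by move: dis; rewrite -setI_eq0 => /eqP/setP/(_ x); rewrite !inE xc xD.
by case: c {dis} nE => [e|[e1 e2]] nE; rewrite /holds !nE // !inE eqxx ?orbT.
Qed.

Lemma cost_ge0 D c : 0 <= cost D c.
Proof.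
case: c => [e|[e1 e2]] /=; do 2?case: ifP => _ //.
by rewrite addr_ge0 // exprn_ge0.
Qed.

Lemma cost_D1 D e c : e \notin coords c -> cost (D :\ e) c = cost D c.
Proof.
case: c => [x|[x1 x2]] /=; rewrite !inE ?negb_or ?[e == _]eq_sym; first by move=> ->.
by move=> /andP[-> ->].
Qed.

Lemma prod_cost_D1 D e (cs : seq cstr) : all (fun c => e \notin coords c) cs ->
  \prod_(c <- cs) cost (D :\ e) c = \prod_(c <- cs) cost D c.
Proof.
move=> /allP H; rewrite big_seq [RHS]big_seq; apply: eq_bigr => c cc; apply: cost_D1; exact: H.
Qed.

(* The proof reveals the coordinates of the constraints one after the other. *)
Lemma PP_cost (cs : seq cstr) D E1 : all proper_cstr cs ->
  pairwise (fun c c' => [disjoint coords c & coords c']) cs -> [disjoint E1 & D] ->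
  PP D E1 cs <= \prod_(c <- cs) cost D c /\
  (all (fun c => coords c \subset D) cs -> PP D E1 cs = \prod_(c <- cs) cost D c).
Proof.
elim: cs D E1 => [|c cs IH] D E1 /=.
  by move=> _ _ _; rewrite big_nil /PP /= mu_cst.
move=> /andP[pc pcs] /andP[dc dcs] dE; rewrite big_cons.
have out e : e \in coords c -> all (fun c => e \notin coords c) cs.
  move=> ec; apply/allP => c' c'cs; have := allP dc _ c'cs; rewrite -setI_eq0 => /eqP/setP/(_ e).
  by rewrite !inE ec /= => ->.
have nE1 e : e \in D -> e \in E1 = false.
  by move=> eD; apply/negP => eE; move: dE; rewrite -setI_eq0 => /eqP/setP/(_ e); rewrite !inE eE eD.
have dD1 e D' E' : [disjoint E' & D'] -> [disjoint E' & D' :\ e] /\ [disjoint e |: E' & D' :\ e].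
  move=> d; split; first by apply: disjointWr d; exact: subsetDl.
  rewrite -setI_eq0; apply/eqP/setP => x; rewrite !inE; case: eqP => //= _.
  by case: (boolP (x \in E')) => // xE; rewrite (disjointFr d xE).
have sD1 e D' : e \in coords c -> all (fun c => coords c \subset D') cs ->
    all (fun c => coords c \subset D' :\ e) cs.
  move=> ec /allP H; apply/allP => c' c'cs; rewrite subsetD1 H //=; exact: (allP (out e ec)).
case: c pc {dc} out sD1 => [e|[e1 e2]] /= pc out sD1.
  have eo := out e (set11 e).
  have [eD|eD] := boolP (e \in D); last first.
    rewrite PP_drop ?disjoints1 // mul1r; have [le _] := IH D E1 pcs dcs dE; split.
      by apply: le_trans le; rewrite ler_piMl ?PP_ge0 // lern1 leq_b1.
    by rewrite sub1set (negPf eD).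
  have dis E' : PP (D :\ e) E' (inl e :: cs) = (e \notin E')%:R * PP (D :\ e) E' cs.
    by apply: PP_drop; rewrite /= disjoints1 !inE eqxx.
  rewrite (PP_peel _ _ eD) !dis nE1 // setU11 /= mul1r mul0r mulr0 addr0.
  have [d1 _] := dD1 e D E1 dE; have [le eq] := IH (D :\ e) E1 pcs dcs d1.
  rewrite -(prod_cost_D1 D eo); split; first by rewrite ler_wpM2l.
  by move=> /andP[_ H]; rewrite eq // sD1 ?set11.
have [i1 i2] : e1 \in [set e1; e2] /\ e2 \in [set e1; e2] by rewrite !inE !eqxx orbT.
have [u1 u2] := (out e1 i1, out e2 i2).
have disj D' : e1 \notin D' -> e2 \notin D' -> [disjoint coords (inr (e1, e2)) & D'].
  move=> n1 n2; rewrite /= -setI_eq0; apply/eqP/setP => x; rewrite !inE.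
  case: eqP => [->|_]; first by rewrite (negPf n1).
  by case: eqP => [->|_] //; rewrite (negPf n2).
have dis D' E' : e1 \notin D' -> e2 \notin D' -> PP D' E' (inr (e1, e2) :: cs) =
    ((e1 \in E') == (e2 \in E'))%:R * PP D' E' cs.
  by move=> n1 n2; apply: PP_drop; exact: disj.
have one e D' E' : e \in [set e1; e2] -> [disjoint E' & D'] -> PP D' E' cs <= \prod_(c <- cs) cost D' c.
  by move=> _ d; have [] := IH D' E' pcs dcs d.
have P0 D' : 0 <= \prod_(c <- cs) cost D' c by apply: prodr_ge0 => c _; exact: cost_ge0.
have [D1|D1] := boolP (e1 \in D); have [D2|D2] := boolP (e2 \in D).
- have D2' : e2 \in D :\ e1 by rewrite !inE eq_sym pc D2.
  have n1 : e1 \notin D :\ e1 :\ e2 by rewrite !inE eqxx andbF.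
  have n2 : e2 \notin D :\ e1 :\ e2 by rewrite !inE eqxx.
  rewrite (PP_peel _ _ D1) !(PP_peel _ _ D2') !dis // !inE !eqxx (negPf pc) [e2 == e1]eq_sym (negPf pc) !nE1 //=.
  rewrite !mul0r !mul1r !mulr0 addr0 add0r.
  have [d1 d2] := dD1 e1 D E1 dE.
  have [d3 _] := dD1 e2 _ _ d1; have [_ d4] := dD1 e2 _ _ d2.
  have [le3 eq3] := IH _ _ pcs dcs d3; have [le4 eq4] := IH _ _ pcs dcs d4.
  rewrite -(prod_cost_D1 D u1) -(prod_cost_D1 (D :\ e1) u2); split.
    have -> (x : R) : (p ^+ 2 + (1 - p) ^+ 2) * x = (1 - p) * ((1 - p) * x) + p * (p * x) by ring.
    by apply: lerD; rewrite ler_wpM2l // ler_wpM2l.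
  by move=> /andP[_ H]; rewrite eq3 ?eq4 ?sD1 //; ring.
- have n1 : e1 \notin D :\ e1 by rewrite !inE eqxx.
  have n2 : e2 \notin D :\ e1 by rewrite !inE (negPf D2) andbF.
  have [d1 d2] := dD1 e1 D E1 dE.
  have [le1 _] := IH _ _ pcs dcs d1; have [le2 _] := IH _ _ pcs dcs d2.
  rewrite (PP_peel _ _ D1) !dis // nE1 // setU11 !inE [e2 == e1]eq_sym (negPf pc) /=.
  rewrite -(prod_cost_D1 D u1); split; last by rewrite subUset !sub1set (negPf D2) andbF.
  case: (e2 \in E1) => /=.
    rewrite mul0r mulr0 add0r mul1r; apply: (le_trans (ler_wpM2l p_ge0 le2)).
    by rewrite ler_wpM2r //; move: p02; lra.
  by rewrite mul0r mulr0 addr0 mul1r ler_wpM2l.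
- have n1 : e1 \notin D :\ e2 by rewrite !inE (negPf D1) andbF.
  have n2 : e2 \notin D :\ e2 by rewrite !inE eqxx.
  have [d1 d2] := dD1 e2 D E1 dE.
  have [le1 _] := IH _ _ pcs dcs d1; have [le2 _] := IH _ _ pcs dcs d2.
  rewrite (PP_peel _ _ D2) !dis // (nE1 _ D2) setU11 !inE (negPf pc) /=.
  rewrite -(prod_cost_D1 D u2); split; last by rewrite subUset !sub1set (negPf D1).
  case: (e1 \in E1) => /=.
    rewrite mul0r mulr0 add0r mul1r; apply: (le_trans (ler_wpM2l p_ge0 le2)).
    by rewrite ler_wpM2r //; move: p02; lra.
  by rewrite mul0r mulr0 addr0 mul1r ler_wpM2l.
have [le _] := IH D E1 pcs dcs dE; rewrite dis // mul1r; split.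
  by apply: le_trans le; rewrite ler_piMl ?PP_ge0 // lern1 leq_b1.
by rewrite subUset !sub1set (negPf D1).
Qed.

End Constraints.

Lemma pairwise_of_uniq (T : eqType) (r : rel T) (s : seq T) : uniq s ->
  {in s &, forall x y, x != y -> r x y} -> pairwise r s.
Proof.
elim: s => //= x s IH /andP[xs us] H; apply/andP; split.
  apply/allP => y ys; apply: H; rewrite ?inE ?eqxx ?ys ?orbT //.
  by apply: contraNneq xs => ->.
by apply: IH => // y z ys zs; apply: H; rewrite inE ?ys ?zs orbT.
Qed.

Section PrEdges.
Variable n : nat.
Implicit Types x y : 'I_n.

Lemma pr_upper x y : x != y -> pr x y \in upper_pairs n.
Proof.
by rewrite /pr inE; case: (ltngtP x y) => // /val_inj ->; rewrite eqxx.
Qed.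

Lemma pr_pairs (S : {set 'I_n}) x y : x != y -> (pr x y \in pairs S) = (x \in S) && (y \in S).
Proof.
move=> xy; rewrite inE pr_upper //= /pr; case: ifP => _ //=; exact: andbC.
Qed.

Lemma pr_inj x y x' y' : pr x y = pr x' y' -> (x = x' /\ y = y') \/ (x = y' /\ y = x').
Proof.
by rewrite /pr; case: ifP => _; case: ifP => _ [-> ->]; [left|right|right|left].
Qed.

End PrEdges.

Section Template.
Variables (R : realType) (p : R) (n r t : nat).
Hypothesis p02 : 0 < p < 1 / 2.

(* [inl z] is a singleton vertex, [inr (i, false)] and [inr (i, true)] are twins. *)
Definition template : finType := ('I_r + 'I_t * bool)%type.

Definition tindex : finType := (template * template + 'I_t * 'I_r)%type.

Definition same_side (a b : template) :=
  match a, b with inl _, inl _ => true | inr _, inr _ => true | _, _ => false end.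

(** [enum_rank] keeps one order of each pair inside a side, so that distinct constraints involve
    disjoint pairs. Twins lie on the same side and are thus nonadjacent. *)
Definition valid (u : tindex) :=
  match u with inl (a, b) => same_side a b && (enum_rank a < enum_rank b)%N | inr _ => true end.

Implicit Types (f g : {ffun template -> 'I_n}).

Definition tcstr f (u : tindex) : cstr ('I_n * 'I_n)%type :=
  match u with
  | inl (a, b) => inl (pr (f a) (f b))
  | inr (i, z) => inr (pr (f (inr (i, false))) (f (inl z)), pr (f (inr (i, true))) (f (inl z)))
  end.

Definition tcs f := [seq tcstr f u | u <- enum tindex & valid u].

Definition planted f (E : {set 'I_n * 'I_n}) := all (holds E) (tcs f).

Definition base_cost (u : tindex) : R :=
  match u with inl _ => 1 - p | inr _ => p ^+ 2 + (1 - p) ^+ 2 end.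

Definition ptmpl : R := \prod_(u : tindex | valid u) base_cost u.

Lemma tcs_proper f : injective f -> all (@proper_cstr _) (tcs f).
Proof.
move=> fi; apply/allP => _ /mapP[[[a b]|[i z]] _ ->] //=.
by apply/eqP => /pr_inj [[/fi]|[/fi]].
Qed.

Lemma tcs_disjoint f : injective f ->
  pairwise (fun c c' => [disjoint coords c & coords c']) (tcs f).
Proof.
move=> fi; rewrite pairwise_map; apply: pairwise_of_uniq; first by rewrite filter_uniq // enum_uniq.
have tw i i' bb bb' z z' : pr (f (inr (i, bb))) (f (inl z)) = pr (f (inr (i', bb'))) (f (inl z')) -> i = i' /\ z = z'.
  by move=> /pr_inj [[/fi [-> _] /fi [->]]|[/fi]].
have ss a b i bb z : same_side a b -> pr (f a) (f b) <> pr (f (inr (i, bb))) (f (inl z)).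
  by move=> sab /pr_inj [[/fi ea /fi eb]|[/fi ea /fi eb]]; rewrite ea eb in sab.
move=> u v; rewrite !mem_filter => /andP[vu _] /andP[vv _] uv /=.
rewrite -setI_eq0; apply/eqP/setP => e; rewrite in_set0 in_setI; apply/negP => /andP[].
case: u vu uv => [[a b]|[i z]] /= vu uv; case: v vv uv => [[a' b']|[i' z']] /= vv uv.
- move=> /set1P -> /set1P /pr_inj [[/fi ea /fi eb]|[/fi ea /fi eb]].
    by rewrite ea eb eqxx in uv.
  by move: vu vv; rewrite ea eb => /andP[_ l1] /andP[_ l2]; move: (ltn_trans l1 l2); rewrite ltnn.
- by case/andP: vu => sab _; move=> /set1P -> /set2P [] /(ss _ _ _ _ _ sab).
- by case/andP: vv => sab _; move=> /set2P [] -> /set1P /esym /(ss _ _ _ _ _ sab).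
- by move=> /set2P [] -> /set2P [] /tw [ei ez]; rewrite ei ez eqxx in uv.
Qed.

Lemma tcs_cost f D : \prod_(c <- tcs f) cost p D c = \prod_(u : tindex | valid u) cost p D (tcstr f u).
Proof. by rewrite big_map big_filter big_enum_cond; apply: eq_bigl. Qed.

Lemma valid_neq f a b : injective f -> valid (inl (a, b)) -> f a != f b.
Proof.
by move=> fi /andP[_ lt]; apply/eqP => /fi e; rewrite e ltnn in lt.
Qed.

Lemma cross_neq f i bb z : injective f -> f (inr (i, bb)) != f (inl z).
Proof. by move=> fi; apply/eqP => /fi. Qed.

Lemma planted_prob f : injective f ->
  mu p (upper_pairs n) (fun E => (planted f E)%:R) = ptmpl.
Proof.
move=> fi; have d0 : [disjoint (set0 : {set 'I_n * 'I_n}) & upper_pairs n].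
  by rewrite -setI_eq0 set0I.
have [_ eq] := PP_cost p02 (tcs_proper fi) (tcs_disjoint fi) d0.
transitivity (PP p (upper_pairs n) set0 (tcs f)).
  by apply: eq_mu => E _; rewrite setU0.
rewrite eq ?tcs_cost.
  apply: eq_bigr => -[[a b]|[i z]] /= v; first by rewrite pr_upper // valid_neq.
  by rewrite !pr_upper // cross_neq.
apply/allP => k /mapP[u]; rewrite mem_filter => /andP[v _] ->.
case: u v => [[a b]|[i z]] /= v; first by rewrite sub1set pr_upper // valid_neq.
by rewrite subUset !sub1set !pr_upper // cross_neq.
Qed.

Lemma planted_local f E : injective f ->
  planted f E = planted f (E :&: pairs [set f a | a : template]).
Proof.
move=> fi; have im a : f a \in [set f a | a : template] by apply/imsetP; exists a.
apply: eq_in_all => k /mapP[u]; rewrite mem_filter => /andP[v _] ->.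
case: u v => [[a b]|[i z]] /= v; first by rewrite in_setI pr_pairs ?valid_neq // !im !andbT.
by rewrite !in_setI !pr_pairs ?cross_neq // !im !andbT.
Qed.

(** Factor by which revealing the pairs inside [S] raises the cost of a constraint of [f] above
    [base_cost]. *)
Definition cost_ratio f (S : {set 'I_n}) (u : tindex) : R :=
  match u with
  | inl (a, b) => if (f a \in S) && (f b \in S) then (1 - p)^-1 else 1
  | inr (i, z) => if f (inl z) \in S then
      (if f (inr (i, false)) \in S then
         (if f (inr (i, true)) \in S then (p ^+ 2 + (1 - p) ^+ 2)^-1 else (1 - p) / (p ^+ 2 + (1 - p) ^+ 2))
       else (if f (inr (i, true)) \in S then (1 - p) / (p ^+ 2 + (1 - p) ^+ 2) else 1))
      else 1
  end.

(* Given the edges inside the range of [g], each constraint of [f] keeps only the cost of its fresh edges. *)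
Lemma planted_pair_prob f g : injective f -> injective g ->
  mu p (upper_pairs n) (fun E => (planted g E && planted f E)%:R) <=
  ptmpl * (ptmpl * \prod_(u : tindex | valid u) cost_ratio f [set g a | a : template] u).
Proof.
move=> fi gi; set S := [set g a | a : template].
have p01 : 0 <= p <= 1 by move: p02; lra.
have q0 : 0 < 1 - p by move: p02; lra.
have Q0 : 0 < p ^+ 2 + (1 - p) ^+ 2 by rewrite ltr_wpDl ?exprn_gt0 // sqr_ge0.
set O := upper_pairs n :\: pairs S.
have OU : O :|: pairs S = upper_pairs n.
  by rewrite setUC -[RHS](setID _ (pairs S)) (setIidPr (pairs_sub S)).
have dOS : [disjoint O & pairs S].
  by rewrite -setI_eq0; apply/eqP/setP => e; rewrite in_setI in_setD in_set0; case: (e \in pairs S); by rewrite ?andbF.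
set F := \prod_(u | _) _; pose G := ptmpl * F.
have rc u : valid u -> cost p O (tcstr f u) = base_cost u * cost_ratio f S u.
  case: u => [[a b]|[i z]] /= v.
    rewrite inE pr_upper ?valid_neq // pr_pairs ?valid_neq // andbT.
    by case: (_ && _) => /=; rewrite ?mulr1 // divff // gt_eqF.
  rewrite !in_setD !pr_upper ?cross_neq // !pr_pairs ?cross_neq // !andbT.
  case: (f (inl z) \in S); case: (f (inr (i, false)) \in S); case: (f (inr (i, true)) \in S) => /=;
    rewrite ?mulr1 // ?divff ?gt_eqF //; by field; rewrite gt_eqF.
have inner (E1 : {set 'I_n * 'I_n}) : E1 \subset pairs S ->
    mu p O (fun E => (planted f (E :|: E1))%:R) <= G.
  move=> E1S; have d1 : [disjoint E1 & O] by apply: disjointWl E1S _; rewrite disjoint_sym.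
  have [le _] := PP_cost p02 (tcs_proper fi) (tcs_disjoint fi) d1.
  apply: le_trans le _; rewrite tcs_cost /G /ptmpl -big_split /=.
  by rewrite (eq_bigr _ rc).
rewrite -OU mu_split //.
apply: (@le_trans _ _ (mu p (pairs S) (fun E1 => G * (planted g E1)%:R))).
  apply: le_mu => // E1 E1S; apply: (@le_trans _ _ (mu p O (fun E => (planted g E1)%:R * (planted f (E :|: E1))%:R))).
    apply: le_mu => // E EO; rewrite -natrM mulnb planted_local // -/S.
    rewrite (_ : (E :|: E1) :&: pairs S = E1) //.
    rewrite setIUl (setIidPl E1S); apply/setUidPr; apply/subsetP => e; rewrite inE => /andP[/(subsetP EO) eO eS].
    by move: eO; rewrite inE eS.
  by rewrite muZ [leRHS]mulrC ler_wpM2l // inner.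
rewrite muZ [leRHS]mulrC ler_wpM2l //.
  rewrite /G mulr_ge0 ?prodr_ge0 // => u _; last first.
    by case: u => [[a b]|[i z]] /=; do 3?case: ifP => _ //; rewrite ?divr_ge0 ?invr_ge0 ?ltW.
  by case: u => [[a b]|[i z]] /=; rewrite ltW.
rewrite -(planted_prob gi) -(mu_marginal p _ (pairs_sub S)); apply: le_mu => // E _.
by rewrite -planted_local.
Qed.

End Template.

Section PlantedStructure.
Variables (n r t : nat).
Implicit Types (f : {ffun template r t -> 'I_n}) (E : {set 'I_n * 'I_n}).

Lemma prC (x y : 'I_n) : pr x y = pr y x.
Proof. by rewrite /pr; case: ltngtP => // /val_inj ->. Qed.

(** Each pair of twins forms a biclique with its common neighbourhood among the singletons. As both
    sides of the template are independent, these [t] bicliques cover every edge inside its image. *)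
Lemma planted_bp f E : injective f -> E \subset upper_pairs n -> planted f E ->
  (bp E <= n - (r + 2 * t) + t)%N.
Proof.
move=> fi EU /allP pl; pose M := [set f a | a : template r t].
have cM : #|M| = (r + 2 * t)%N.
  by rewrite card_imset // card_sum card_ord card_prod card_ord card_bool mulnC.
have plu u : valid u -> holds E (tcstr f u).
  by move=> vu; apply: pl; apply: map_f; rewrite mem_filter vu mem_enum.
have same a b : same_side a b -> adj E (f a) (f b) = false.
  move=> sab; have [->|ab] := eqVneq a b; first exact: adj_irr.
  have fab : f a != f b by apply: contra ab => /eqP /fi ->.
  rewrite adj_pr //; apply/negbTE.
  case: (ltngtP (enum_rank a) (enum_rank b)) => [lt|lt|/val_inj/enum_rank_inj e].
  - by have := plu (inl (a, b)); rewrite /= sab lt; apply.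
  - rewrite prC; have := plu (inl (b, a)); rewrite /= lt andbT; apply.
    by case: (a) (b) sab => [?|?] [?|?].
  - by rewrite e eqxx in ab.
have twin i z bb : adj E (f (inr (i, bb))) (f (inl z)) = adj E (f (inr (i, false))) (f (inl z)).
  rewrite !adj_pr ?cross_neq //; have /eqP H := plu (inr (i, z)) isT.
  by case: bb; rewrite ?H.
pose A i : {set 'I_n} := [set f (inr (i, false)); f (inr (i, true))].
pose B i : {set 'I_n} := [set f (inl z) | z : 'I_r & adj E (f (inr (i, false))) (f (inl z))].
pose s := [seq (A i, B i) | i <- enum 'I_t].
have inA i a : (f a \in A i) = (if a is inr (j, _) then j == i else false).
  rewrite /A !inE !(inj_eq fi); case: a => [z|[j bb]] //=.
  have e b' : (inr (j, bb) == inr (i, b') :> template r t) = (j == i) && (bb == b') by [].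
  by rewrite !e; case: bb {e}; rewrite ?andbT ?andbF ?orbF.
have inB i a : (f a \in B i) = (if a is inl z then adj E (f (inr (i, false))) (f (inl z)) else false).
  case: a => [z|b].
    apply/imsetP/idP => [[z' H /fi [->]]|H]; last by exists z; rewrite ?inE.
    by move: H; rewrite inE.
  by apply/negbTE/imsetP => -[z _ /fi].
have cross j bb z : count (fun AB => in_biclique AB (f (inr (j, bb))) (f (inl z))) s =
    adj E (f (inr (j, bb))) (f (inl z)) :> nat.
  rewrite count_map (eq_count (a2 := fun i => (i == j) && adj E (f (inr (j, bb))) (f (inl z)))); last first.
    move=> i /=; rewrite /in_biclique /= !inA !inB andbF orbF eq_sym.
    by case: eqP => [->|] //=; rewrite twin.
  case: adj; last by rewrite (eq_count (a2 := pred0)) ?count_pred0 // => i; rewrite /= andbF.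
  rewrite (eq_count (a2 := pred1 j)) => [|i]; last by rewrite /= andbT.
  by rewrite count_uniq_mem ?enum_uniq // mem_enum.
have szs : (size s <= #|M|)%N by rewrite size_map size_enum_ord cM; lia.
have [|le _] := @decomposes_bp n E M s EU _ szs; last first.
  by rewrite cM size_map size_enum_ord in le.
move=> _ _ /imsetP[a _ ->] /imsetP[b _ ->].
case: a => [z|[j bb]]; case: b => [z'|[j' bb']].
- rewrite same // (eq_in_count (a2 := pred0)) ?count_pred0 // => _ /mapP[i _ ->] /=.
  by rewrite /in_biclique /= !inA.
- rewrite adjC -cross; apply: eq_count => AB; exact: in_bicliqueC.
- exact: cross.
rewrite same // (eq_in_count (a2 := pred0)) ?count_pred0 // => _ /mapP[i _ ->] /=.
by rewrite /in_biclique /= !inB !andbF.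
Qed.

End PlantedStructure.

(** * Correlation of two overlapping copies *)

Section Gain.
Variable R : realType.

(** In units of [ln n / c], [u] measures the shared singletons, [v] and [w] the twin pairs shared in
    two vertices and in one. The left side is the log-correlation; the right side is what choosing
    the shared vertices costs, up to the margin [de]. At full overlap, to first order in [ep], this
    needs [et > (1 - 2 kap) ep], whereas exceeding [alpha] needs [et < ep]: [et] is the midpoint. *)
Lemma quadratic_gain (kap u v w be : R) : 0 < kap <= 1 / 2 -> be = 3 / 2 - kap ->
  let ep := kap / 8 in let et := (1 - kap) * ep in let de := ep * kap / 16 in
  0 <= u <= 2 - et -> 0 <= v -> 0 <= w -> v + w <= ep ->
  u ^+ 2 / 2 + (2 * v + w) ^+ 2 / 2 + u * (be * v + (be - 1) * w) <= (1 - de) * (u + 2 * v + w).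
Proof.
move=> /andP[k0 k2] -> ep et de /andP[u0 u2] v0 w0 vw.
have ep0 : 0 < ep by rewrite divr_gt0.
have ep1 : ep <= kap / 8 by [].
have de0 : 0 <= de by rewrite /de; nra.
have de1 : de <= ep / 32 by rewrite /de; nra.
have et2 : ep / 2 <= et by rewrite /et; nra.
have et3 : et <= ep by rewrite /et; nra.
have h1 : (2 * v + w) ^+ 2 / 2 <= ep * (2 * v + w).
  have : (2 * v + w) * (2 * v + w) <= (2 * ep) * (2 * v + w) by rewrite ler_wpM2r //; lra.
  by rewrite expr2; lra.
have h2 : u ^+ 2 <= u * (2 - et) by rewrite expr2 ler_wpM2l.
have uw : u * w <= 2 * w by rewrite ler_wpM2r //; lra.
have h3 : u * w * (1 / 2 - kap) <= 2 * w * (1 / 2 - kap) by rewrite ler_wpM2r //; lra.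
pose a := et / 2 - de; pose b := 2 - 2 * de - 2 * ep.
(* What is left is affine in [u] and in [v], so it is enough to look at [u = 0, 2] and [v = 0, ep];
   [k1] is the corner [(2, ep)]. *)
suff key : 0 <= u * a + v * (b - (3 / 2 - kap) * u).
  have e1 : (3 / 2 - kap - 1) * (u * w) = u * w * (1 / 2 - kap) by field.
  have w1 : 0 <= w * (2 * kap - ep - de) by rewrite mulr_ge0 //; lra.
  rewrite /a /b in key; nra.
have a0 : 0 <= a by rewrite /a; lra.
have b0 : 0 <= b by rewrite /b; lra.
have k1 : 0 <= 2 * a + ep * (b - (3 / 2 - kap) * 2).
  have -> : 2 * a + ep * (b - (3 / 2 - kap) * 2) = et - 2 * de + ep * (2 * kap - 1 - 2 * de - 2 * ep).
    by rewrite /a /b; field.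
  rewrite /et; have -> : (1 - kap) * ep - 2 * de + ep * (2 * kap - 1 - 2 * de - 2 * ep) =
     ep * (kap - kap / 8 - 2 * de - 2 * ep) by rewrite /de; field.
  by rewrite mulr_ge0 ?(ltW ep0) //; lra.
have k2' : 0 <= u * a + ep * (b - (3 / 2 - kap) * u).
  have -> : u * a + ep * (b - (3 / 2 - kap) * u) =
    u / 2 * (2 * a + ep * (b - (3 / 2 - kap) * 2)) + (1 - u / 2) * (ep * b) by field.
  by rewrite addr_ge0 // mulr_ge0 ?(mulr_ge0 (ltW ep0)) //; lra.
rewrite -(pmulr_rge0 _ ep0).
have -> : ep * (u * a + v * (b - (3 / 2 - kap) * u)) =
   (ep - v) * (u * a) + v * (u * a + ep * (b - (3 / 2 - kap) * u)) by ring.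
by rewrite addr_ge0 // mulr_ge0 // ?mulr_ge0 //; lra.
Qed.

(* Exponential form of the ratios: [c] and [b] are the costs of an absent edge and of a twin constraint. *)
Lemma gain_bound (p b th : R) (n r t : nat) (f : {ffun template r t -> 'I_n}) (S : {set 'I_n}) :
  0 < p < 1 / 2 -> p ^+ 2 + (1 - p) ^+ 2 = expR (- b) ->
  (forall X t2 t1 : R, 0 <= X <= r%:R -> 0 <= t2 -> 0 <= t1 -> t2 + t1 <= t%:R ->
     cp p * (X ^+ 2 + (2 * t2 + t1) ^+ 2) / 2 + X * (b * t2 + (b - cp p) * t1) <= th * (X + (2 * t2 + t1))) ->
  \prod_(u : tindex r t | valid u) cost_ratio p f S u <=
  \prod_(a : template r t) (if f a \in S then expR th else 1).
Proof.
move=> p02 QE H; set c := cp p in H *.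
have qE : 1 - p = expR (- c) by rewrite cpE //; lra.
pose s (a : template r t) : R := (f a \in S)%:R.
have s01 a : 0 <= s a <= 1 by rewrite /s; case: (f a \in S); rewrite ?ler01 ?lexx.
pose w2 i := s (inr (i, false)) * s (inr (i, true)).
pose w1 i := s (inr (i, false)) * (1 - s (inr (i, true))) + (1 - s (inr (i, false))) * s (inr (i, true)).
pose w (u : tindex r t) : R := match u with
  | inl (x, y) => c * (s x * s y) | inr (i, z) => s (inl z) * (b * w2 i + (b - c) * w1 i) end.
have -> : \prod_(u : tindex r t | valid u) cost_ratio p f S u = expR (\sum_(u : tindex r t | valid u) w u).
  rewrite expR_sum; apply: eq_bigr => -[[x y]|[i z]] _ /=.
    rewrite /s qE -!expRN ?opprK; by case: (f x \in S); case: (f y \in S); rewrite /= ?mulr1 ?mulr0 ?expR0.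
  rewrite /w2 /w1 /s QE qE -!expRN ?opprK -expRD.
  case: (f (inl z) \in S); case: (f (inr (i, false)) \in S); case: (f (inr (i, true)) \in S) => /=;
    rewrite -?[RHS]expR0; try (by congr expR; ring); by rewrite -[LHS]expR0; congr expR; ring.
have -> : \prod_(a : template r t) (if f a \in S then expR th else 1) = expR (\sum_(a : template r t) th * s a).
  rewrite expR_sum; apply: eq_bigr => a _; rewrite /s; case: ifP => _; by rewrite /= ?mulr1 ?mulr0 ?expR0.
rewrite ler_expR -big_distrr /=.
pose X := \sum_z s (inl z); pose t2 := \sum_i w2 i; pose t1 := \sum_i w1 i.
pose Y := \sum_(v : 'I_t * bool) s (inr v).
have YE : Y = 2 * t2 + t1.
  have -> : Y = \sum_i \sum_(bb : bool) s (inr (i, bb)) by rewrite pair_bigA; apply: eq_bigr => -[].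
  rewrite /t2 /t1 big_distrr -big_split /=.
  apply: eq_bigr => i _; rewrite big_bool /w2 /w1 /=; ring.
have sE : \sum_(a : template r t) s a = X + (2 * t2 + t1) by rewrite big_sumType -YE.
have V : 2 * \sum_(u : template r t * template r t | valid (inl u : tindex r t)) s u.1 * s u.2 <= X ^+ 2 + Y ^+ 2.
  pose F (x y : template r t) : R := if same_side x y then (if (enum_rank x < enum_rank y)%N then s x * s y else 0) else 0.
  have -> : \sum_(u : template r t * template r t | valid (inl u : tindex r t)) s u.1 * s u.2 = \sum_x \sum_y F x y.
    rewrite pair_bigA big_mkcond /=; apply: eq_bigr => -[x y] _; rewrite /F /=.
    by case: (same_side x y); case: (_ < _)%N.
  have -> : X ^+ 2 + Y ^+ 2 = \sum_x \sum_y (if same_side x y then s x * s y else 0).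
    rewrite big_sumType /=; congr (_ + _); rewrite expr2 big_distrl; apply: eq_bigr => x _; rewrite big_sumType /= big_distrr /=.
      by rewrite [X in _ = _ + X]big1 ?addr0 //.
    by rewrite [X in _ = X + _]big1 ?add0r //.
  rewrite mulr_natl mulr2n {2}exchange_big -big_split /=; apply: ler_sum => x _.
  rewrite -big_split; apply: ler_sum => y _ /=; rewrite /F.
  have -> : same_side y x = same_side x y by case: (x) (y) => [?|?] [?|?].
  case: (same_side x y); last by rewrite addr0.
  have [/andP[x0 x1] /andP[y0 y1]] := (s01 x, s01 y).
  have xy : 0 <= s x * s y by rewrite mulr_ge0.
  by case: ltngtP; rewrite ?addr0 ?add0r // mulrC.
have t20 : 0 <= t2.
  by apply: sumr_ge0 => i _; rewrite mulr_ge0 //.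
have t10 : 0 <= t1.
  by apply: sumr_ge0 => i _; have := s01 (inr (i, false)); have := s01 (inr (i, true)); rewrite /w1; nra.
have tt : t2 + t1 <= t%:R.
  rewrite -big_split /=; apply: (@le_trans _ _ (\sum_(i < t) (1 : R))); last by rewrite sumr_const card_ord.
  by apply: ler_sum => i _; have := s01 (inr (i, false)); have := s01 (inr (i, true)); rewrite /w1 /w2; nra.
have X0 : 0 <= X <= r%:R.
  apply/andP; split; first by apply: sumr_ge0 => z _; case/andP: (s01 (inl z)).
  apply: (@le_trans _ _ (\sum_(z < r) (1 : R))); last by rewrite sumr_const card_ord.
  by apply: ler_sum => z _; case/andP: (s01 (inl z)).
rewrite sE; apply: le_trans (H X t2 t1 X0 t20 t10 tt).
rewrite big_sumType /=; apply: lerD.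
  have c0 : 0 < c by have [c1 _ _] := cp_bounds p02; rewrite /c; lra.
  rewrite (eq_bigr (fun u : template r t * template r t => c * (s u.1 * s u.2))); last by move=> [].
  by rewrite -big_distrr -YE /= -mulrA ler_wpM2l ?(ltW c0) // ler_pdivlMr // mulrC.
have -> : \sum_(v : 'I_t * 'I_r | true) w (inr v : tindex r t) = \sum_i \sum_z s (inl z) * (b * w2 i + (b - c) * w1 i).
  by rewrite pair_bigA; apply: eq_bigr => -[].
apply: eq_ler; rewrite /t2 /t1 !big_distrr -big_split /= big_distrr /=; apply: eq_bigr => i _.
by rewrite -big_distrl.
Qed.

End Gain.

(** * The upper bound *)

Section PartThree.
Variable R : realType.

Lemma alpha_ge_prob (p : R) n k : 0 <= p <= 1 ->
  mu p (upper_pairs n) (fun E => (k <= alpha E)%N%:R) <= EX p n k.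
Proof.
move=> p01; apply: (@le_trans _ _ (mu p (upper_pairs n) (fun E =>
   \sum_(S : {set 'I_n} | #|S| == k) [disjoint E & pairs S]%:R))).
  apply: le_mu => // E EU; case: leqP => [ka|_]; last by apply: sumr_ge0.
  have [S iS cS] := alpha_witness E.
  have : (0 < #|[set B : {set 'I_n} | B \subset S & #|B| == k]|)%N.
    by rewrite cards_draws cS bin_gt0.
  case/card_gt0P => B; rewrite inE => /andP[BS Bk].
  rewrite (bigD1 B) //= -independentE // (_ : independent E B); last first.
    rewrite independentE //; apply: disjointWr (_ : pairs B \subset pairs S) _; last by rewrite -independentE.
    by apply/subsetP => u; rewrite !inE => /and3P[-> /(subsetP BS) -> /(subsetP BS) ->].
  by rewrite lerDl sumr_ge0.
rewrite mu_sum (eq_bigr (fun=> (1 - p) ^+ 'C(k, 2))) => [|S /eqP Sk].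
  by rewrite sumr_const -cardsE card_draws card_ord /EX mulr_natl.
by rewrite mu_disjoint ?pairs_sub // card_pairs Sk.
Qed.

Lemma planted_exists_prob (p th b : R) (n r t : nat) : 0 < p < 1 / 2 ->
  p ^+ 2 + (1 - p) ^+ 2 = expR (- b) -> 0 <= th -> (r + 2 * t <= n)%N ->
  (forall X t2 t1 : R, 0 <= X <= r%:R -> 0 <= t2 -> 0 <= t1 -> t2 + t1 <= t%:R ->
     cp p * (X ^+ 2 + (2 * t2 + t1) ^+ 2) / 2 + X * (b * t2 + (b - cp p) * t1) <= th * (X + (2 * t2 + t1))) ->
  mu p (upper_pairs n) (fun E => (~~ [exists f : {ffun template r t -> 'I_n}, injectiveb f && planted f E])%:R)
  <= (n%:R + (r + 2 * t)%:R * expR th) ^+ (r + 2 * t) / (n ^_ (r + 2 * t))%:R - 1.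
Proof.
move=> p02 QE th0 mn H; have p01 : 0 <= p <= 1 by lra.
set m := (r + 2 * t)%N in mn *.
have ct : #|template r t| = m.
  by rewrite card_sum card_ord card_prod card_ord card_bool mulnC.
set N : R := (n ^_ m)%:R.
have N0 : 0 < N by rewrite ltr0n ffact_gt0.
have cN : #|[pred f : {ffun template r t -> 'I_n} | injectiveb f]|%:R = N.
  by rewrite -cardsE card_inj_ffuns ct card_ord.
pose X (E : {set 'I_n * 'I_n}) : R := \sum_(f : {ffun template r t -> 'I_n} | injectiveb f) (planted f E)%:R.
set pt := ptmpl p r t.
have pt0 : 0 < pt.
  apply: prodr_gt0 => -[[x y]|[i z]] _ /=; first by lra.
  by rewrite QE expR_gt0.
have X1 : mu p (upper_pairs n) X = N * pt.
  rewrite mu_sum (eq_bigr (fun=> pt)) => [|f /injectiveP fi]; last exact: planted_prob.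
  by rewrite sumr_const -mulr_natl cN.
have inner (g : {ffun template r t -> 'I_n}) : injective g ->
    \sum_(f : {ffun template r t -> 'I_n} | injectiveb f) mu p (upper_pairs n) (fun E => (planted g E && planted f E)%:R)
    <= pt * (pt * (n%:R + m%:R * expR th) ^+ m).
  move=> gi; set S := [set g a | a : template r t].
  apply: (@le_trans _ _ (\sum_(f : {ffun template r t -> 'I_n} | injectiveb f) pt * (pt * \prod_(a : template r t) (if f a \in S then expR th else 1)))).
    apply: ler_sum => f /injectiveP fi; apply: le_trans (planted_pair_prob p02 fi gi) _.
    rewrite -/pt ler_pM2l // ler_pM2l //; exact: (gain_bound f S p02 QE H).
  rewrite -!big_distrr /= ler_pM2l // ler_pM2l //.
  have e0 v : 0 <= (if v \in S then expR th else 1 : R) by case: ifP => _; rewrite ?expR_ge0.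
  apply: (@le_trans _ _ (\sum_(f : {ffun template r t -> 'I_n}) \prod_(a : template r t) (if f a \in S then expR th else 1))).
    rewrite big_mkcond; apply: ler_sum => f _; case: ifP => // _; exact: prodr_ge0.
  rewrite -(bigA_distr_bigA (fun (a : template r t) (v : 'I_n) => if v \in S then expR th else 1)) /=.
  rewrite prodr_const ct lerXn2r ?nnegrE ?sumr_ge0 ?addr_ge0 ?mulr_ge0 ?expR_ge0 //.
  rewrite (bigID [in S]) /= addrC; apply: lerD.
    rewrite (eq_bigr (fun=> 1)) => [|v /negPf ->] //; rewrite sumr_const ler_nat.
    by rewrite -[X in (_ <= X)%N]card_ord max_card.
  rewrite (eq_bigr (fun=> expR th)) => [|v ->] //; rewrite sumr_const -[leLHS]mulr_natl ler_wpM2r ?expR_ge0 // ler_nat.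
  by rewrite -ct; apply: leq_imset_card.
have X2 : mu p (upper_pairs n) (fun E => X E ^+ 2) <= N * (pt * (pt * (n%:R + m%:R * expR th) ^+ m)).
  rewrite (eq_mu p (g := fun E => \sum_(g : {ffun template r t -> 'I_n} | injectiveb g)
     \sum_(f : {ffun template r t -> 'I_n} | injectiveb f) (planted g E && planted f E)%:R)); last first.
    move=> E _; rewrite expr2 /X big_distrl /=; apply: eq_bigr => g _.
    by rewrite big_distrr /=; apply: eq_bigr => f _; rewrite -natrM mulnb.
  rewrite mu_sum -cN -sum1_card natr_sum big_distrl /=; apply: ler_sum => g /injectiveP gi.
  by rewrite mu_sum mul1r inner.
have mX : 0 < mu p (upper_pairs n) X by rewrite X1 mulr_gt0.
apply: (@le_trans _ _ (mu p (upper_pairs n) (fun E => (X E == 0)%:R))).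
  apply: le_mu => // E _; rewrite ler_nat; case: existsP => //= nex.
  rewrite lt0b /X big1 // => f fi; case: (boolP (planted f E)) => // pf.
  by case: nex; exists f; rewrite fi pf.
apply: le_trans (chebyshev_eq0 p01 mX) _; rewrite lerD2r X1 ler_pdivrMr ?exprn_gt0 ?mulr_gt0 //.
apply: le_trans X2 _; apply: eq_ler; field; by rewrite gt_eqF.
Qed.

(** The falling factorial is at least [(n - m) ^ m], which leaves [(1 + z) ^ m <= exp (m z)] with
    [z = 4 m exp th / n]. *)
Lemma planted_numeric (n m : nat) (th y : R) : 0 <= th -> (2 * m <= n)%N -> (0 < n)%N ->
  4 * m%:R ^+ 2 * expR th / n%:R <= y -> y <= 1 / 2 ->
  (n%:R + m%:R * expR th) ^+ m / (n ^_ m)%:R - 1 <= 2 * y.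
Proof.
move=> th0 mn n0 hy y2.
have n0' : (0 : R) < n%:R by rewrite ltr0n.
have mn1 : (m <= n)%N by apply: leq_trans mn; exact: leq_pmull.
have mn' : 2 * m%:R <= (n%:R : R) by rewrite -natrM ler_nat.
have nm : (n%:R : R) / 2 <= (n - m)%:R by rewrite natrB //; lra.
have nm0 : (0 : R) < (n - m)%:R by apply: lt_le_trans nm; rewrite divr_gt0.
have e1 : 1 <= expR th by rewrite -[leLHS]expR0 ler_expR.
have ff : ((n - m)%:R : R) ^+ m <= (n ^_ m)%:R.
  rewrite -natrX ler_nat ffact_prod -[X in (_ ^ X)%N]card_ord -prod_nat_const.
  by apply: leq_prod => i _; rewrite leq_sub2l // ltnW.
have m0 : (0 : R) <= m%:R by [].
have em0 : 0 <= m%:R * expR th by rewrite mulr_ge0 ?expR_ge0.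
apply: (@le_trans _ _ (((n%:R + m%:R * expR th) / (n - m)%:R) ^+ m - 1)).
  rewrite lerD2r exprMn exprVn ler_wpM2l ?exprn_ge0 ?addr_ge0 // lef_pV2 ?posrE ?exprn_gt0 //.
  by apply: lt_le_trans ff; rewrite exprn_gt0.
pose z := 4 * m%:R * expR th / n%:R.
have mz : m%:R * z <= y by apply: le_trans hy; apply: eq_ler; rewrite /z; field; rewrite gt_eqF.
have z0 : 0 <= z by rewrite /z !mulr_ge0 ?invr_ge0 ?expR_ge0.
have b : (n%:R + m%:R * expR th) / (n - m)%:R <= 1 + z.
  rewrite ler_pdivrMr // natrB //.
  have zn : z * n%:R = 4 * (m%:R * expR th) by rewrite /z; field; rewrite gt_eqF.
  have zm : z * m%:R <= z * (n%:R / 2) by rewrite ler_wpM2l //; lra.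
  have mm : m%:R <= m%:R * expR th by rewrite ler_peMr.
  lra.
apply: (@le_trans _ _ (expR y - 1)).
  rewrite lerD2r; apply: (@le_trans _ _ (expR z ^+ m)).
    rewrite lerXn2r ?nnegrE ?expR_ge0 ?divr_ge0 ?addr_ge0 ?(ltW nm0) //.
    by apply: le_trans b _; exact: expR_ge1Dx.
  by rewrite -expRM_natl ler_expR.
have y0 : 0 <= y by apply: le_trans mz; rewrite mulr_ge0.
have := expR_le_quad y2; nra.
Qed.

(** A first moment keeps [alpha] below [2 ln n / c + 2], while [r + t] is about [(2 - et + ep) ln n
    / c = (2 + kap ep) ln n / c]. *)
Lemma bp_upper (p : R) : 0 < p < 1 / 2 -> 0 < 4 * p ^+ 3 - 7 * p ^+ 2 + 5 * p - 1 ->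
  exists c : R, 0 < c /\
  whp (fun n => Gnp_prob n p (fun E => (bp E)%:R <= n%:R - (1 + c) * (alpha E)%:R)).
Proof.
move=> p02 pol; have [p0 p2] := andP p02.
have p01 : 0 <= p <= 1 by lra.
set c := cp p; have [c1 c2 c3] := cp_bounds p02; rewrite -/c in c1 c2 c3.
have c0 : 0 < c by lra.
have qE : 1 - p = expR (- c) by rewrite cpE //; lra.
set Q := p ^+ 2 + (1 - p) ^+ 2.
have Q0 : 0 < Q by rewrite ltr_wpDl ?sqr_ge0 // exprn_gt0 //; lra.
pose b := - ln Q; have QE : Q = expR (- b) by rewrite opprK lnK.
have bc : c <= b.
  have : Q <= 1 - p by rewrite /Q; nra.
  by rewrite QE qE ler_expR lerN2.
have b3 : b < 3 / 2 * c.
  have : (1 - p) ^+ 3 < Q ^+ 2.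
    rewrite -subr_gt0 (_ : _ - _ = p * (4 * p ^+ 3 - 7 * p ^+ 2 + 5 * p - 1)); last by rewrite /Q; ring.
    by rewrite mulr_gt0.
  rewrite qE QE -!expRM_natl ltr_expR; lra.
pose kap := 3 / 2 - b / c.
have kap0 : 0 < kap <= 1 / 2.
  have h1 : b / c < 3 / 2 by rewrite ltr_pdivrMr.
  have h2 : 1 <= b / c by rewrite ler_pdivlMr // mul1r.
  by rewrite /kap; lra.
have beE : b / c = 3 / 2 - kap by rewrite /kap; ring.
pose ep := kap / 8; pose et := (1 - kap) * ep; pose de := ep * kap / 16.
have [k0 k2] := andP kap0.
have ep0 : 0 < ep by rewrite divr_gt0.
have ep1 : ep <= 1 / 16 by rewrite /ep; lra.
have de0 : 0 < de by rewrite /de divr_gt0 // mulr_gt0.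
have de1 : de <= 1 by rewrite /de; nra.
have et0 : 0 <= et by rewrite /et mulr_ge0 ?(ltW ep0) //; lra.
have et1 : et <= ep by rewrite /et; nra.
(* Uses half of the gain [kap * ep]; the other half absorbs the roundings of [r], [t] and [kk]. *)
pose c3' := kap * ep / 4; have c30 : 0 < c3' by rewrite divr_gt0 // mulr_gt0.
have c31 : c3' <= 1 by rewrite /c3'; nra.
exists c3'; split => //; apply: whp_compl => e e0.
(* [A L ^ 2 <= n ^ de] bounds [4 m ^ 2 exp th / n] by [1 / (2 + 4 / e)], which is below both [1 / 2]
   and [e / 4]. *)
pose A : R := 4 * (4 / c) ^+ 2 * (2 + 4 / e).
have e4 : 0 <= 4 / e by rewrite divr_ge0 // ltW.
have [x1 x10 H1] := poly_le_expR A 2 de0.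
have [x2 x20 H2] := poly_le_expR (2 * (4 / c)) 1 (@ltr01 R).
have [x3 x30 H3] := poly_le_expR (2 / e) 0 (@ltr01 R).
have [n1 Hn1] := @ltn_ln_eventually R (1 + x1 + x2 + x3 + 12 * c / (kap * ep)).
exists (maxn 1 n1) => n; rewrite geq_max => /andP[n0 nn1]; split=> //.
set L : R := ln n%:R; have LL : 1 + x1 + x2 + x3 + 12 * c / (kap * ep) <= L := Hn1 n nn1.
have ke0 : 0 < kap * ep by rewrite mulr_gt0.
have x40 : 0 <= 12 * c / (kap * ep) by rewrite divr_ge0 ?(ltW ke0) // mulr_ge0 // ltW.
have L0 : 0 < L by lra.
have nE : n%:R = expR L by rewrite lnK // posrE ltr0n.
have Lc0 : 0 < L / c by rewrite divr_gt0.
pose r := Num.truncn ((2 - et) * (L / c)); pose t := Num.truncn (ep * (L / c)).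
have r1 : r%:R <= (2 - et) * (L / c) by rewrite truncn_le mulr_ge0 ?(ltW Lc0) //; lra.
have r2 : (2 - et) * (L / c) < r%:R + 1 by rewrite natr1 truncnS_gt.
have t1 : t%:R <= ep * (L / c) by rewrite truncn_le mulr_ge0 ?(ltW Lc0) ?(ltW ep0).
have t2 : ep * (L / c) < t%:R + 1 by rewrite natr1 truncnS_gt.
set m := (r + 2 * t)%N.
have mL : m%:R <= 4 / c * L.
  rewrite natrD natrM (_ : 4 / c * L = 4 * (L / c)); last by field; rewrite gt_eqF.
  have := mulr_ge0 et0 (ltW Lc0); have := ler_wpM2r (ltW Lc0) ep1; lra.
have mn : (2 * m <= n)%N.
  rewrite -(ler_nat R) natrM nE; have := H2 L; rewrite expr1 mul1r => H.
  have {}H : 2 * (4 / c) * L <= expR L by apply: H; lra.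
  by apply: le_trans H; rewrite -mulrA ler_wpM2l.
have mn2 : (m <= n)%N by apply: leq_trans mn; exact: leq_pmull.
pose th := (1 - de) * L.
have th0 : 0 <= th by rewrite mulr_ge0 ?(ltW L0) //; lra.
(* The three extra units make [c (kk - 1)] exceed [2 L + c], so that the expected number of
   independent [kk]-sets is at most [1 / n]. *)
pose kk := (Num.truncn (2 * (L / c))).+3.
have kk1 : 2 * (L / c) + 2 < kk%:R.
  have := truncnS_gt (2 * (L / c)); rewrite /kk -[in X in _ -> X]natr1 -natr1 -natr1 => H.
  by rewrite -natr1 in H; lra.
have kk2 : kk%:R <= 2 * (L / c) + 3.
  rewrite /kk -addn3 natrD lerD2r.
  by rewrite truncn_le mulr_ge0 // ltW.
have ee : e = e / 2 + e / 2 by lra.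
rewrite [leRHS]ee.
apply: (mu_orb (P1 := fun E => (kk <= alpha E)%N)
  (P2 := fun E => ~~ [exists f : {ffun template r t -> 'I_n}, injectiveb f && planted f E])) => //.
- move=> E EU; rewrite -ltNge => bpC; case: leqP => //= ak; apply/negP => /existsP[f /andP[/injectiveP fi pf]].
  have bpE := planted_bp fi EU pf.
  have {}bpE : (bp E)%:R <= n%:R - (r%:R + t%:R) :> R.
    move: bpE; rewrite -(ler_nat R) natrD natrB // /m natrD natrM; lra.
  have aE : (alpha E)%:R <= 2 * (L / c) + 2.
    have : ((alpha E)%:R : R) + 1 <= kk%:R by rewrite natr1 ler_nat.
    lra.
  have aE2 : (1 + c3') * (alpha E)%:R <= (1 + c3') * (2 * (L / c) + 2) by rewrite ler_wpM2l //; lra.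
  have big : 12 <= kap * ep * (L / c).
    rewrite mulrA ler_pdivlMr // [leRHS]mulrC -ler_pdivrMr //.
    by apply: le_trans LL; lra.
  have rt : 2 * (L / c) + kap * ep * (L / c) < r%:R + t%:R + 2.
    have -> : 2 * (L / c) + kap * ep * (L / c) = (2 - et) * (L / c) + ep * (L / c) by rewrite /et; ring.
    lra.
  have {}aE2 : (1 + c3') * (alpha E)%:R <= 2 * (L / c) + kap * ep * (L / c) / 2 + 2 + 2 * c3'.
    by apply: le_trans aE2 _; apply: eq_ler; rewrite /c3'; field; rewrite gt_eqF.
  lra.
- apply: le_trans (alpha_ge_prob n kk p01) _.
  rewrite /EX qE expR_bin2; apply: (@le_trans _ _ (expR L ^+ kk * expR (- (c * (kk%:R * (kk%:R - 1) / 2))))).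
    by rewrite ler_wpM2r ?expR_ge0 // -nE -natrX ler_nat bin_le_expn.
  rewrite -expRM_natl -expRD; apply: (@le_trans _ _ (expR (- L))).
    have kc : 2 * L + 2 * c <= kk%:R * c.
      have := ler_wpM2r (ltW c0) (ltW kk1); rewrite mulrDl.
      by rewrite (_ : 2 * (L / c) * c = 2 * L) //; field; rewrite gt_eqF.
    rewrite ler_expR; have kk0 : (0 : R) <= kk%:R by [].
    have : kk%:R * (2 * L + 2 * c) <= kk%:R * (kk%:R * c) by rewrite ler_wpM2l.
    have : 0 <= L by lra.
    nra.
  rewrite expRN; have := H3 L; rewrite expr0 mulr1 mul1r => H.
  have {}H : 2 / e <= expR L by apply: H; lra.
  by rewrite -[e / 2]invf_div lef_pV2 ?posrE ?expR_gt0 ?divr_gt0.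
have Hgain (X s2 s1 : R) : 0 <= X <= r%:R -> 0 <= s2 -> 0 <= s1 -> s2 + s1 <= t%:R ->
     cp p * (X ^+ 2 + (2 * s2 + s1) ^+ 2) / 2 + X * (b * s2 + (b - cp p) * s1) <= th * (X + (2 * s2 + s1)).
  move=> /andP[X0 Xr] s20 s10 ss; rewrite -/c.
  pose u := X / (L / c); pose v := s2 / (L / c); pose w := s1 / (L / c).
  have uE : X = u * (L / c) by rewrite /u divfK // gt_eqF.
  have vE : s2 = v * (L / c) by rewrite /v divfK // gt_eqF.
  have wE : s1 = w * (L / c) by rewrite /w divfK // gt_eqF.
  have Lci : 0 <= (L / c)^-1 by rewrite invr_ge0 ltW.
  have u02 : 0 <= u <= 2 - et.
    by rewrite mulr_ge0 //= /u ler_pdivrMr //; apply: le_trans r1.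
  have v0 : 0 <= v by rewrite mulr_ge0.
  have w0 : 0 <= w by rewrite mulr_ge0.
  have vw : v + w <= ep by rewrite /v /w -mulrDl ler_pdivrMr //; apply: le_trans t1.
  have := quadratic_gain kap0 beE u02 v0 w0 vw; rewrite -/ep -/de => HQ.
  have LL0 : 0 <= L ^+ 2 / c by rewrite divr_ge0 ?sqr_ge0 // ltW.
  have := ler_wpM2l LL0 HQ.
  have -> : c * (X ^+ 2 + (2 * s2 + s1) ^+ 2) / 2 + X * (b * s2 + (b - c) * s1) =
    L ^+ 2 / c * (u ^+ 2 / 2 + (2 * v + w) ^+ 2 / 2 + u * (b / c * v + (b / c - 1) * w)).
    by rewrite uE vE wE; field; rewrite gt_eqF.
  have -> : th * (X + (2 * s2 + s1)) = L ^+ 2 / c * ((1 - de) * (u + 2 * v + w)).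
    by rewrite uE vE wE /th; field; rewrite gt_eqF.
  by [].
apply: le_trans (planted_exists_prob p02 QE th0 mn2 Hgain) _; rewrite -/m.
pose y := (2 + 4 / e)^-1.
have e24 : 0 < 2 + 4 / e by lra.
have y2 : y <= 1 / 2 by rewrite /y div1r lef_pV2 ?posrE //; lra.
have ye : 2 * y <= e / 2.
  have : y <= e / 4.
    by rewrite /y -[e / 4]invf_div lef_pV2 ?posrE ?divr_gt0 //; lra.
  lra.
apply: le_trans ye; apply: planted_numeric => //.
have -> : 4 * m%:R ^+ 2 * expR th / n%:R = 4 * m%:R ^+ 2 / expR (de * L).
  rewrite nE -!expRN -mulrA -expRD; congr (_ * expR _); rewrite /th; ring.
rewrite ler_pdivrMr ?expR_gt0 // /y [leRHS]mulrC ler_pdivlMr //.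
apply: le_trans (H1 L _); last by lra.
have mm : m%:R ^+ 2 <= (4 / c) ^+ 2 * L ^+ 2.
  rewrite -exprMn; apply: lerXn2r; rewrite ?nnegrE //.
  exact: le_trans mL.
rewrite [leRHS](_ : _ = 4 * ((4 / c) ^+ 2 * L ^+ 2) * (2 + 4 / e)); last by rewrite /A; ring.
by rewrite ler_wpM2r ?(ltW e24) // ler_wpM2l.
Qed.

End PartThree.

Theorem theorem1 (R : realType) (p0 : R)
  (hp0 : 4 * p0 ^+ 3 - 7 * p0 ^+ 2 + 5 * p0 - 1 = 0) :
  (* (i) *)
  ((forall p : R, 0 < p < p0 ->
      whp (fun n => Gnp_prob n p (fun E => bp E == (n - alpha E)%N))) /\
   (forall gamma : R, - (1 / 3) < gamma < 0 ->
      whp (fun n => Gnp_prob n ((n%:R : R) `^ gamma)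
                      (fun E => bp E == (n - alpha E)%N)))) /\
  (* (ii) *)
  (forall p : R, p0 <= p < 1 / 2 ->
     exists C : R, 0 < C /\
       whp (fun n => Gnp_prob n p
              (fun E => n%:R - C * (alpha E)%:R <= (bp E)%:R))) /\
  (* (iii) *)
  (forall p : R, p0 < p < 1 / 2 ->
     exists c : R, 0 < c /\
       whp (fun n => Gnp_prob n p
              (fun E => (bp E)%:R <= n%:R - (1 + c) * (alpha E)%:R))).
Proof.
have p00 : 0 < p0 by case: ltP => // p00; move: hp0; nra.
have p02 : p0 < 1 / 2.
  (* The cubic takes the value [1 / 4] at [1 / 2], and the cofactor of [p0 - 1 / 2] is positive. *)
  have : (p0 - 1 / 2) * (4 * p0 ^+ 2 - 5 * p0 + 5 / 2) = - (1 / 4) by rewrite -[RHS]addr0 -hp0; field.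
  have : 0 < 4 * p0 ^+ 2 - 5 * p0 + 5 / 2 by nra.
  by case: ltP => // ? ? ?; nra.
(* The cubic is strictly increasing, so its sign at [p] is decided by comparing [p] with [p0]. *)
have inc (x y : R) : x < y -> 4 * x ^+ 3 - 7 * x ^+ 2 + 5 * x - 1 < 4 * y ^+ 3 - 7 * y ^+ 2 + 5 * y - 1.
  move=> xy; rewrite -subr_gt0.
  rewrite (_ : _ - _ = (y - x) * (4 * (y ^+ 2 + y * x + x ^+ 2) - 7 * (y + x) + 5)); last by ring.
  rewrite mulr_gt0 ?subr_gt0 //; have := sqr_ge0 (y - x); have := sqr_ge0 (y + x - 7 / 6); nra.
split; [split | split].
- move=> p /andP[pp pl]; apply: bp_eq_alpha_constant; first by rewrite pp; exact: lt_trans p02.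
  by rewrite -hp0 inc.
- exact: bp_eq_alpha_power.
- move=> p /andP[pp p2]; apply: bp_lower; rewrite p2 andbT; exact: lt_le_trans pp.
- move=> p /andP[pp p2]; apply: bp_upper; first by rewrite p2 andbT; exact: lt_trans pp.
  by rewrite -hp0 inc.
Qed.
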